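(* Let $F:\mathbb{R}^n\to\mathbb{R}$ be a random ReLU neural network function with hidden layer widths $(n_1,\dots,n_\ell)$, whose parameters (all weights and biases) are drawn as in the context. Then the probability that $F$ is PL Morse equals $$\frac{\sum_{k=n+1}^{n_1}\binom{n_1}{k}}{2^{n_1}}\quad\text{if }\ell=1,$$ and is at most $\dfrac{\sum_{k=n+1}^{n_1}\binom{n_1}{k}}{2^{n_1}}$ if $\ell>1$. (An empty sum is $0$.)
   Context: A ReLU neural network function $F:\mathbb{R}^{n_0}\to\mathbb{R}$ with hidden layer widths $(n_1,\dots,n_\ell)$ is $F=A_{\ell+1}\circ\sigma\circ A_\ell\circ\cdots\circ\sigma\circ A_1$, where $A_i:\mathbb{R}^{n_{i-1}}\to\mathbb{R}^{n_i}$ ($n_{\ell+1}=1$) are affine maps and $\sigma$ applies $\mathrm{ReLU}(t)=\max\{0,t\}$ in each coordinate. Random model: all entries of the weight matrices and bias vectors are i.i.d. with a distribution that is absolutely continuous with respect to Lebesgue measure and symmetric about $0$. PL Morse (for a map $F:\mathbb{R}^n\to\mathbb{R}$, $\mathbb{R}^n$ with its standard PL structure): a point $p$ is PL regular if there is a PL homeomorphism from a neighborhood of $p$ onto a neighborhood of $0\in\mathbb{R}^n$ sending $p$ to $0$ in whose coordinates $F(x)=F(p)+x_n$; $p$ is PL nondegenerate-critical of index $k$ if there is such a chart in which $F(x)=F(p)-|x_1|-\dots-|x_k|+|x_{k+1}|+\dots+|x_n|$; otherwise $p$ is PL degenerate-critical. $F$ is PL Morse if every point is PL regular or PL nondegenerate-critical.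 *)

(* Defs.v *)
From HB Require Import structures.
From mathcomp Require Import all_boot all_order all_algebra.
From mathcomp Require Import all_classical all_reals all_analysis.
Set Implicit Arguments. Unset Strict Implicit. Unset Printing Implicit Defensive.
Import Order.TTheory GRing.Theory Num.Theory.
Import numFieldNormedType.Exports.
Local Open Scope classical_set_scope.
Local Open Scope ring_scope.

Section Defs.
Variable R : realType.

Definition relu (t : R) : R := Num.max 0 t.

(** Parameter indices: (i, j, None) is the bias of neuron j in layer i,
    (i, j, Some k) is the weight from input k to neuron j in layer i.
    Layers are numbered 1..l+1 (layer l+1 is the output affine map). *)
Definition pidx := (nat * nat * option nat)%type.

Definition dims (n : nat) (ns : seq nat) : seq nat := n :: rcons ns 1%N.
Definition dim (n : nat) (ns : seq nat) (i : nat) : nat := nth 0%N (dims n ns) i.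

Definition valid_idx (n : nat) (ns : seq nat) (q : pidx) : bool :=
  let: (i, j, ok) := q in
  [&& (1 <= i)%N, (i <= (size ns).+1)%N, (j < dim n ns i)%N &
      (if ok is Some k then (k < dim n ns i.-1)%N else true)].

Definition layer_affine (th : pidx -> R) (i m : nat) (v : nat -> R) : nat -> R :=
  fun j => \sum_(k < m) th (i, j, Some (k : nat)) * v k + th (i, j, None).

Definition relu_net (n : nat) (ns : seq nat) (th : pidx -> R)
    (x : 'rV[R]_n) : R :=
  let v0 : nat -> R := fun k => \sum_(j < n | nat_of_ord j == k) x ord0 j in
  let hidden := foldl (fun v i => fun j =>
                   relu (layer_affine th i (dim n ns i.-1) v j))
                 v0 (iota 1 (size ns)) in
  layer_affine th (size ns).+1 (dim n ns (size ns)) hidden 0%N.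

Definition is_affine (n m : nat) (f : 'rV[R]_n -> 'rV[R]_m) : Prop :=
  exists (A : 'M[R]_(n, m)) (b : 'rV[R]_m), forall x, f x = x *m A + b.

Definition polytope (n : nat) (s : seq 'rV[R]_n) : set 'rV[R]_n :=
  [set x | exists lam : nat -> R,
     (forall i, 0 <= lam i) /\ \sum_(i < size s) lam i = 1 /\
     x = \sum_(i < size s) lam i *: nth 0 s i].

Definition PL_on (n m : nat) (U : set 'rV[R]_n) (f : 'rV[R]_n -> 'rV[R]_m) : Prop :=
  {within U, continuous f} /\
  forall x, U x -> exists Ps : seq (seq 'rV[R]_n),
    (forall P, P \in Ps -> polytope P `<=` U /\
        exists g, is_affine g /\ {in polytope P, f =1 g}) /\
    nbhs x (\bigcup_(P in [set P | P \in Ps]) polytope P).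

Definition PL_chart_model (n : nat) (F : 'rV[R]_n -> R) (p : 'rV[R]_n)
    (model : 'rV[R]_n -> R) : Prop :=
  exists (U V : set 'rV[R]_n) (h g : 'rV[R]_n -> 'rV[R]_n),
    [/\ open U, open V, U p, V 0 & h p = 0] /\
    [/\ h @` U `<=` V, g @` V `<=` U,
        {in U, cancel h g}, {in V, cancel g h} &
        PL_on U h /\ PL_on V g] /\
    (forall x, V x -> F (g x) = F p + model x).

(** coordinates x_1..x_n are x ord0 j for j : 'I_n, with x_i <-> val j = i-1 *)
Definition PL_regular (n : nat) (F : 'rV[R]_n -> R) (p : 'rV[R]_n) : Prop :=
  PL_chart_model F p (fun x => \sum_(j < n | nat_of_ord j == n.-1) x ord0 j).

Definition PL_nondeg_critical (n : nat) (F : 'rV[R]_n -> R) (p : 'rV[R]_n)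
    (k : nat) : Prop :=
  (k <= n)%N /\
  PL_chart_model F p (fun x => - (\sum_(j < n | (j < k)%N) `|x ord0 j|)
                               + \sum_(j < n | (k <= j)%N) `|x ord0 j|).

Definition PL_Morse (n : nat) (F : 'rV[R]_n -> R) : Prop :=
  forall p, PL_regular F p \/ exists k, PL_nondeg_critical F p k.

End Defs.

Definition iid_params {d} {Om : measurableType d} {R : realType}
    (P : probability Om R) (mu : probability R R) (n : nat) (ns : seq nat)
    (th : pidx -> Om -> R) : Prop :=
  (forall q, valid_idx n ns q -> measurable_fun setT (th q)) /\
  (forall q, valid_idx n ns q -> forall A : set R, measurable A ->
      P (th q @^-1` A) = mu A) /\
  (forall (s : seq pidx) (A : pidx -> set R), uniq s ->
      all (valid_idx n ns) s -> (forall q, measurable (A q)) ->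
      P (\bigcap_(q in [set q | q \in s]) (th q @^-1` A q)) =
      (\prod_(q <- s) P (th q @^-1` A q))%E).

Definition symmetric_law {R : realType} (mu : probability R R) : Prop :=
  forall A : set R, measurable A -> mu [set - x | x in A] = mu A.

(* Main.v *)
Require Import Defs.
From HB Require Import structures.
From mathcomp Require Import all_boot all_order all_algebra fingroup perm.
From mathcomp Require Import all_classical all_reals all_analysis.
From mathcomp Require Import measurable_realfun ring lra.
Set Implicit Arguments. Unset Strict Implicit. Unset Printing Implicit Defensive.
Import Order.TTheory GRing.Theory Num.Theory.
Import numFieldNormedType.Exports.
Local Open Scope classical_set_scope.
Local Open Scope ring_scope.

(** Near a point [p] a ReLU network is [F p] plus a positively homogeneous PL
    function [D] depending only on the parameters and on the signs of the
    pre-activations at [p], and a PL chart at [p] exists if and only if [D] is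
    conjugate to the model by a conical PL homeomorphism, given by two finite
    families of cones with matching generators. With bounds on the generators and
    on the Lipschitz constants these conditions are closed, so the parameters for
    which a sign pattern occurs, and those for which its germ is nondegenerate, are
    countable unions of projections of closed sets along compact sets; hence the
    PL Morse event is measurable.

    If some point has all first-layer pre-activations negative, [F] is constant
    near it and not PL Morse. By symmetry of the law every sign pattern of the
    first layer occurs with the same probability, and [n1] hyperplanes in general
    position realize exactly [\sum_(k <= n) 'C(n1, k)] of the [2 ^ n1] patterns;
    this gives the upper bound. For one hidden layer and generic parameters without
    such a flat point, [D] is in suitable linear coordinates a sum of one-variable
    PL functions: if one of them is monotone the point is regular, otherwise all of
    them are multiples of absolute values up to rescaling each half-line, and the
    point is nondegenerate-critical. *)

(** * Closed sets and continuity *)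

(** Measurability is an issue because the definition quantifies over all points and over arbitrary
    PL charts. A chart can be linearised at its point: it is affine on finitely many polytopes that
    contain the point, so it spans a conical map determined by two finite lists of vectors, which
    range over a finite-dimensional space. Projections along such a space are harmless once it is
    exhausted by compact boxes; this is why explicit bounds accompany every existential. Genericity
    means that two families of determinants do not vanish: minors of the first-layer weights and
    biases, which give general position, and minors whose last row is the gradient of the active
    part of the network, which keep this gradient independent of the kink normals. Each determinant
    is affine in one well-chosen parameter, with a smaller or simpler determinant as slope, so
    Fubini in that parameter and the absence of atoms show that it vanishes with probability zero.
    With several hidden layers, deeper neurons can create further flat regions, so the argument
    leaves only an inequality. *)

Section Closed.
Variable T : topologicalType.
Implicit Type A : set T.

Lemma closed_forall I (P : I -> set T) :
  (forall i, closed (P i)) -> closed [set x | forall i, P i x].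
Proof.
move=> cP x cx i; apply: cP => B /cx[y [Py By]]; exists y; split => //.
Qed.

Lemma closed_imply (Q : Prop) A : closed A -> closed [set x | Q -> A x].
Proof. by move=> cA; apply: (@closed_forall Q (fun=> A)). Qed.

Lemma closed_exists (I : finType) (P : I -> set T) :
  (forall i, closed (P i)) -> closed [set x | exists i, P i x].
Proof.
move=> cP x cx; apply: contrapT => nP.
have : \forall y \near x, forall i, ~ P i y.
  apply: filter_forall => i.
  have oP := closed_openC (cP i).
  by apply: open_nbhs_nbhs; split=> //= Px; apply: nP; exists i.
by move=> /cx[y [[i Pi] /(_ i)]].
Qed.

(** Tube lemma: if no point of the fibre over [x] lies in [Z], compactness of [K] gives one
    neighbourhood of [x] whose fibres all avoid [Z]. *)
Lemma closed_exists_compact (U : topologicalType) (K : set U) (Z : set (T * U)) :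
  compact K -> closed Z -> closed [set x | exists2 l, K l & Z (x, l)].
Proof.
move=> /compact_near_coveringP cK cZ x cx; apply: contrapT => nZ.
have : \forall y \near x, K `<=` (fun l => ~ Z (y, l)).
  apply: (cK T (nbhs x) (fun y l => ~ Z (y, l))) => l Kl.
  have : nbhs (x, l) (~` Z).
    apply: open_nbhs_nbhs; split; first exact: closed_openC.
    by move=> Zl; apply: nZ; exists l.
  move=> [[B C]/= [nB nC] BC]; exists (C, B) => //= -[a b]/= [Ca Bb].
  exact: (BC (b, a)).
by move=> /cx[y [[l Kl Zl] /(_ l Kl)]].
Qed.

End Closed.

Section Continuous.
Variables (R : realType) (T : topologicalType).
Implicit Types f g : T -> R.

Lemma cont_add f g : continuous f -> continuous g ->
  continuous (fun x => f x + g x).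
Proof. by move=> cf cg x; apply: cvgD; [apply: cf | apply: cg]. Qed.

Lemma cont_mul f g : continuous f -> continuous g ->
  continuous (fun x => f x * g x).
Proof. by move=> cf cg x; apply: cvgM; [apply: cf | apply: cg]. Qed.

Lemma cont_opp f : continuous f -> continuous (fun x => - f x).
Proof. by move=> cf x; apply: cvgN; apply: cf. Qed.

Lemma cont_sub f g : continuous f -> continuous g ->
  continuous (fun x => f x - g x).
Proof. by move=> cf cg; apply: cont_add => //; apply: cont_opp. Qed.

Lemma cont_cst (c : R) : continuous (fun _ : T => c).
Proof. by move=> x; apply: cvg_cst. Qed.

Lemma cont_abs f : continuous f -> continuous (fun x => `|f x|).
Proof. by move=> cf x; apply: cvg_norm; apply: cf. Qed.

Lemma cont_sum I (r : seq I) (P : pred I) (F : I -> T -> R) :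
  (forall i, P i -> continuous (F i)) ->
  continuous (fun x => \sum_(i <- r | P i) F i x).
Proof.
move=> cF; elim: r => [|i r IH].
  by under eq_fun do rewrite big_nil; apply: cont_cst.
have [Pi|nPi] := boolP (P i).
  under eq_fun do rewrite big_cons Pi.
  by apply: cont_add => //; apply: cF.
by under eq_fun do rewrite big_cons (negbTE nPi).
Qed.

Lemma cont_relu f : continuous f -> continuous (fun x => relu (f x)).
Proof.
move=> cf; have -> : (fun x => relu (f x)) = (fun x => (f x + `|f x|) * 2^-1).
  apply/funext => x; rewrite /relu; case: (leP 0 (f x)) => h.
    by rewrite ger0_norm // -mulr2n -[f x *+ 2]mulr_natr mulfK.
  by rewrite ltr0_norm // subrr mul0r.
by apply: cont_mul; [apply: cont_add => //; apply: cont_abs | apply: cont_cst].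
Qed.

Lemma closed_fun_le f g : continuous f -> continuous g ->
  closed [set x | f x <= g x].
Proof.
move=> cf cg.
have -> : [set x | f x <= g x] = (fun x => g x - f x) @^-1` [set y | 0 <= y].
  by apply/seteqP; split => x /=; rewrite subr_ge0.
apply: preimage_closed; last exact: closed_ge.
by move=> x _; apply: cont_sub.
Qed.

Lemma closed_fun_eq f g : continuous f -> continuous g ->
  closed [set x | f x = g x].
Proof.
move=> cf cg.
have -> : [set x | f x = g x] = [set x | f x <= g x] `&` [set x | g x <= f x].
  apply/seteqP; split => x /= => [->//|[h1 h2]].
  by apply/eqP; rewrite eq_le h1.
by apply: closedI; apply: closed_fun_le.
Qed.

Lemma cont_mx m n (f : T -> 'M[R]_(m, n)) :
  (forall i j, continuous (fun x => f x i j)) -> continuous f.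
Proof.
move=> cf x A [B nB BA].
have : \forall y \near x, forall ij : 'I_m * 'I_n, B ij.1 ij.2 (f y ij.1 ij.2).
  by apply: filter_forall => ij; apply: (cf ij.1 ij.2 x); apply: nB.
by apply: filterS => y By; apply: BA => i j; apply: (By (i, j)).
Qed.

Lemma cont_norm n (f : T -> 'rV[R]_n) :
  (forall j, continuous (fun x => f x 0 j)) -> continuous (fun x => `|f x|).
Proof.
move=> cf x; apply: (@cvg_norm _ 'rV[R]_n).
by apply: cont_mx => i j; rewrite [i]ord1; apply: cf.
Qed.

End Continuous.

(** * Sup norm of row vectors and Lipschitz maps *)

Section RowNorm.
Variables (R : realType) (n : nat).
Implicit Types x y : 'rV[R]_n.

Lemma entry_le_norm x j : `|x 0 j| <= `|x|.
Proof.
rewrite [leRHS]/Num.norm /= mx_normrE.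
by apply: (le_bigmax _ (fun ij => `|x ij.1 ij.2|) (0, j)).
Qed.

Lemma norm_le_entry x (r : R) : 0 <= r -> (forall j, `|x 0 j| <= r) -> `|x| <= r.
Proof.
move=> r0 xr; rewrite [leLHS]/Num.norm /= mx_normrE; apply/bigmax_leP; split=> //.
by case=> i j _; rewrite [i]ord1; apply: xr.
Qed.

End RowNorm.

Section RowNormMul.
Variables (R : realType) (n : nat).
Implicit Types x y : 'rV[R]_n.

(** The sum of all absolute entries is a crude operator bound; only the existence of some Lipschitz
    constant matters. *)
Lemma norm_mulmx_le m (A : 'M[R]_(n, m)) x :
  `|x *m A| <= (\sum_i \sum_j `|A i j|) * `|x|.
Proof.
have S0 : 0 <= \sum_i \sum_j `|A i j|.
  by apply: sumr_ge0 => i _; apply: sumr_ge0.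
apply: norm_le_entry => [|j]; first by rewrite mulr_ge0.
rewrite mxE mulr_suml; apply: le_trans (ler_norm_sum _ _ _) _.
apply: ler_sum => i _; rewrite normrM mulrC.
apply: ler_pM => //; last exact: entry_le_norm.
by rewrite (bigD1 j) //= lerDl sumr_ge0.
Qed.

Lemma lipschitz_continuous m (f : 'rV[R]_n -> 'rV[R]_m) (K : R) :
  (forall x y, `|f x - f y| <= K * `|x - y|) -> continuous f.
Proof.
move=> fK x A /nbhs_ballP[e /= e0 eA]; apply/nbhs_ballP.
have K1 : 0 < `|K| + 1 by apply: ltr_pwDr.
exists (e / (`|K| + 1)) => /=; first by rewrite divr_gt0.
move=> y; rewrite -ball_normE /= ltr_pdivlMr // => xy; apply: eA.
rewrite -ball_normE /=; apply: le_lt_trans (fK _ _) (le_lt_trans _ xy).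
by rewrite mulrC ler_wpM2l // (le_trans (ler_norm K)) // lerDl.
Qed.

End RowNormMul.

(** * Polytopes as images of compact simplices *)

Section Polytope.
Variables (R : realType) (n : nat).
Implicit Types (s : seq 'rV[R]_n) (x : 'rV[R]_n).

(** Packs the weights, a function on [nat], into a row vector, so that they range over a simplex in
    a finite-dimensional space, where compactness applies. *)
Lemma polytopeP s x : polytope s x <-> exists2 l : 'rV[R]_(size s),
  (forall i, 0 <= l 0 i) /\ \sum_i l 0 i = 1 & x = \sum_i l 0 i *: nth 0 s i.
Proof.
split=> [[lam [lam0 [lam1 ->]]]|[l [l0 l1] ->]].
  exists (\row_i lam i); first split.
  - by move=> i; rewrite mxE.
  - by rewrite -lam1; apply: eq_bigr => i _; rewrite mxE.
  by apply: eq_bigr => i _; rewrite mxE.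
exists (fun i => if insub i is Some j then l 0 j else 0); split; last split.
- by move=> i; case: insubP.
- by rewrite -l1; apply: eq_bigr => i _; rewrite valK.
by apply: eq_bigr => i _; rewrite valK.
Qed.

Lemma polytope_closed s : closed (polytope s).
Proof.
pose K := [set l : 'rV[R]_(size s) | (forall i, 0 <= l 0 i) /\ \sum_i l 0 i = 1].
have Kcl : closed K.
  apply: closedI.
    apply: closed_forall => i; apply: closed_fun_le; first exact: cont_cst.
    exact: coord_continuous.
  apply: closed_fun_eq; last exact: cont_cst.
  by apply: cont_sum => i _; apply: coord_continuous.
have Kco : compact K.
  apply: bounded_closed_compact => //; exists 1; split; first exact: num_real.
  move=> r r1 l [l0 l1] /=; apply: le_trans (ltW r1).
  apply: norm_le_entry => // j; rewrite ger0_norm // -l1 (bigD1 j) //=.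
  by rewrite lerDl sumr_ge0.
have -> : polytope s = (fun l : 'rV[R]_(size s) => \sum_i l 0 i *: nth 0 s i) @` K.
  apply/seteqP; split => x /=; first by move/polytopeP => [l Kl ->]; exists l.
  by move=> [l Kl <-]; apply/polytopeP; exists l.
apply: compact_closed; first exact: norm_hausdorff.
apply: continuous_compact => //; apply: continuous_subspaceT.
apply: cont_mx => i j; under eq_fun do rewrite summxE.
apply: cont_sum => k _; under eq_fun do rewrite mxE.
by apply: cont_mul; [apply: coord_continuous | apply: cont_cst].
Qed.

End Polytope.

(** * Local structure of PL maps *)

Section SegmentLipschitz.
Variables (R : realType) (m : nat).

(* Peel off one set [A]: between [inf A] and [sup A] the bound holds by
   assumption, and the two outer intervals are covered by the other sets, whose
   union is closed. *)
Lemma lipschitz_cover_segment N (A : nat -> set R) (phi : R -> 'rV[R]_m) (K : R) :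
  (forall i, closed (A i)) ->
  (forall i s t, A i s -> A i t -> `|phi t - phi s| <= K * `|t - s|) ->
  forall a b, a <= b ->
  (forall t, a <= t <= b -> exists2 i, (i < N)%N & A i t) ->
  `|phi b - phi a| <= K * (b - a).
Proof.
move=> cA lA; elim: N => [|N IH] a b ab cov.
  by have [|i] := cov a; rewrite ?lexx.
pose U := [set t | exists i : 'I_N, A i t].
have cU : closed U by apply: closed_exists.
pose B := [set t | (a <= t <= b) /\ A N t].
have notB t : a <= t <= b -> ~ B t -> U t.
  move=> tab nB; have [i] := cov t tab; rewrite ltnS leq_eqVlt => /orP[/eqP->|iN] At.
    by case: nB.
  by exists (Ordinal iN).
have IHU c d : c <= d -> (forall t, c <= t <= d -> U t) ->
    `|phi d - phi c| <= K * (d - c).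
  by move=> cd h; apply: IH => // t /h[i At]; exists i.
have cB : closed B.
  have -> : B = ([set t | a <= t] `&` [set t | t <= b]) `&` A N.
    by apply/seteqP; split => t /= => [[/andP[]]|[[ha hb] At]] //; split=> //; apply/andP.
  by apply: closedI => //; apply: closedI; [exact: closed_ge | exact: closed_le].
have [[t0 Bt0]|nB] := pselect (exists t, B t); last first.
  by apply: IHU => // t tab; apply: notB => // Bt; apply: nB; exists t.
have Bub : has_ubound B by exists b => t [/andP[]].
have Blb : has_lbound B by exists a => t [/andP[]].
have Bne : B !=set0 by exists t0.
have Bv : B (sup B) by apply: cB; apply: closure_sup.
have Bu : B (inf B).
  apply: cB => X /nbhs_ballP[e /= e0 eX].
  have [t Bt tlt] := inf_adherent e0 (conj Bne Blb).
  exists t; split=> //; apply: eX; rewrite -ball_normE /=.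
  rewrite distrC ger0_norm ?subr_ge0; last exact: ge_inf.
  by rewrite ltrBlDl.
set u := inf B in Bu *; set v := sup B in Bv *.
have uv : u <= v by apply: ub_le_sup.
have [[/andP[au ub] Au] [/andP[av vb] Av]] := (Bu, Bv).
have h1 : `|phi u - phi a| <= K * (u - a).
  have [->|nau] := eqVneq a u; first by rewrite !subrr normr0 mulr0.
  have ltau : a < u by rewrite lt_neqAle nau.
  apply: IHU => // t /andP[at_ tu]; have [->|ntu] := eqVneq t u; last first.
    apply: notB; first by rewrite at_ (le_trans tu).
    by move=> /(ge_inf Blb); rewrite leNgt lt_neqAle ntu tu.
  (* The endpoint [u] belongs to [B]; it still lies in the closed set [U], as a limit of the points
     just left of it, which are outside [B]. *)
  apply: cU => X /nbhs_ballP[e /= e0 eX].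
  pose s := Num.max a (u - e / 2).
  have su : s < u by rewrite gt_max ltau ltrBlDr ltrDl divr_gt0.
  exists s; split.
    apply: notB; first by rewrite le_max lexx /= (le_trans (ltW su)).
    by move=> /(ge_inf Blb); rewrite leNgt su.
  apply: eX; rewrite -ball_normE /= ger0_norm ?subr_ge0 ?(ltW su) //.
  rewrite ltrBlDl addrC -ltrBlDl.
  by rewrite lt_max; apply/orP; right; rewrite ltrD2l ltrN2 ltr_pdivrMr // mulr_natr mulr2n ltrDl.
have h2 : `|phi b - phi v| <= K * (b - v).
  have [->|nvb] := eqVneq v b; first by rewrite !subrr normr0 mulr0.
  have ltvb : v < b by rewrite lt_neqAle nvb.
  apply: IHU => // t /andP[vt tb]; have [->|ntv] := eqVneq t v; last first.
    apply: notB; first by rewrite tb (le_trans av).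
    by move=> /(ub_le_sup Bub); rewrite leNgt lt_neqAle eq_sym ntv vt.
  apply: cU => X /nbhs_ballP[e /= e0 eX].
  pose s := Num.min b (v + e / 2).
  have su : v < s by rewrite lt_min ltvb ltrDl divr_gt0.
  exists s; split.
    apply: notB; first by rewrite ge_min lexx /= (le_trans av) ?(ltW su).
    by move=> /(ub_le_sup Bub); rewrite leNgt su.
  apply: eX; rewrite -ball_normE /= distrC ger0_norm ?subr_ge0 ?(ltW su) //.
  rewrite ltrBlDl gt_min; apply/orP; right.
  by rewrite ltrD2l ltr_pdivrMr // mulr_natr mulr2n ltrDl.
have h3 := lA N u v Au Av.
rewrite [`|v - u|]ger0_norm ?subr_ge0 // in h3.
have -> : phi b - phi a = (phi b - phi v) + ((phi v - phi u) + (phi u - phi a)).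
  by rewrite !addrA !subrK.
have -> : K * (b - a) = K * (b - v) + (K * (v - u) + K * (u - a)).
  by rewrite -!mulrDr !addrA !subrK.
apply: le_trans (ler_normD _ _) (lerD h2 _).
exact: le_trans (ler_normD _ _) (lerD h3 h1).
Qed.

Lemma lipschitz_cover n N (Q : nat -> set 'rV[R]_n) (f : 'rV[R]_n -> 'rV[R]_m)
    (K : R) x y :
  (forall i, closed (Q i)) ->
  (forall i y z, Q i y -> Q i z -> `|f y - f z| <= K * `|y - z|) ->
  (forall t, 0 <= t <= 1 -> exists2 i, (i < N)%N & Q i (x + t *: (y - x))) ->
  `|f y - f x| <= K * `|y - x|.
Proof.
move=> cQ lQ cov.
pose c t := x + t *: (y - x).
have cc : continuous c.
  apply: cont_mx => i j; rewrite /c.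
  under eq_fun do rewrite !mxE.
  apply: cont_add; first exact: cont_cst.
  by apply: cont_mul; [move=> ?; apply: cvg_id | apply: cont_cst].
have := @lipschitz_cover_segment N (fun i => c @^-1` Q i) (f \o c) (K * `|y - x|).
have -> : f y - f x = (f \o c) 1 - (f \o c) 0.
  by rewrite /= /c scale1r scale0r addr0 subrKC.
move=> /(_ _ _ 0 1) h; have := h; rewrite subr0 mulr1; apply=> //.
- by move=> i; apply: preimage_closed => // ? _; apply: cc.
- move=> i s t Qs Qt /=; apply: le_trans (lQ i _ _ Qt Qs) _.
  rewrite /c opprD addrACA subrr add0r -scalerBl normrZ.
  by rewrite -!mulrA [`|t - s| * _]mulrC.
Qed.

End SegmentLipschitz.

Section Germ.
Variables (R : realType) (n m : nat).
Implicit Types (U : set 'rV[R]_n) (f : 'rV[R]_n -> 'rV[R]_m) (Ps : seq (seq 'rV[R]_n)).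

Lemma PL_germ U f x : PL_on U f -> U x -> exists Ps (e : R),
  [/\ 0 < e,
      forall P, P \in Ps -> [/\ polytope P x, polytope P `<=` U &
         exists g, is_affine g /\ {in polytope P, f =1 g}] &
      forall y : 'rV[R]_n, `|y - x| < e -> exists2 P, P \in Ps & polytope P y].
Proof.
move=> [_ fP] /fP[Ps [PsP cov]].
have : \forall y \near x, forall i : 'I_(size Ps),
    polytope (nth [::] Ps i) y -> polytope (nth [::] Ps i) x.
  apply: (@filter_forall _ _ (fun (i : 'I_(size Ps)) y =>
    polytope (nth [::] Ps i) y -> polytope (nth [::] Ps i) x) (nbhs x) _) => i.
  have [Px|nPx] := pselect (polytope (nth [::] Ps i) x).
    by apply: filterE.
  have : \forall y \near x, ~ polytope (nth [::] Ps i) y.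
    by apply: open_nbhs_nbhs; split=> //; apply: closed_openC; apply: polytope_closed.
  by apply: filterS => y nPy Py.
move=> /(filterI cov)/nbhs_ballP[e /= e0 eP].
exists [seq P <- Ps | `[< polytope P x >]], e; split=> //.
  move=> P; rewrite mem_filter => /andP[/asboolP Px PPs].
  by have [PU Pg] := PsP P PPs.
move=> y yx; have [|[P PPs Py] h] := eP y; first by rewrite -ball_normE /= distrC.
exists P => //; rewrite mem_filter; apply/andP; split=> //; apply/asboolP.
move: Py; have /(nthP [::])[i si <-] := PPs.
exact: (h (Ordinal si)).
Qed.

Lemma exists_uniform_bound (T : eqType) (s : seq T) (Phi : T -> R -> Prop) :
  (forall a K K', Phi a K -> K <= K' -> Phi a K') ->
  (forall a, a \in s -> exists K, Phi a K) ->
  exists2 K, 0 <= K & forall a, a \in s -> Phi a K.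
Proof.
move=> mono; elim: s => [|a s IH] h; first by exists 0.
have [K K0 hK] : exists2 K, 0 <= K & forall a, a \in s -> Phi a K.
  by apply: IH => b bs; apply: h; rewrite inE bs orbT.
have [K' hK'] := h a (mem_head _ _).
exists (Num.max K K'); first by rewrite le_max K0.
move=> b; rewrite inE => /orP[/eqP->|/hK hb].
  by apply: mono hK' _; rewrite le_max lexx orbT.
by apply: mono hb _; rewrite le_max lexx.
Qed.

(** Affine pieces bound [f] only within one piece. Two points of the ball are joined by a segment
    that stays in the ball by convexity and is covered by the closed pieces, and the bounds add up
    along it. *)
Lemma PL_locally_lipschitz U f x : PL_on U f -> U x -> exists (e K : R),
  [/\ 0 < e, 0 <= K, ball x e `<=` U & forall y z : 'rV[R]_n, `|y - x| < e -> `|z - x| < e ->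
    `|f y - f z| <= K * `|y - z|].
Proof.
move=> fPL Ux; have [Ps [e [e0 PsP cov]]] := PL_germ fPL Ux.
have [K K0 KP] : exists2 K : R, 0 <= K & forall P, P \in Ps ->
    forall y z, polytope P y -> polytope P z -> `|f y - f z| <= K * `|y - z|.
  apply: (@exists_uniform_bound _ Ps (fun P K =>
    forall y z, polytope P y -> polytope P z -> `|f y - f z| <= K * `|y - z|)).
    move=> P K K' h KK' y z Py Pz; apply: le_trans (h y z Py Pz) _.
    exact: ler_wpM2r.
  move=> P /PsP[_ _ [g [[A [b gE]] fg]]].
  exists (\sum_i \sum_j `|A i j|) => y z Py Pz.
  rewrite !fg ?inE // !gE opprD addrACA subrr addr0 -mulmxBl.
  exact: norm_mulmx_le.
exists e, K; split=> // [y|y z ye ze].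
  rewrite -ball_normE /= distrC => /cov[P /PsP[_ PU _]]; exact: PU.
apply: (@lipschitz_cover R m n (size Ps)
   (fun i => if (i < size Ps)%N then polytope (nth [::] Ps i) else set0)).
- move=> i; case: ifP => _; [exact: polytope_closed | exact: closed0].
- move=> i a b; case: ifP => // si; apply: KP; exact: mem_nth.
- move=> t /andP[t0 t1]; have [|P PPs Py] := cov (z + t *: (y - z)).
    have -> : z + t *: (y - z) - x = (1 - t) *: (z - x) + t *: (y - x).
      by apply/rowP => j; rewrite !mxE; ring.
    apply: le_lt_trans (ler_normD _ _) _; rewrite !normrZ (ger0_norm t0).
    rewrite ger0_norm ?subr_ge0 //.
    have [->|nt] := eqVneq t 0; first by rewrite subr0 mul1r mul0r addr0.
    have tp : 0 < t by rewrite lt_def nt.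
    have -> : e = (1 - t) * e + t * e by rewrite -mulrDl subrK mul1r.
    apply: ler_ltD; first by rewrite ler_wpM2l ?subr_ge0 // ltW.
    by rewrite ltr_pM2l.
  exists (index P Ps); rewrite index_mem PPs // nth_index //.
Qed.

End Germ.

(** * Conical PL homeomorphisms *)

Section PolytopeConvex.
Variables (R : realType) (n : nat) (P : seq 'rV[R]_n).

Lemma polytope_vertex x j : (j < size P)%N -> polytope P (nth x P j).
Proof.
move=> sj; apply/polytopeP; exists (\row_k (k == Ordinal sj)%:R); first split.
- by move=> i; rewrite mxE ler0n.
- rewrite (bigD1 (Ordinal sj)) //= mxE eqxx big1 ?addr0 // => i /negbTE ni.
  by rewrite mxE ni.
rewrite (bigD1 (Ordinal sj)) //= mxE eqxx scale1r big1 ?addr0 => [|i /negbTE ni].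
  exact: set_nth_default.
by rewrite mxE ni scale0r.
Qed.

Lemma polytope_convex (I : finType) (c : I -> R) (y : I -> 'rV[R]_n) :
  (forall i, 0 <= c i) -> \sum_i c i = 1 -> (forall i, polytope P (y i)) ->
  polytope P (\sum_i c i *: y i).
Proof.
move=> c0 c1 yP.
have /choice[l lP] i : exists l : 'rV[R]_(size P), [/\ forall j, 0 <= l 0 j,
    \sum_j l 0 j = 1 & y i = \sum_j l 0 j *: nth 0 P j].
  by have /polytopeP[l [l0 l1] yE] := yP i; exists l.
apply/polytopeP; exists (\row_j \sum_i c i * l i 0 j); first split.
- move=> j; rewrite mxE; apply: sumr_ge0 => i _; rewrite mulr_ge0 //.
  by have [] := lP i.
- under eq_bigr do rewrite mxE.
  rewrite exchange_big /= -[RHS]c1; apply: eq_bigr => i _.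
  by rewrite -mulr_sumr; have [_ -> _] := lP i; rewrite mulr1.
under [RHS]eq_bigr do rewrite mxE scaler_suml.
rewrite [RHS]exchange_big /=; apply: eq_bigr => i _.
have [_ _ {1}->] := lP i; rewrite scaler_sumr; apply: eq_bigr => j _.
by rewrite scalerA.
Qed.

End PolytopeConvex.

Section Conic.
Variables (R : realType) (n : nat).

Definition nneg m (l : 'rV[R]_m) : Prop := forall j, 0 <= l 0 j.

Definition conic_cover N m (V : 'I_N -> 'M[R]_(m, n)) (C : R) : Prop :=
  forall x : 'rV[R]_n, exists i, exists l : 'rV[R]_m,
    [/\ nneg l, forall j, l 0 j <= C * `|x| & x = l *m V i].

Definition conic_lip N m (V W : 'I_N -> 'M[R]_(m, n)) (C : R) : Prop :=
  forall i j (k l : 'rV[R]_m), nneg k -> nneg l ->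
    `|k *m V i - l *m V j| <= C * `|k *m W i - l *m W j|.

(* [V i] and [W i] list generators of corresponding cones; the graph
   [l *m V i |-> l *m W i] is then a conical bi-Lipschitz PL homeomorphism
   carrying [D] to [md]. The bounds by [C] make all conditions closed in
   [(V, W)]. *)
Definition conic_matching (D md : 'rV[R]_n -> R) N m
    (V W : 'I_N -> 'M[R]_(m, n)) (C : R) : Prop :=
  [/\ conic_cover V C, conic_cover W C, conic_lip V W C, conic_lip W V C &
      forall i (l : 'rV[R]_m), nneg l -> D (l *m V i) = md (l *m W i)].

Definition conic_equiv (D md : 'rV[R]_n -> R) : Prop :=
  exists N m (V W : 'I_N -> 'M[R]_(m, n)) (C : R),
    0 <= C /\ conic_matching D md V W C.

Definition pos_homogeneous (D : 'rV[R]_n -> R) : Prop :=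
  forall t x, 0 <= t -> D (t *: x) = t * D x.

Lemma nnegZ m (l : 'rV[R]_m) t : 0 <= t -> nneg l -> nneg (t *: l).
Proof. by move=> t0 l0 j; rewrite mxE mulr_ge0. Qed.

Lemma conic_cover_le N m (V : 'I_N -> 'M[R]_(m, n)) C C' :
  C <= C' -> conic_cover V C -> conic_cover V C'.
Proof.
move=> CC' cV x; have [i [l [l0 lC xE]]] := cV x; exists i, l; split=> // j.
by apply: le_trans (lC j) _; apply: ler_wpM2r.
Qed.

Lemma conic_lip_le N m (V W : 'I_N -> 'M[R]_(m, n)) C C' :
  C <= C' -> conic_lip V W C -> conic_lip V W C'.
Proof.
move=> CC' cV i j k l k0 l0; apply: le_trans (cV i j k l k0 l0) _.
exact: ler_wpM2r.
Qed.

Lemma conic_matching_le D md N m (V W : 'I_N -> 'M[R]_(m, n)) C C' :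
  C <= C' -> conic_matching D md V W C -> conic_matching D md V W C'.
Proof.
by move=> CC' [h1 h2 h3 h4 h5]; split=> //;
  [apply: conic_cover_le h1|apply: conic_cover_le h2|
   apply: conic_lip_le h3|apply: conic_lip_le h4].
Qed.

(** Rescale [x] to norm [e / 2], inside the ball; scaling the coefficients back multiplies the bound
    [1] by the factor [2 / e] times the norm of [x]. *)
Lemma conic_cover_local N m (V : 'I_N -> 'M[R]_(m, n)) e : 0 < e ->
  (forall x : 'rV[R]_n, `|x| < e -> exists i, exists l : 'rV[R]_m,
    [/\ nneg l, forall j, l 0 j <= 1 & x = l *m V i]) ->
  conic_cover V (2 / e).
Proof.
move=> e0 h x; have [->|x0] := eqVneq x 0.
  have [|i [l [l0 l1 xE]]] := h 0; first by rewrite normr0.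
  exists i, 0; split=> [j|j|]; rewrite ?mxE ?normr0 ?mulr0 //.
  by rewrite mul0mx.
have nx0 : 0 < `|x| by rewrite normr_gt0.
pose t := e / (2 * `|x|).
have t0 : 0 < t by rewrite divr_gt0 // mulr_gt0.
have tn : t * `|x| = e / 2 by rewrite /t invfM mulrA mulfVK ?gt_eqF.
have [|i [l [l0 l1 xE]]] := h (t *: x).
  by rewrite normrZ gtr0_norm // tn ltr_pdivrMr // mulr_natr mulr2n ltrDl.
have tV : 2 / e * `|x| = t^-1 by rewrite /t invf_div mulrAC.
exists i, (t^-1 *: l); split.
- by apply: nnegZ => //; rewrite invr_ge0 ltW.
- by move=> j; rewrite mxE tV ger_pMr ?invr_gt0.
by rewrite -scalemxAl -xE scalerA mulVf ?scale1r ?gt_eqF.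
Qed.

(** The common step size for all perturbation arguments below: one [t] that respects finitely many
    strict inequalities. *)
Lemma exists_small_scale (I : finType) (a b : I -> R) :
  (forall i, 0 < b i) -> exists2 t : R, 0 < t & forall i, t * a i < b i.
Proof.
move=> b0; have S0 : 0 <= \sum_j `|a j| / b j.
  by apply: sumr_ge0 => j _; rewrite divr_ge0 // ltW.
have S1 : 0 < \sum_j `|a j| / b j + 1 by apply: ltr_pwDr.
exists (\sum_j `|a j| / b j + 1)^-1; first by rewrite invr_gt0.
move=> i; rewrite mulrC ltr_pdivrMr // mulrC -ltr_pdivrMr //.
apply: (@le_lt_trans _ _ (`|a i| / b i)).
  by rewrite ler_pM2r ?invr_gt0 // ler_norm.
rewrite (bigD1 i) //= -addrA ltrDl ltr_pwDr //.
by apply: sumr_ge0 => j _; rewrite divr_ge0 // ltW.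
Qed.

(** Both sides are homogeneous of degree one, so [k] and [l] may be scaled down by a common
    factor. *)
Lemma conic_lip_local N m (V W : 'I_N -> 'M[R]_(m, n)) C e : 0 < e ->
  (forall i j (k l : 'rV[R]_m), nneg k -> nneg l ->
    \sum_a k 0 a < e -> \sum_a l 0 a < e ->
    `|k *m V i - l *m V j| <= C * `|k *m W i - l *m W j|) ->
  conic_lip V W C.
Proof.
move=> e0 h i j k l k0 l0.
have [t t0 ht] := @exists_small_scale bool
  (fun b => if b then \sum_a k 0 a else \sum_a l 0 a) (fun=> e) (fun=> e0).
have sumZ (u : 'rV[R]_m) : \sum_a (t *: u) 0 a = t * \sum_a u 0 a.
  by rewrite mulr_sumr; apply: eq_bigr => a _; rewrite mxE.
have := h i j (t *: k) (t *: l) (nnegZ (ltW t0) k0) (nnegZ (ltW t0) l0).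
rewrite !sumZ => /(_ (ht true) (ht false)).
rewrite -!scalemxAl -!scalerBr !normrZ gtr0_norm // mulrCA.
by rewrite ler_pM2l.
Qed.

(** Every polytope in the germ of [h] at [p] contains [p], and [h] is affine on it with [h p = 0].
    Hence [h] is linear on the cone spanned by the vertices seen from [p], and the images of the
    vertices generate the target cone. The local Lipschitz bounds of [h] and [g] give the two
    distance estimates near the apex, and homogeneity spreads everything to the full cones. *)
Lemma PL_chart_conic (F D md : 'rV[R]_n -> R) (p : 'rV[R]_n) (r : R) : 0 < r ->
  pos_homogeneous D -> pos_homogeneous md ->
  (forall x : 'rV[R]_n, `|x| < r -> F (p + x) = F p + D x) ->
  PL_chart_model F p md -> conic_equiv D md.
Proof.
move=> r0 hD hmd FD [U [V [h [g]]]].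
move=> [[oU oV Up V0 hp] [[hU gV hg gh [PLh PLg]] FE]].
have g0 : g 0 = p by rewrite -hp hg ?inE.
have [Ps [e [e0 PsP cov]]] := PL_germ PLh Up.
have [eh [Kh [eh0 Kh0 ehU hlip]]] := PL_locally_lipschitz PLh Up.
have [eg [Kg [eg0 Kg0 egV glip]]] := PL_locally_lipschitz PLg V0.
(* One generator count for all cones, since [V] and [W] are families of matrices of a single
   size. *)
pose B := \max_(P <- Ps) size P.
(* [nth] defaults to [p], so the generators of each cone are padded with zeros. *)
pose Vm (i : 'I_(size Ps)) : 'M[R]_(B, n) :=
  \matrix_(j < B, c < n) (nth p (nth [::] Ps i) j - p) 0 c.
pose Wm (i : 'I_(size Ps)) : 'M[R]_(B, n) :=
  \matrix_(j < B, c < n) h (nth p (nth [::] Ps i) j) 0 c.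
have sB i : (size (nth [::] Ps i) <= B)%N.
  have [si|si] := ltnP i (size Ps); last by rewrite nth_default.
  by apply: (@leq_bigmax_seq _ Ps xpredT size) => //; apply: mem_nth.
have VE i (l : 'rV[R]_B) : l *m Vm i =
    \sum_(j < B) l 0 j *: (nth p (nth [::] Ps i) j - p).
  apply/rowP => c; rewrite mxE summxE; apply: eq_bigr => j _.
  by rewrite !mxE.
have WE i (l : 'rV[R]_B) : l *m Wm i =
    \sum_(j < B) l 0 j *: h (nth p (nth [::] Ps i) j).
  apply/rowP => c; rewrite mxE summxE; apply: eq_bigr => j _.
  by rewrite !mxE.
have memPs i : nth [::] Ps (i : 'I_(size Ps)) \in Ps by apply: mem_nth.
have vP (i : 'I_(size Ps)) j : polytope (nth [::] Ps i) (nth p (nth [::] Ps i) j).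
  have [sj|sj] := ltnP j (size (nth [::] Ps i)); first exact: polytope_vertex.
  by rewrite (nth_default p sj); case: (PsP _ (memPs i)).
have inP (i : 'I_(size Ps)) (l : 'rV[R]_B) : nneg l -> \sum_a l 0 a <= 1 ->
    polytope (nth [::] Ps i) (p + l *m Vm i).
  move=> l0 l1.
  (* The missing weight [1 - \sum_a l 0 a] goes to [p], which lies in every polytope. *)
  pose c (o : 'I_B.+1) := if unlift ord0 o is Some j then l 0 j else 1 - \sum_a l 0 a.
  pose y (o : 'I_B.+1) := if unlift ord0 o is Some j
    then nth p (nth [::] Ps i) (j : 'I_B) else p.
  have -> : p + l *m Vm i = \sum_o c o *: y o.
    rewrite big_ord_recl /c /y unlift_none /=.
    under [X in _ = _ + X]eq_bigr do rewrite liftK.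
    rewrite VE scalerBl scale1r -addrA; congr (_ + _).
    rewrite addrC scaler_suml -sumrB; apply: eq_bigr => j _.
    by rewrite scalerBr.
  apply: polytope_convex.
  - by move=> o; rewrite /c; case: unlift => [j|] //; rewrite subr_ge0.
  - rewrite big_ord_recl /c unlift_none /=.
    by under [X in _ + X]eq_bigr do rewrite liftK; rewrite subrK.
  - move=> o; rewrite /y; case: unlift => [j|] //.
    by case: (PsP _ (memPs i)).
have hV i (l : 'rV[R]_B) : nneg l -> \sum_a l 0 a <= 1 ->
    h (p + l *m Vm i) = l *m Wm i.
  move=> l0 l1; have [pP _ [f [[A [b fE]] hf]]] := PsP _ (memPs i).
  have pAb : p *m A + b = 0 by rewrite -fE -hf ?inE.
  rewrite hf ?inE; last exact: inP.
  rewrite fE mulmxDl addrAC pAb add0r VE WE mulmx_suml; apply: eq_bigr => j _.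
  rewrite -scalemxAl hf ?inE; last exact: vP.
  by rewrite fE mulmxBl -[p *m A](addrK b) pAb sub0r opprK.
have sumle1 (l : 'rV[R]_B) : nneg l -> \sum_a l 0 a <= 1 -> forall j, l 0 j <= 1.
  move=> l0 l1 j; apply: le_trans l1; rewrite (bigD1 j) //= lerDl.
  exact: sumr_ge0.
have covV (x : 'rV[R]_n) : `|x| < e -> exists i, exists l : 'rV[R]_B,
    [/\ nneg l, \sum_a l 0 a <= 1 & x = l *m Vm i].
  move=> xe; have [|P PPs [lam [lam0 [lam1 xE]]]] := cov (p + x).
    by rewrite addrC addKr.
  have iP : (index P Ps < size Ps)%N by rewrite index_mem.
  pose i := Ordinal iP; have Pi : nth [::] Ps i = P by rewrite nth_index.
  pose l : 'rV[R]_B := \row_j (if (j < size P)%N then lam j else 0).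
  have sP : (size P <= B)%N by rewrite -Pi.
  have lE (X : lmodType R) (f : nat -> X) : \sum_(j < B) l 0 j *: f j =
      \sum_(j < size P) lam j *: f j.
    rewrite (big_ord_widen _ (fun j => lam j *: f j) sP) [RHS]big_mkcond /=.
    by apply: eq_bigr => j _; rewrite mxE; case: ifP => // _; rewrite scale0r.
  exists i, l; split.
  - by move=> j; rewrite mxE; case: ifP.
  - have := lE R^o (fun=> 1); under eq_bigr do rewrite /GRing.scale /= mulr1.
    by move=> ->; under eq_bigr do rewrite /GRing.scale /= mulr1; rewrite lam1.
  rewrite VE Pi (lE _ (fun j => nth p P j - p)).
  under eq_bigr do rewrite scalerBr.
  rewrite sumrB -scaler_suml lam1 scale1r; apply/eqP; rewrite eq_sym subr_eq.
  rewrite addrC xE eq_sym; apply/eqP/eq_bigr => j _; congr (_ *: _).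
  exact: set_nth_default.
(* On this radius [g] is [Kg]-Lipschitz and lands within [e] of [p], where the cones [Vm] are known
   to cover. *)
pose ew := Num.min eg (e / (Kg + 1)).
have Kg1 : 0 < Kg + 1 by apply: ltr_pwDr.
have ew0 : 0 < ew by rewrite lt_min eg0 divr_gt0.
have covW (y : 'rV[R]_n) : `|y| < ew -> exists i, exists l : 'rV[R]_B,
    [/\ nneg l, \sum_a l 0 a <= 1 & y = l *m Wm i].
  rewrite lt_min => /andP[yg]; rewrite ltr_pdivlMr // => ye.
  have Vy : V y by apply: egV; rewrite -ball_normE /= sub0r normrN.
  have [|i [l [l0 l1 lE]]] := covV (g y - p).
    rewrite -g0; apply: le_lt_trans (glip y 0 _ _) _; rewrite ?subr0 ?normr0 //.
    apply: le_lt_trans ye; rewrite mulrC ler_wpM2l // lerDl //.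
  exists i, l; split=> //; rewrite -hV // -lE addrC subrK gh //.
  exact/mem_set.
(* Small coefficients yield small vectors on both sides at once, so the local estimates for [h], [g]
   and [F] all apply. *)
have near0 (d : R) : 0 < d -> exists2 c : R, 0 < c & forall i (l : 'rV[R]_B),
    nneg l -> \sum_a l 0 a < c ->
    [/\ \sum_a l 0 a <= 1, `|l *m Vm i| < d & `|l *m Wm i| < d].
  move=> d0.
  pose S := \sum_i \sum_a \sum_b (`|Vm i a b| + `|Wm i a b|) + 1.
  have S0 : 0 < S.
    by apply: ltr_pwDr => //; do 3 apply: sumr_ge0 => ? _; rewrite addr_ge0.
  have bnd (M : 'M[R]_(B, n)) (l : 'rV[R]_B) : nneg l ->
      \sum_a \sum_b `|M a b| <= S - 1 -> S * \sum_a l 0 a < d -> `|l *m M| < d.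
    move=> l0 MS lS; apply: le_lt_trans (norm_mulmx_le M l) _.
    apply: le_lt_trans lS; apply: ler_pM => //.
    - by do 2 apply: sumr_ge0 => ? _.
    - by apply: le_trans MS _; rewrite gerBl.
    apply: norm_le_entry; first by apply: sumr_ge0.
    move=> j; rewrite ger0_norm // (bigD1 j) //= lerDl.
    exact: sumr_ge0.
  exists (Num.min 1 (d / S)); first by rewrite lt_min ltr01 divr_gt0.
  move=> i l l0; rewrite lt_min => /andP[l1]; rewrite ltr_pdivlMr // mulrC => lS.
  split; first exact: ltW.
    apply: bnd => //; rewrite /S addrK (bigD1 i) //=.
    apply: (@le_trans _ _ (\sum_a \sum_b (`|Vm i a b| + `|Wm i a b|))).
      by do 2 apply: ler_sum => ? _; rewrite lerDl.
    by rewrite lerDl; do 3 apply: sumr_ge0 => ? _; rewrite addr_ge0.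
  apply: bnd => //; rewrite /S addrK (bigD1 i) //=.
  apply: (@le_trans _ _ (\sum_a \sum_b (`|Vm i a b| + `|Wm i a b|))).
    by do 2 apply: ler_sum => ? _; rewrite lerDr.
  by rewrite lerDl; do 3 apply: sumr_ge0 => ? _; rewrite addr_ge0.
have [|c c0 near1] := near0 (Num.min r (Num.min eh eg)).
  by rewrite !lt_min r0 eh0 eg0.
exists (size Ps), B, Vm, Wm, (Num.max (Num.max (2 / e) (2 / ew)) (Num.max Kg Kh)).
have gW i (l : 'rV[R]_B) : nneg l -> \sum_a l 0 a < c -> g (l *m Wm i) = p + l *m Vm i.
  move=> l0 lc; have [l1 _ _] := near1 i l l0 lc.
  rewrite -hV // hg // inE; have [_ PU _] := PsP _ (memPs i).
  by apply: PU; apply: inP.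
split; first by rewrite !le_max Kg0 orbT.
split.
- apply: (@conic_cover_le _ _ _ (2 / e)); first by rewrite !le_max lexx.
  apply: conic_cover_local => // x /covV[i [l [l0 l1 ->]]].
  by exists i, l; split=> //; apply: sumle1.
- apply: (@conic_cover_le _ _ _ (2 / ew)); first by rewrite !le_max lexx orbT.
  apply: conic_cover_local => // x /covW[i [l [l0 l1 ->]]].
  by exists i, l; split=> //; apply: sumle1.
- apply: (@conic_lip_le _ _ _ _ Kg); first by rewrite !le_max lexx !orbT.
  apply: (conic_lip_local c0) => i j k l k0 l0 kc lc.
  have := glip (k *m Wm i) (l *m Wm j); rewrite !subr0 !gW //.
  rewrite opprD addrACA subrr add0r; apply.
    by have [_ _] := near1 i k k0 kc; rewrite !lt_min => /and3P[].
  by have [_ _] := near1 j l l0 lc; rewrite !lt_min => /and3P[].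
- apply: (@conic_lip_le _ _ _ _ Kh); first by rewrite !le_max lexx !orbT.
  apply: (conic_lip_local c0) => i j k l k0 l0 kc lc.
  have [k1 kV _] := near1 i k k0 kc; have [l1 lV _] := near1 j l l0 lc.
  have := hlip (p + k *m Vm i) (p + l *m Vm j); rewrite !hV //.
  rewrite opprD addrACA subrr add0r; apply.
    by rewrite addrC addKr; move: kV; rewrite !lt_min => /and3P[].
  by rewrite addrC addKr; move: lV; rewrite !lt_min => /and3P[].
move=> i l l0.
(* The chart identity holds only near the apex: scale [l] into that range, then cancel [t] by
   homogeneity of [D] and [md]. *)
have [t t0 /(_ tt)] := @exists_small_scale unit (fun=> \sum_a l 0 a) (fun=> c) (fun=> c0).
rewrite mulr_sumr => ht.
have tc : \sum_a (t *: l) 0 a < c by under eq_bigr do rewrite mxE.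
have tl0 := nnegZ (ltW t0) l0.
have [l1 lV lW] := near1 i _ tl0 tc.
have := FE ((t *: l) *m Wm i); rewrite gW // FD; last first.
  by move: lV; rewrite !lt_min => /and3P[].
rewrite -!scalemxAl hD ?hmd ?ltW // => /(_ _)/addrI h'.
apply: (mulfI (lt0r_neq0 t0)); apply: h'; apply: egV.
rewrite -ball_normE /= sub0r normrN scalemxAl.
by move: lW; rewrite !lt_min => /and3P[].
Qed.

End Conic.

(** * From matched cones back to a PL chart *)

Section PolytopeMore.
Variables (R : realType) (n : nat).
Implicit Types P Q : seq 'rV[R]_n.

Lemma polytope_sub P Q : (forall v, v \in Q -> polytope P v) ->
  polytope Q `<=` polytope P.
Proof.
move=> QP z /polytopeP[l [l0 l1] ->]; apply: polytope_convex => // i.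
by apply: QP; apply: mem_nth.
Qed.

Lemma polytope_segment P x y (d : R) : 0 <= d <= 1 ->
  polytope P x -> polytope P y -> polytope P (x + d *: (y - x)).
Proof.
move=> /andP[d0 d1] Px Py.
have -> : x + d *: (y - x) = \sum_(b : bool) (if b then d else 1 - d) *: (if b then y else x).
  by rewrite big_bool /=; apply/rowP => j; rewrite !mxE; ring.
apply: polytope_convex => [[]||[]] //; rewrite ?subr_ge0 //.
by rewrite big_bool /= addrC subrK.
Qed.

Lemma polytope_homothety P x (d : R) z : polytope P z ->
  polytope [seq x + d *: (v - x) | v <- P] (x + d *: (z - x)).
Proof.
move=> [lam [lam0 [lam1 ->]]]; exists lam; rewrite size_map; split=> //; split=> //.
transitivity (\sum_(i < size P) lam i *: (x + d *: (P`_i - x))); last first.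
  by apply: eq_bigr => i _; rewrite (nth_map 0).
under [RHS]eq_bigr do rewrite scalerDr scalerA mulrC -scalerA.
rewrite big_split /= -scaler_suml lam1 scale1r -scaler_sumr; congr (_ + _ *: _).
under [RHS]eq_bigr do rewrite scalerBr.
by rewrite sumrB -scaler_suml lam1 scale1r.
Qed.

Lemma polytope_radius P x (r : R) z : (forall v, v \in P -> `|v - x| < r) ->
  polytope P z -> `|z - x| < r.
Proof.
move=> Pr /polytopeP[l [l0 l1] ->].
have -> : \sum_i l 0 i *: P`_i - x = \sum_i l 0 i *: (P`_i - x).
  by under [RHS]eq_bigr do rewrite scalerBr; rewrite sumrB -scaler_suml l1 scale1r.
apply: le_lt_trans (ler_norm_sum _ _ _) _.
(* A positive weight keeps the inequality strict in the convex combination. *)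
have [i li] : exists i, 0 < l 0 i.
  apply: contrapT => nl; suff : (1 : R) = 0 by move/eqP; rewrite oner_eq0.
  rewrite -l1; apply: big1 => i _; apply/eqP; rewrite eq_le l0 andbT leNgt.
  by apply/negP => li; apply: nl; exists i.
have -> : r = \sum_i l 0 i * r by rewrite -mulr_suml l1 mul1r.
rewrite (bigD1 i) //= [ltRHS](bigD1 i) //=; apply: ltr_leD.
  by rewrite normrZ ger0_norm // ltr_pM2l // Pr // mem_nth.
apply: ler_sum => j _; rewrite normrZ ger0_norm // ler_wpM2l // ltW //.
by rewrite Pr // mem_nth.
Qed.

End PolytopeMore.

Section ConicChart.
Variables (R : realType) (n : nat).

(* Shrink the polytopes around [x] by a homothety centred at [x]. *)
Lemma PL_on_restrict m (U : set 'rV[R]_n) (f : 'rV[R]_n -> 'rV[R]_m) :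
  PL_on setT f -> open U -> PL_on U f.
Proof.
move=> fPL oU; have [cf _] := fPL; split.
  by apply: continuous_subspaceW cf.
move=> x Ux; have [Ps [e [e0 PsP cov]]] := PL_germ fPL (I : setT x).
have /nbhs_ballP[r /= r0 rU] : nbhs x U by apply: open_nbhs_nbhs.
have [S S0 SP] : exists2 S : R, 0 <= S & forall P, P \in Ps ->
    forall v, v \in P -> `|v - x| <= S.
  apply: (@exists_uniform_bound R _ Ps (fun P (S : R) => forall v, v \in P -> `|v - x| <= S)).
    by move=> P K K' h KK' v /h vK; apply: le_trans KK'.
  move=> P _.
  have [K _ KP] : exists2 K : R, 0 <= K & forall v, v \in P -> `|v - x| <= K.
    apply: exists_uniform_bound => [v K K' h|v _]; first exact: le_trans.
    by exists `|v - x|.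
  by exists K.
(* [S] bounds the distance of every vertex from [x], so the second entry puts the shrunk polytopes
   in the ball of radius [r]; [d <= 1] keeps each inside the original one. *)
pose d := Num.min 1 (r / (S + 1)).
have S1 : 0 < S + 1 by apply: ltr_pwDr.
have d0 : 0 < d by rewrite lt_min ltr01 divr_gt0.
have d1 : d <= 1 by rewrite ge_min lexx.
have dr : d * S < r.
  apply: (@lt_le_trans _ _ (d * (S + 1))); first by rewrite ltr_pM2l // ltrDl.
  by rewrite -ler_pdivlMr // ge_min lexx orbT.
exists [seq [seq x + d *: (v - x) | v <- P] | P <- Ps]; split.
  move=> _ /mapP[P PPs ->]; have [Px _ [g [ga fg]]] := PsP P PPs.
  have sub : polytope [seq x + d *: (v - x) | v <- P] `<=` polytope P.
    apply: polytope_sub => _ /mapP[v vP ->].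
    apply: polytope_segment => //; first by rewrite ltW.
    by have /(nthP 0)[k sk <-] := vP; apply: polytope_vertex.
  split; last by exists g; split=> // z; rewrite inE => /sub zP; apply: fg; rewrite inE.
  move=> z zP; apply: rU; rewrite -ball_normE /= distrC.
  apply: polytope_radius zP => _ /mapP[v vP ->].
  rewrite addrAC subrr add0r normrZ gtr0_norm //; apply: le_lt_trans dr.
  by rewrite ler_pM2l // (SP P).
apply/nbhs_ballP; exists (d * e) => /=; first exact: mulr_gt0.
move=> y; rewrite -ball_normE /= => xy.
pose y' := x + d^-1 *: (y - x).
have [|P PPs Py] := cov y'.
  rewrite /y' addrAC subrr add0r normrZ ger0_norm ?invr_ge0 ?ltW //.
  by rewrite mulrC ltr_pdivrMr // mulrC distrC.
exists [seq x + d *: (v - x) | v <- P]; first exact: map_f.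
have -> : y = x + d *: (y' - x).
  by rewrite /y' [x + _ - x]addrAC subrr add0r scalerA divff ?gt_eqF // scale1r subrKC.
exact: polytope_homothety.
Qed.

(** The rows of [1 - V *m pinvmx V] annihilate [V], hence by hypothesis also [W]; this says that
    [pinvmx V *m W] works. *)
Lemma mulmx_factor m k (V : 'M[R]_(m, n)) (W : 'M[R]_(m, k)) :
  (forall u : 'rV[R]_m, u *m V = 0 -> u *m W = 0) -> exists A, W = V *m A.
Proof.
move=> h; exists (pinvmx V *m W); apply/row_matrixP => i.
apply/eqP; rewrite -subr_eq0 -raddfB /= rowE -(mul1mx W) mulmxA.
rewrite -[1%:M *m W]/(1%:M *m W) mulmxA -mulmxBl mulmxA; apply/eqP.
apply: h; rewrite mulmx1 -mulmxA mulmxBl mul1mx mulmxKpV ?submx_refl // subrr.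
by rewrite mulmx0.
Qed.

(** A point may lie in several cones and have several coefficient vectors. The Lipschitz bound makes
    the choice irrelevant: two representations of one point have images at distance zero. *)
Lemma conic_map N m (V W : 'I_N -> 'M[R]_(m, n)) C :
  conic_cover V C -> conic_lip W V C -> exists H : 'rV[R]_n -> 'rV[R]_n,
  [/\ forall i (l : 'rV[R]_m), nneg l -> H (l *m V i) = l *m W i,
      forall x y : 'rV[R]_n, `|H x - H y| <= C * `|x - y| & H 0 = 0].
Proof.
move=> cV lWV.
have /choice[c cP] (x : 'rV[R]_n) : exists c : 'I_N * 'rV[R]_m,
    nneg c.2 /\ x = c.2 *m V c.1.
  by have [i [l [l0 _ xE]]] := cV x; exists (i, l).
pose H x := (c x).2 *m W (c x).1.
have HE i (l : 'rV[R]_m) : nneg l -> H (l *m V i) = l *m W i.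
  move=> l0; have [c0 cE] := cP (l *m V i).
  apply/eqP; rewrite -subr_eq0 -normr_le0; apply: le_trans (lWV _ _ _ _ c0 l0) _.
  by rewrite -cE subrr normr0 mulr0.
exists H; split=> // [x y|].
  have [x0 xE] := cP x; have [y0 yE] := cP y.
  by rewrite [in leRHS]xE [in leRHS]yE; apply: lWV.
have [i [l [l0 _ _]]] := cV 0; have := HE i 0; rewrite !mul0mx; apply.
by move=> j; rewrite mxE.
Qed.

Lemma PL_on_conic N m (V W : 'I_N -> 'M[R]_(m, n)) C (H : 'rV[R]_n -> 'rV[R]_n)
    (p q : 'rV[R]_n) : 0 <= C -> conic_cover V C ->
  (forall i (l : 'rV[R]_m), nneg l -> H (l *m V i) = l *m W i) ->
  (forall x y : 'rV[R]_n, `|H x - H y| <= C * `|x - y|) ->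
  PL_on setT (fun x => q + H (x - p)).
Proof.
move=> C0 cV HE Hlip; split.
  apply: continuous_subspaceT; apply: (@lipschitz_continuous _ _ _ _ C) => x y.
  rewrite opprD addrACA subrr add0r; apply: le_trans (Hlip _ _) _.
  by rewrite opprB addrA subrK.
(* [T] exceeds the sum of the coefficients of [y - p] for all [y] within distance 1 of [x], so cones
   truncated at scale [T] cover that ball. *)
move=> x _; pose T := \sum_(j < m) C * (`|x - p| + 1) + 1.
have T0 : 0 < T.
  by apply: ltr_pwDr => //; apply: sumr_ge0 => j _; rewrite mulr_ge0 // addr_ge0.
pose P i := p :: [seq p + T *: row j (V i) | j <- enum 'I_m].
exists [seq P i | i <- enum 'I_N]; split.
  move=> _ /mapP[i _ ->]; split=> //.
  (* A linear relation among the generators [V i] equates two points of the cone, given by its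
     positive and negative parts. [H] agrees on them, so [W i] satisfies the same relation and [H]
     is linear on the cone. *)
  have [A WE] : exists A, W i = V i *m A.
    apply: mulmx_factor => u uV.
    pose k := \row_j Num.max 0 (u 0 j) : 'rV[R]_m.
    pose l := \row_j Num.max 0 (- u 0 j) : 'rV[R]_m.
    have ukl : u = k - l.
      apply/rowP => j; rewrite !mxE; case: (leP 0 (u 0 j)) => uj.
        by rewrite max_l ?subr0 // oppr_le0.
      by rewrite max_r ?oppr_ge0 ?ltW // sub0r opprK.
    have k0 : nneg k by move=> j; rewrite mxE le_max lexx.
    have l0 : nneg l by move=> j; rewrite mxE le_max lexx.
    move: uV; rewrite ukl !mulmxBl => /eqP; rewrite subr_eq0 => /eqP kl.
    by rewrite -!HE // kl subrr.
  exists (fun z => q + (z - p) *m A); split.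
    exists A, (q - p *m A) => z; rewrite mulmxBl addrCA; congr (_ + _).
  move=> z; rewrite inE => -[lam [lam0 [lam1 zE]]].
  suff [l l0 lE] : exists2 l : 'rV[R]_m, nneg l & z - p = l *m V i.
    by rewrite lE HE // WE mulmxA.
  rewrite zE /= size_map size_enum_ord in lam1 *.
  exists (\row_j (lam j.+1 * T)); first by move=> j; rewrite mxE mulr_ge0 // ltW.
  rewrite -[in - p](scale1r p) -lam1 scaler_suml -sumrB.
  under eq_bigr do rewrite -scalerBr.
  rewrite big_ord_recl /= subrr scaler0 add0r mulmx_sum_row.
  apply: eq_bigr => j _; rewrite mxE -scalerA; congr (_ *: _).
  by rewrite add0n (nth_map j) ?size_enum_ord // nth_ord_enum addrAC subrr add0r.
apply/nbhs_ballP; exists 1 => //= y; rewrite -ball_normE /= => xy.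
have [i [l [l0 lC yE]]] := cV (y - p).
exists (P i); first by apply: map_f; rewrite mem_enum.
pose c (o : 'I_m.+1) := if unlift ord0 o is Some j then l 0 j / T
  else 1 - (\sum_j l 0 j) / T.
pose v (o : 'I_m.+1) := if unlift ord0 o is Some j then p + T *: row j (V i) else p.
have -> : y = \sum_o c o *: v o.
  rewrite big_ord_recl /c /v unlift_none /=.
  under [X in _ = _ + X]eq_bigr do rewrite liftK.
  rewrite -[LHS](subrK p) yE mulmx_sum_row.
  under [X in _ = _ + X]eq_bigr do rewrite scalerDr scalerA mulfVK ?gt_eqF //.
  rewrite big_split /= -scaler_suml -mulr_suml addrA -scalerDl subrK scale1r.
  by rewrite addrC.
have lT : (\sum_j l 0 j) / T <= 1.
  rewrite ler_pdivrMr // mul1r; apply: (@le_trans _ _ (T - 1)); last by rewrite gerBl.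
  rewrite /T addrK; apply: ler_sum => j _; apply: le_trans (lC j) _.
  apply: ler_wpM2l => //; rewrite -[y](subrK x) -addrA addrC.
  by apply: le_trans (ler_normD _ _) _; rewrite lerD2l distrC ltW.
apply: polytope_convex.
- move=> o; rewrite /c; case: unlift => [j|]; first by rewrite divr_ge0 // ltW.
  by rewrite subr_ge0.
- rewrite big_ord_recl /c unlift_none /=.
  by under [X in _ + X]eq_bigr do rewrite liftK; rewrite -mulr_suml subrK.
- move=> o; rewrite /v; case: unlift => [j|]; last exact: (@polytope_vertex _ _ (P i) 0 0%N).
  have -> : p + T *: row j (V i) = nth 0 (P i) j.+1.
    by rewrite /P /= (nth_map j) ?size_enum_ord // nth_ord_enum.
  by apply: polytope_vertex; rewrite /= size_map size_enum_ord ltnS.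
Qed.

(** The maps between the two cone systems are mutually inverse and PL on the whole space; they are
    restricted to the ball where [D] describes [F] and to its image. The shapes [0 + H (x - p)] and
    [p + G (y - 0)] are chosen to match [PL_on_conic]. *)
Lemma conic_PL_chart (F D md : 'rV[R]_n -> R) (p : 'rV[R]_n) (r : R) : 0 < r ->
  (forall x : 'rV[R]_n, `|x| < r -> F (p + x) = F p + D x) ->
  conic_equiv D md -> PL_chart_model F p md.
Proof.
move=> r0 FD [N [m [V [W [C [C0 [cV cW lVW lWV DE]]]]]]].
have [H [HE Hlip H0]] := conic_map cV lWV.
have [G [GE Glip G0]] := conic_map cW lVW.
have GH x : G (H x) = x.
  by have [i [l [l0 _ ->]]] := cV x; rewrite HE // GE.
have HG x : H (G x) = x.
  by have [i [l [l0 _ ->]]] := cW x; rewrite GE // HE.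
pose h x := 0 + H (x - p); pose g y := p + G (y - 0).
have oU : open (ball p r) by apply: ball_open.
have cG : continuous G by apply: lipschitz_continuous Glip.
pose Y := [set y : 'rV[R]_n | `|G y| < r].
have oY : open Y.
  have -> : Y = G @^-1` (ball 0 r).
    by apply/seteqP; split => y /=; rewrite -ball_normE /= sub0r normrN.
  by apply: open_comp; [move=> *; apply: cG | apply: ball_open].
exists (ball p r), Y, h, g; split; [split|split; [split|]] => //.
- exact: ballxx.
- by rewrite /Y /= G0 normr0.
- by rewrite /h subrr H0 addr0.
- move=> _ [x xr <-]; move: xr; rewrite -ball_normE /Y /= => xr.
  by rewrite /h add0r GH distrC.
- move=> _ [y Yy <-]; rewrite -ball_normE /= /g subr0 opprD addrA subrr sub0r.
  by rewrite normrN.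
- by move=> x _; rewrite /g /h add0r subr0 GH subrKC.
- by move=> y _; rewrite /g /h add0r subr0 addrAC subrr add0r HG.
- by split; apply: PL_on_restrict => //; [apply: PL_on_conic HE Hlip | apply: PL_on_conic GE Glip].
move=> y Yy; rewrite /g subr0 FD //; congr (_ + _).
by have [i [l [l0 _ ->]]] := cW y; rewrite GE // DE.
Qed.

End ConicChart.

(** * Directional germs of a ReLU network *)

Section Network.
Variable R : realType.

Definition rsign (t : R) : option bool :=
  if 0 < t then Some true else if t < 0 then Some false else None.

(** One-sided directional derivative of [relu] at a point of sign [o]; at the kink it is [relu]
    itself. *)
Definition drelu (o : option bool) (t : R) : R :=
  match o with Some true => t | Some false => 0 | None => relu t end.

Fixpoint hid (dm : nat -> nat) (th : pidx -> R) (v : nat -> R) (i : nat) : nat -> R :=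
  if i is i'.+1 then fun j => relu (layer_affine th i (dm i') (hid dm th v i') j)
  else v.

(* Directional derivative of [hid] when neuron [(i, j)] has sign [s i j]. *)
Fixpoint dhid (dm : nat -> nat) (th : pidx -> R) (s : nat -> nat -> option bool)
    (v : nat -> R) (i : nat) : nat -> R :=
  if i is i'.+1 then fun j => drelu (s i j)
    (\sum_(k < dm i') th (i, j, Some (k : nat)) * dhid dm th s v i' k)
  else v.

Definition inp n (x : 'rV[R]_n) : nat -> R :=
  fun k => \sum_(j < n | nat_of_ord j == k) x ord0 j.

Definition dnet n ns (th : pidx -> R) s (x : 'rV[R]_n) : R :=
  \sum_(k < Defs.dim n ns (size ns))
    th ((size ns).+1, 0%N, Some (k : nat)) * dhid (Defs.dim n ns) th s (inp x) (size ns) k.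

Definition preact n ns (th : pidx -> R) (x : 'rV[R]_n) (i j : nat) : R :=
  layer_affine th i.+1 (Defs.dim n ns i) (hid (Defs.dim n ns) th (inp x) i) j.

Definition realizes n ns th (s : nat -> nat -> option bool) (x : 'rV[R]_n) : Prop :=
  forall i j, (i < size ns)%N -> (j < Defs.dim n ns i.+1)%N ->
    rsign (preact ns th x i j) = s i.+1 j.

Lemma foldl_hid (dm : nat -> nat) th v i :
  foldl (fun v i => fun j => relu (layer_affine th i (dm i.-1) v j)) v (iota 1 i) =
  hid dm th v i.
Proof.
elim: i => [|i IH] //.
have -> : iota 1 i.+1 = iota 1 i ++ [:: i.+1] by rewrite -[in LHS](addn1 i) iotaD.
by rewrite foldl_cat IH.
Qed.

Lemma relu_netE n ns th (x : 'rV[R]_n) : relu_net ns th x =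
  preact ns th x (size ns) 0.
Proof. by rewrite /relu_net foldl_hid. Qed.

Lemma reluZ (t x : R) : 0 <= t -> relu (t * x) = t * relu x.
Proof. by move=> t0; rewrite /relu maxr_pMr // mulr0. Qed.

Lemma dreluZ o (t x : R) : 0 <= t -> drelu o (t * x) = t * drelu o x.
Proof. by case: o => [[]|] t0 /=; rewrite ?mulr0 // reluZ. Qed.

Lemma drelu0 o : drelu o 0 = 0.
Proof. by have := @dreluZ o 0 0 (lexx _); rewrite !mul0r. Qed.

Lemma inpZ n (x : 'rV[R]_n) t k : inp (t *: x) k = t * inp x k.
Proof. by rewrite /inp mulr_sumr; apply: eq_bigr => j _; rewrite mxE. Qed.

Lemma inpD n (x y : 'rV[R]_n) k : inp (x + y) k = inp x k + inp y k.
Proof. by rewrite /inp -big_split; apply: eq_bigr => j _; rewrite mxE. Qed.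

Lemma dhidZ n dm th s (x : 'rV[R]_n) t i j : 0 <= t ->
  dhid dm th s (inp (t *: x)) i j = t * dhid dm th s (inp x) i j.
Proof.
move=> t0; elim: i j => [|i IH] j /=; first exact: inpZ.
rewrite -dreluZ // mulr_sumr; congr drelu; apply: eq_bigr => k _.
by rewrite IH mulrCA.
Qed.

Lemma dnet_homogeneous n ns th s : pos_homogeneous (@dnet n ns th s).
Proof.
move=> t x t0; rewrite /dnet mulr_sumr; apply: eq_bigr => k _.
by rewrite dhidZ // mulrCA.
Qed.

Section NetworkContinuous.
Variables (T : topologicalType) (n : nat) (th : T -> pidx -> R) (x : T -> 'rV[R]_n).
Hypothesis cth : forall q, continuous (th ^~ q).
Hypothesis cx : forall j, continuous (fun t => x t 0 j).

Lemma cont_inp k : continuous (fun t => inp (x t) k).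
Proof. by apply: cont_sum => j _; apply: cx. Qed.

Lemma cont_affine i m (v : T -> nat -> R) j :
  (forall k, continuous (v ^~ k)) -> continuous (fun t => layer_affine (th t) i m (v t) j).
Proof.
move=> cv; apply: cont_add; last exact: cth.
by apply: cont_sum => k _; apply: cont_mul => //; apply: cth.
Qed.

Lemma cont_hid dm i j : continuous (fun t => hid dm (th t) (inp (x t)) i j).
Proof.
elim: i j => [|i IH] j /=; first exact: cont_inp.
by apply: cont_relu; apply: cont_affine.
Qed.

Lemma cont_preact ns i j : continuous (fun t => preact ns (th t) (x t) i j).
Proof. by apply: cont_affine => k; apply: cont_hid. Qed.

Lemma cont_drelu o (f : T -> R) : continuous f -> continuous (fun t => drelu o (f t)).
Proof. by case: o => [[]|] cf //=; [apply: cont_cst | apply: cont_relu]. Qed.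

Lemma cont_dhid dm s i j : continuous (fun t => dhid dm (th t) s (inp (x t)) i j).
Proof.
elim: i j => [|i IH] j /=; first exact: cont_inp.
apply: cont_drelu; apply: cont_sum => k _.
by apply: cont_mul => //; apply: cth.
Qed.

Lemma cont_dnet ns s : continuous (fun t => dnet ns (th t) s (x t)).
Proof.
by apply: cont_sum => k _; apply: cont_mul; [apply: cth | apply: cont_dhid].
Qed.

End NetworkContinuous.

Lemma relu_germ (a : R) : \forall b \near 0, relu (a + b) = relu a + drelu (rsign a) b.
Proof.
rewrite /rsign; have [a0|a0|<-] := ltgtP 0 a.
- apply/nbhs_ballP; exists a => //= b; rewrite -ball_normE /= sub0r normrN => ba.
  have : - b < a by apply: le_lt_trans ba; rewrite -normrN ler_norm.
  by move=> ab; rewrite /relu !max_r ?ltW // -ltrBlDr sub0r.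
- apply/nbhs_ballP; exists (- a); rewrite /= ?oppr_gt0 // => b.
  rewrite -ball_normE /= sub0r normrN => ba.
  rewrite /relu !max_l ?addr0 ?ltW // addrC -ltrBrDr sub0r.
  by apply: le_lt_trans ba; rewrite ler_norm.
- by apply: filterE => b; rewrite add0r /relu maxxx add0r.
Qed.

(** By induction on the layers: the increment of a pre-activation is continuous in [x] and vanishes
    at 0, so for small [x] it stays where [relu_germ] is valid. Each layer has finitely many
    neurons, so one neighbourhood serves them all. *)
Lemma hid_germ n ns th s (p : 'rV[R]_n) i : realizes ns th s p -> (i <= size ns)%N ->
  \forall x \near (0 : 'rV[R]_n), forall j : 'I_(Defs.dim n ns i),
   hid (Defs.dim n ns) th (inp (p + x)) i j =
   hid (Defs.dim n ns) th (inp p) i j + dhid (Defs.dim n ns) th s (inp x) i j.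
Proof.
move=> rs; elim: i => [|i IH] si.
  by apply: filterE => x j; rewrite /= inpD.
have {}IH := IH (ltnW si).
apply: (@filter_forall _ _ (fun (j : 'I_(Defs.dim n ns i.+1)) x =>
   hid (Defs.dim n ns) th (inp (p + x)) i.+1 j =
   hid (Defs.dim n ns) th (inp p) i.+1 j + dhid (Defs.dim n ns) th s (inp x) i.+1 j) (nbhs (0 : 'rV[R]_n)) _) => j /=.
rewrite -(rs i j si (ltn_ord j)).
pose b (x : 'rV[R]_n) := \sum_(k < Defs.dim n ns i) th (i.+1, j : nat, Some (k : nat)) *
  dhid (Defs.dim n ns) th s (inp x) i k.
have cb : continuous b.
  apply: cont_sum => k _; apply: cont_mul; first exact: cont_cst.
  apply: (@cont_dhid _ _ (fun=> th) id) => q; first exact: cont_cst.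
  exact: coord_continuous.
have b0 : b 0 = 0.
  apply: big1 => k _; rewrite -(scale0r (0 : 'rV[R]_n)) dhidZ //.
  by rewrite mul0r mulr0.
have /cb : nbhs (b 0) [set c | relu (preact ns th p i j + c) =
    relu (preact ns th p i j) + drelu (rsign (preact ns th p i j)) c].
  by rewrite b0; apply: relu_germ.
apply: filterS2 IH => x IH; rewrite /= => <-; congr relu.
rewrite /preact /layer_affine [RHS]addrAC; congr (_ + _).
rewrite -big_split /=; apply: eq_bigr => k _.
by rewrite IH mulrDr.
Qed.

Lemma relu_net_germ n ns th s (p : 'rV[R]_n) : realizes ns th s p ->
  exists2 r : R, 0 < r & forall x : 'rV[R]_n, `|x| < r ->
    relu_net ns th (p + x) = relu_net ns th p + dnet ns th s x.
Proof.
move=> rs; have /nbhs_ballP[r /= r0 rP] := hid_germ rs (leqnn _).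
exists r => // x xr; rewrite !relu_netE /preact /layer_affine addrAC; congr (_ + _).
rewrite -big_split /=; apply: eq_bigr => k _.
rewrite rP ?mulrDr //; rewrite -ball_normE /= sub0r normrN //.
Qed.

Definition reg_model n (x : 'rV[R]_n) : R := \sum_(j < n | nat_of_ord j == n.-1) x ord0 j.
Definition crit_model n k (x : 'rV[R]_n) : R :=
  - (\sum_(j < n | (j < k)%N) `|x ord0 j|) + \sum_(j < n | (k <= j)%N) `|x ord0 j|.

Definition conic_Morse n (D : 'rV[R]_n -> R) : Prop :=
  conic_equiv D (@reg_model n) \/
  exists k : 'I_n.+1, conic_equiv D (@crit_model n k).

Lemma reg_model_homogeneous n : pos_homogeneous (@reg_model n).
Proof.
by move=> t x t0; rewrite /reg_model mulr_sumr; apply: eq_bigr => j _; rewrite mxE.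
Qed.

Lemma crit_model_homogeneous n k : pos_homogeneous (@crit_model n k).
Proof.
move=> t x t0; rewrite /crit_model mulrDr mulrN !mulr_sumr.
congr (- _ + _); apply: eq_bigr => j _; rewrite mxE normrM ger0_norm //.
Qed.

(** The conclusion depends on [p] only through its sign pattern. This replaces the quantifier over
    uncountably many points by one over finitely many patterns. *)
Lemma PL_Morse_conic n ns th s (p : 'rV[R]_n) : PL_Morse (@relu_net R n ns th) ->
  realizes ns th s p -> conic_Morse (@dnet n ns th s).
Proof.
move=> FM rs.
have [r r0 rE] := relu_net_germ rs; have hD := @dnet_homogeneous n ns th s.
case: (FM p) => [reg|[k [kn crit]]]; [left|right].
  by apply: (PL_chart_conic r0 hD _ rE reg); apply: reg_model_homogeneous.
have kn' : (k < n.+1)%N by [].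
exists (Ordinal kn').
by apply: (PL_chart_conic r0 hD _ rE crit); apply: crit_model_homogeneous.
Qed.

Lemma conic_PL_Morse n ns th :
  (forall p : 'rV[R]_n, exists2 s, realizes ns th s p & conic_Morse (@dnet n ns th s)) ->
  PL_Morse (@relu_net R n ns th).
Proof.
move=> h p; have [s rs cM] := h p.
have [r r0 rE] := relu_net_germ rs.
case: cM => [reg|[k crit]]; [left|right].
  exact: (conic_PL_chart r0 rE reg).
exists k; split; first by rewrite -ltnS.
exact: (conic_PL_chart r0 rE crit).
Qed.

End Network.

(** * Measurability of the PL Morse event *)

Lemma rV_box_compact (R : realType) m (a b : R) :
  compact [set l : 'rV[R]_m | forall j, l 0 j \in `[a, b]].
Proof.
have -> : [set l : 'rV[R]_m | forall j, l 0 j \in `[a, b]] =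
    [set l : 'rV[R]_m | forall j, `[a, b]%classic (l ord0 j)].
  by apply/seteqP; split=> l /= h j; apply: h.
by apply: (@rV_compact _ _ (fun=> `[a, b]%classic)) => _; apply: segment_compact.
Qed.

Section MeasurableSets.
Variables (R : realType) (d : measure_display) (Om : measurableType d).

Lemma measurable_forall (I : finType) (A : I -> set Om) :
  (forall i, measurable (A i)) -> measurable [set om | forall i, A i om].
Proof.
move=> mA; have -> : [set om | forall i, A i om] = \bigcap_(i in [set: I]) A i.
  by apply/seteqP; split=> om h i //; apply: h.
exact: fin_bigcap_measurable.
Qed.

Lemma measurable_exists (I : countType) (A : I -> set Om) :
  (forall i, measurable (A i)) -> measurable [set om | exists i, A i om].
Proof.
move=> mA; have -> : [set om | exists i, A i om] = \bigcup_i A i.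
  by apply/seteqP; split=> om [i]; [exists i | move=> _ ?; exists i].
by apply: countable_bigcupT_measurable => //; apply: countableP.
Qed.

Lemma measurable_and_cst (Q : Prop) (A : set Om) : measurable A ->
  measurable [set om | Q /\ A om].
Proof.
move=> mA; have [q|nq] := pselect Q.
  by rewrite (_ : [set om | _] = A) //; apply/seteqP; split=> om // [].
rewrite (_ : [set om | _] = set0); first exact: measurable0.
by apply/seteqP; split=> om // [].
Qed.

Lemma measurable_imply (A B : set Om) : measurable A -> measurable B ->
  measurable [set om | A om -> B om].
Proof.
move=> mA mB; have -> : [set om | A om -> B om] = ~` A `|` B.
  apply/seteqP; split=> om /=; last by case.
  by move=> h; have [Ao|nA] := pselect (A om); [right; apply: h | left].
by apply: measurableU => //; apply: measurableC.
Qed.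

(** An open set is a countable union of boxes with rational centres and radii [k.+1%:R^-1], and the
    preimage of a box involves one coordinate at a time. *)
Lemma measurable_preimage_closed K (th : Om -> 'rV[R]_K) (A : set 'rV[R]_K) :
  (forall a, measurable_fun setT (fun om => th om 0 a)) -> closed A ->
  measurable (th @^-1` A).
Proof.
move=> mth cA; suff mO O : open O -> measurable (th @^-1` O).
  by have := measurableC (mO _ (closed_openC cA)); rewrite -preimage_setC setCK.
move=> oO.
pose box (c : 'rV[rat]_K) (k : nat) := [set t : 'rV[R]_K |
  forall a, ratr (c 0 a) - k.+1%:R^-1 < t 0 a < ratr (c 0 a) + k.+1%:R^-1].
have mbox c k : measurable (th @^-1` box c k).
  apply: measurable_forall => a.
  have := mth a measurableT `](ratr (c 0 a) - k.+1%:R^-1), (ratr (c 0 a) + k.+1%:R^-1)[%classic.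
  rewrite setTI => /(_ (measurable_itv _)); congr measurable.
have -> : th @^-1` O = [set om | exists ck : 'rV[rat]_K * nat,
    box ck.1 ck.2 `<=` O /\ box ck.1 ck.2 (th om)].
  apply/seteqP; split=> om /=; last by case=> -[c k] [sub] /sub.
  move=> Oom; have /nbhs_ballP[e /= e0 eO] : nbhs (th om) O by apply: open_nbhs_nbhs.
  (* A box of radius [r] with centre within [r] of the point stays within [r + r < e] of it. *)
  pose k := Num.trunc (2 / e); pose r : R := k.+1%:R^-1.
  have r0 : 0 < r by rewrite invr_gt0 ltr0n.
  have re : r + r < e.
    rewrite -mulr2n -mulr_natl /r ltr_pdivrMr ?ltr0n // mulrC -ltr_pdivrMr //.
    exact: truncnS_gt.
  have /choice[c cP] a : exists q : rat, ratr q \in `](th om 0 a - r), (th om 0 a + r)[.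
    apply: rat_in_itvoo; lra.
  exists (\row_a c a, k); split=> /= [t bt|a].
    apply: eO; split=> // i j; rewrite [i]ord1 -ball_normE /=.
    have := bt j; have := cP j; rewrite mxE in_itv /= -/r ltr_norml.
    move=> /andP[h1 h2] /andP[h3 h4]; apply/andP; split; lra.
  by have := cP a; rewrite mxE in_itv /= -/r => /andP[h1 h2]; apply/andP; split; lra.
apply: measurable_exists => -[c k] /=.
exact: (@measurable_and_cst _ (th @^-1` box c k) (mbox c k)).
Qed.

(** Projections of Borel sets need not be Borel. For closed sets, cutting the fibre into the compact
    boxes of half-side [c] gives a countable union of closed projections. *)
Lemma measurable_projection K I (th : Om -> 'rV[R]_K)
    (Z : nat -> set ('rV[R]_K * 'rV[R]_I)) :
  (forall a, measurable_fun setT (fun om => th om 0 a)) ->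
  (forall k, closed (Z k)) ->
  measurable [set om | exists k e, Z k (th om, e)].
Proof.
move=> mth cZ.
have -> : [set om | exists k e, Z k (th om, e)] = [set om | exists kc : nat * nat,
    exists2 e : 'rV[R]_I, (forall j, e 0 j \in `[- kc.2%:R, kc.2%:R]) & Z kc.1 (th om, e)].
  apply/seteqP; split=> om /=; last by case=> -[k c] [e _ Ze]; exists k, e.
  move=> [k [e Ze]]; exists (k, (Num.trunc `|e|).+1), e => // j; rewrite /= in_itv /= -ler_norml.
  by apply: le_trans (entry_le_norm _ _) (ltW _); apply: truncnS_gt.
apply: measurable_exists => -[k c] /=.
apply: (@measurable_preimage_closed _ th [set t | exists2 e : 'rV[R]_I,
  (forall j, e 0 j \in `[- c%:R, c%:R]) & Z k (t, e)]) => //.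
apply: (@closed_exists_compact _ _ [set e : 'rV[R]_I | forall j, e 0 j \in `[- c%:R, c%:R]]) => //.
exact: rV_box_compact.
Qed.

End MeasurableSets.

Section ConicClosed.
Variables (R : realType) (n : nat) (T : topologicalType).
Variables (D : T -> 'rV[R]_n -> R) (md : 'rV[R]_n -> R) (N m : nat) (C : R).
Variables V W : T -> 'I_N -> 'M[R]_(m, n).
Hypothesis cD : forall x : T -> 'rV[R]_n, (forall j, continuous (fun t => x t 0 j)) ->
  continuous (fun t => D t (x t)).
Hypothesis cmd : continuous md.
Hypothesis cV : forall i a b, continuous (fun t => V t i a b).
Hypothesis cW : forall i a b, continuous (fun t => W t i a b).

Lemma cont_mulmx (U : T -> 'I_N -> 'M[R]_(m, n)) i (l : 'rV[R]_m) j :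
  (forall i a b, continuous (fun t => U t i a b)) ->
  continuous (fun t => (l *m U t i) 0 j).
Proof.
move=> cU; under eq_fun do rewrite mxE.
by apply: cont_sum => k _; apply: cont_mul => //; apply: cont_cst.
Qed.

(** For fixed [x] the bound on the coefficients confines them to a compact box, so their existence
    is a closed condition on the generators. *)
Lemma closed_conic_cover (U : T -> 'I_N -> 'M[R]_(m, n)) :
  (forall i a b, continuous (fun t => U t i a b)) ->
  closed [set t | conic_cover (U t) C].
Proof.
move=> cU; apply: closed_forall => x; apply: closed_exists => i.
pose K := [set l : 'rV[R]_m | forall j, l 0 j \in `[0, C * `|x|]].
pose Z := [set tl : T * 'rV[R]_m | forall j, x 0 j = (tl.2 *m U tl.1 i) 0 j].
rewrite [X in closed X](_ : _ = [set t | exists2 l, K l & Z (t, l)]); last first.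
  apply/seteqP; split=> t /=.
    move=> [l [l0 lC xE]]; exists l; last by move=> j; rewrite [in LHS]xE.
    by move=> j; rewrite in_itv /= l0 lC.
  move=> [l lK lZ]; exists l; split; last by apply/rowP.
    by move=> j; have := lK j; rewrite in_itv /= => /andP[].
  by move=> j; have := lK j; rewrite in_itv /= => /andP[].
apply: closed_exists_compact.
  exact: rV_box_compact.
apply: closed_forall => j; apply: closed_fun_eq; first exact: cont_cst.
under eq_fun do rewrite mxE.
apply: cont_sum => k _; apply: cont_mul.
  move=> tl; apply: (@continuous_comp _ _ _ snd (fun l : 'rV[R]_m => l 0 k)).
    exact: cvg_snd.
  exact: coord_continuous.
move=> tl; apply: (@continuous_comp _ _ _ fst (fun t => U t i k j)).
  exact: cvg_fst.
exact: cU.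
Qed.

Lemma closed_conic_lip (U U' : T -> 'I_N -> 'M[R]_(m, n)) :
  (forall i a b, continuous (fun t => U t i a b)) ->
  (forall i a b, continuous (fun t => U' t i a b)) ->
  closed [set t | conic_lip (U t) (U' t) C].
Proof.
move=> cU cU'; apply: closed_forall => i; apply: closed_forall => j.
apply: closed_forall => k; apply: closed_forall => l.
apply: closed_imply; apply: closed_imply; apply: closed_fun_le.
  apply: cont_norm => c; under eq_fun do rewrite mxE [X in _ + X]mxE.
  by apply: cont_sub; apply: cont_mulmx.
apply: cont_mul; first exact: cont_cst.
apply: cont_norm => c; under eq_fun do rewrite mxE [X in _ + X]mxE.
by apply: cont_sub; apply: cont_mulmx.
Qed.

Lemma closed_conic_matching :
  closed [set t | conic_matching (D t) md (V t) (W t) C].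
Proof.
have -> : [set t | conic_matching (D t) md (V t) (W t) C] =
    [set t | conic_cover (V t) C] `&` ([set t | conic_cover (W t) C] `&`
    ([set t | conic_lip (V t) (W t) C] `&` ([set t | conic_lip (W t) (V t) C] `&`
    [set t | forall i (l : 'rV[R]_m), nneg l -> D t (l *m V t i) = md (l *m W t i)]))).
  by apply/seteqP; split=> t /= => [[]|[? [? [? []]]]].
apply: closedI; first exact: closed_conic_cover.
apply: closedI; first exact: closed_conic_cover.
apply: closedI; first exact: closed_conic_lip.
apply: closedI; first exact: closed_conic_lip.
apply: closed_forall => i; apply: closed_forall => l; apply: closed_imply.
apply: closed_fun_eq; first by apply: cD => j; apply: cont_mulmx.
move=> t; apply: (@continuous_comp _ _ _ (fun t => l *m W t i) md); last exact: cmd.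
by apply: cont_mx => a j; rewrite [a]ord1; apply: cont_mulmx.
Qed.

End ConicClosed.

Section ModelContinuous.
Variables (R : realType) (n : nat).

Lemma cont_reg_model : continuous (@reg_model R n).
Proof. by apply: cont_sum => j _; apply: coord_continuous. Qed.

Lemma cont_crit_model k : continuous (@crit_model R n k).
Proof.
apply: cont_add; first apply: cont_opp;
  by apply: cont_sum => j _; apply: cont_abs; apply: coord_continuous.
Qed.

End ModelContinuous.

(** * Finite-dimensional encoding of parameters and sign patterns *)

Section NetworkExt.
Variables (R : realType) (n : nat) (ns : seq nat).

(** Parameters at invalid indices are arbitrary functions on the probability space; this lets them
    be replaced by 0. *)
Lemma relu_net_ext (th th' : pidx -> R) :
  (forall q, valid_idx n ns q -> th q = th' q) ->
  forall x : 'rV[R]_n, relu_net ns th x = relu_net ns th' x.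
Proof.
move=> eth x; rewrite !relu_netE.
have eh i : (i <= size ns)%N -> forall j, (j < Defs.dim n ns i)%N ->
    hid (Defs.dim n ns) th (inp x) i j = hid (Defs.dim n ns) th' (inp x) i j.
  elim: i => [|i IH] si j sj //=; congr relu; rewrite /layer_affine; congr (_ + _).
    apply: eq_bigr => k _; rewrite IH ?(ltnW si) // eth //.
    by rewrite /valid_idx /= ltnW // sj ltn_ord.
  by rewrite eth // /valid_idx /= ltnW // sj.
have last0 : (0 < Defs.dim n ns (size ns).+1)%N.
  by rewrite /Defs.dim /= nth_rcons ltnn eqxx.
rewrite /preact /layer_affine; congr (_ + _).
  apply: eq_bigr => k _; rewrite eh // eth //.
  by rewrite /valid_idx /= leqnn last0 ltn_ord.
by rewrite eth // /valid_idx /= leqnn last0.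
Qed.

(** Exceeds every layer number as well as bounding the widths, thanks to the summand
    [(size ns).+2]. *)
Definition max_dim : nat := sumn (dims n ns) + (size ns).+2.

Lemma dim_le_max i : (Defs.dim n ns i <= max_dim)%N.
Proof.
apply: leq_trans (leq_addr _ _); rewrite /Defs.dim.
elim: (dims n ns) i => [|a s IH] [|i] //=; first exact: leq_addr.
exact: leq_trans (IH i) (leq_addl _ _).
Qed.

Definition all_idx : seq pidx :=
  [seq (ij, o) | ij <- [seq (i, j) | i <- iota 0 max_dim, j <- iota 0 max_dim],
                 o <- None :: [seq Some k | k <- iota 0 max_dim]].

Lemma valid_all_idx q : valid_idx n ns q -> q \in all_idx.
Proof.
case: q => [[i j] o] /and4P[i1 il jd ok].
have lt_max a b : (a < Defs.dim n ns b)%N -> (a < max_dim)%N.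
  by move=> h; apply: leq_trans h (dim_le_max _).
apply/allpairsP; exists ((i, j), o); split=> //=.
  apply/allpairsP; exists (i, j); split=> //=; rewrite mem_iota //= add0n.
    by apply: leq_trans (leq_addl _ _); rewrite ltnS.
  exact: lt_max jd.
case: o ok => [k|] kd; rewrite inE //=; apply: map_f; rewrite mem_iota add0n /=.
exact: lt_max kd.
Qed.

(** Reads a parameter family off a point of a finite-dimensional space, where closed and compact
    sets are available; indices outside the list read 0. *)
Definition dec (t : 'rV[R]_(size all_idx)) (q : pidx) : R :=
  if insub (index q all_idx) is Some a then t 0 a else 0.

Lemma cont_dec q : continuous (dec ^~ q).
Proof.
rewrite /dec; case: insub => [a|]; last exact: cont_cst.
exact: coord_continuous.
Qed.

Lemma dec_row (f : pidx -> R) q : q \in all_idx ->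
  dec (\row_a f (nth (0%N, 0%N, None) all_idx a)) q = f q.
Proof.
by move=> qI; rewrite /dec insubT ?index_mem // => h; rewrite mxE /= nth_index.
Qed.

(** A finite type of sign patterns, so that a condition on all patterns is a finite intersection of
    events. First components start at 0 while layers start at 1, whence the [i.-1] in
    [pattern_sign]. *)
Definition pattern := {ffun 'I_(size ns) * 'I_max_dim -> option bool}.

Definition pattern_sign (f : pattern) (i j : nat) : option bool :=
  if insub i.-1 is Some i' then if insub j is Some j' then f (i', j') else None
  else None.

Lemma pattern_sign_ext (s : nat -> nat -> option bool) : exists f : pattern,
  forall i j, (i < size ns)%N -> (j < Defs.dim n ns i.+1)%N ->
  pattern_sign f i.+1 j = s i.+1 j.
Proof.
exists [ffun ij : 'I_(size ns) * 'I_max_dim => s ij.1.+1 ij.2] => i j si sj.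
by rewrite /pattern_sign /= insubT insubT ?(leq_trans sj (dim_le_max _)) // => h; rewrite ffunE.
Qed.

(** Strict signs are not closed conditions. Requiring the margin [k.+1%:R^-1] makes them closed, and
    the union over [k] recovers [rsign]. *)
Definition strict_sign (k : nat) (o : option bool) (t : R) : Prop :=
  match o with
  | Some true => k.+1%:R^-1 <= t
  | Some false => t <= - k.+1%:R^-1
  | None => t = 0
  end.

Lemma closed_strict_sign (T : topologicalType) k o (f : T -> R) : continuous f ->
  closed [set t | strict_sign k o (f t)].
Proof.
move=> cf; case: o => [[]|] /=.
- by apply: closed_fun_le => //; apply: cont_cst.
- by apply: closed_fun_le => //; apply: cont_cst.
- by apply: closed_fun_eq => //; apply: cont_cst.
Qed.

Lemma strict_sign_rsign k o t : strict_sign k o t -> rsign t = o.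
Proof.
have k0 : (0 : R) < k.+1%:R^-1 by rewrite invr_gt0 ltr0n.
rewrite /rsign; case: o => [[]|] /= h.
- by rewrite (lt_le_trans k0 h).
- have t0 : t < 0 by apply: le_lt_trans h _; rewrite oppr_lt0.
  by rewrite t0 ltNge ltW.
- by rewrite h ltxx.
Qed.

Lemma rsign_strict_sign (t : R) : exists k, forall k', (k <= k')%N ->
  strict_sign k' (rsign t) t.
Proof.
have key u : 0 < u -> forall k', (Num.trunc u^-1 <= k')%N -> k'.+1%:R^-1 <= u :> R.
  move=> u0 k'; rewrite truncn_le_nat => h.
  by rewrite invf_ple ?posrE ?ltr0n // ltW.
rewrite /rsign; have [t0|t0|<-] := ltgtP 0 t; last by exists 0%N.
  by exists (Num.trunc t^-1) => k' /= h; apply: key.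
exists (Num.trunc (- t)^-1) => k' h /=; rewrite lerNr; apply: key => //.
by rewrite oppr_gt0.
Qed.

Lemma realizes_strict th s (p : 'rV[R]_n) : realizes ns th s p <->
  exists k, forall (i : 'I_(size ns)) (j : 'I_(Defs.dim n ns i.+1)),
    strict_sign k (s i.+1 j) (preact ns th p i j).
Proof.
split=> [rs|[k h] i j si sj]; last first.
  exact: (strict_sign_rsign (h (Ordinal si) (Ordinal sj))).
have /choice[K KP] (ij : nat * nat) := rsign_strict_sign (preact ns th p ij.1 ij.2).
exists (\max_(i < size ns) \max_(j < Defs.dim n ns i.+1) K (i : nat, j : nat)) => i j.
rewrite -rs //; apply: (KP (i : nat, j : nat)).
apply: leq_trans (leq_bigmax i).
exact: (leq_bigmax (F := fun j : 'I_(Defs.dim n ns i.+1) => K (i : nat, j : nat)) j).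
Qed.

End NetworkExt.

Section MorseMeasurable.
Variables (R : realType) (n : nat) (ns : seq nat).
Variables (d : measure_display) (Om : measurableType d).

Lemma measurable_realizable (th : Om -> 'rV[R]_(size (all_idx n ns)))
    (s : nat -> nat -> option bool) :
  (forall a, measurable_fun setT (fun om => th om 0 a)) ->
  measurable [set om | exists p : 'rV[R]_n, realizes ns (dec (th om)) s p].
Proof.
move=> mth.
pose Z k := [set tp : 'rV[R]_(size (all_idx n ns)) * 'rV[R]_n |
  forall (i : 'I_(size ns)) (j : 'I_(Defs.dim n ns i.+1)),
    strict_sign k (s i.+1 j) (preact ns (dec tp.1) tp.2 i j)].
rewrite [X in measurable X](_ : _ = [set om | exists k p, Z k (th om, p)]); last first.
  apply/seteqP; split=> om /=.
    by move=> [p /realizes_strict[k h]]; exists k, p.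
  by move=> [k [p h]]; exists p; apply/realizes_strict; exists k.
apply: measurable_projection => // k.
apply: closed_forall => i; apply: closed_forall => j; apply: closed_strict_sign.
apply: (@cont_preact R _ n (fun tp : 'rV[R]_(size (all_idx n ns)) * 'rV[R]_n => dec tp.1) snd) => q tp.
  apply: (@continuous_comp _ _ _ fst (@dec R n ns ^~ q)); first exact: cvg_fst.
  exact: cont_dec.
apply: (@continuous_comp _ _ _ snd (fun l : 'rV[R]_n => l 0 q)); first exact: cvg_snd.
exact: coord_continuous.
Qed.

(** The numbers of cones and generators and an integral bound range over countable sets. For fixed
    values, the entries of both generator families form one real vector, along which a closed set is
    projected. *)
Lemma measurable_conic_equiv (th : Om -> 'rV[R]_(size (all_idx n ns)))
    (s : nat -> nat -> option bool) (md : 'rV[R]_n -> R) :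
  (forall a, measurable_fun setT (fun om => th om 0 a)) -> continuous md ->
  measurable [set om | conic_equiv (@dnet R n ns (dec (th om)) s) md].
Proof.
move=> mth cmd.
pose E N m := 'rV[R]_#|{: bool * 'I_N * 'I_m * 'I_n}|.
pose M (b : bool) N m (e : E N m) (i : 'I_N) : 'M[R]_(m, n) :=
  \matrix_(a, c) e 0 (enum_rank (b, i, a, c)).
pose Z N m (C : nat) := [set te : 'rV[R]_(size (all_idx n ns)) * E N m |
  conic_matching (@dnet R n ns (dec te.1) s) md (M true N m te.2) (M false N m te.2) C%:R].
rewrite [X in measurable X](_ : _ = [set om | exists Nm : nat * nat,
   exists C e, Z Nm.1 Nm.2 C (th om, e)]); last first.
  apply/seteqP; split=> om /=.
    move=> [N [m [V [W [C [C0 h]]]]]]; exists (N, m), (Num.trunc C).+1.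
    exists (\row_a (let: (b, i, x, c) := enum_val a in if b then V i x c else W i x c)).
    have MV : M true N m (\row_a (let: (b, i, x, c) := enum_val a in if b then V i x c else W i x c)) = V.
      by apply/funext => i; apply/matrixP => x c; rewrite !mxE enum_rankK.
    have MW : M false N m (\row_a (let: (b, i, x, c) := enum_val a in if b then V i x c else W i x c)) = W.
      by apply/funext => i; apply/matrixP => x c; rewrite !mxE enum_rankK.
    rewrite /Z /= MV MW; apply: conic_matching_le h.
    by apply: ltW; apply: truncnS_gt.
  move=> [[N m] [C [e h]]]; exists N, m, (M true N m e), (M false N m e), C%:R.
  by split.
apply: measurable_exists => -[N m]; apply: measurable_projection => // C.
have cM b i a c : continuous (fun te : 'rV[R]_(size (all_idx n ns)) * E N m => M b N m te.2 i a c).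
  move=> te; rewrite /M; under eq_fun do rewrite mxE.
  apply: (@continuous_comp _ _ _ snd (fun l : E N m => l 0 (enum_rank (b, i, a, c)))); first exact: cvg_snd.
  exact: coord_continuous.
apply: (@closed_conic_matching R n _ (fun te : 'rV[R]_(size (all_idx n ns)) * E N m =>
  @dnet R n ns (dec te.1) s) md N m C%:R (fun te => M true N m te.2) (fun te => M false N m te.2)) => //.
move=> x cx; apply: (@cont_dnet R _ n (fun te : 'rV[R]_(size (all_idx n ns)) * E N m => dec te.1) x) => // q te.
apply: (@continuous_comp _ _ _ fst (@dec R n ns ^~ q)); first exact: cvg_fst.
exact: cont_dec.
Qed.

Lemma measurable_PL_Morse (th : pidx -> Om -> R) :
  (forall q, valid_idx n ns q -> measurable_fun setT (th q)) ->
  measurable [set om | PL_Morse (@relu_net R n ns (fun q => th q om))].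
Proof.
move=> mth.
pose th0 q om := if valid_idx n ns q then th q om else 0.
pose v om : 'rV[R]_(size (all_idx n ns)) := \row_a th0 (nth (0%N, 0%N, None) (all_idx n ns) a) om.
have mth0 q : measurable_fun setT (th0 q).
  rewrite /th0; case vq: (valid_idx n ns q); first exact: mth.
  exact: measurable_cst.
have mv a : measurable_fun setT (fun om => v om 0 a).
  by under eq_fun do rewrite mxE; apply: mth0.
have netE om : relu_net ns (fun q => th q om) = relu_net ns (dec (v om)) :> ('rV[R]_n -> R).
  apply/funext; apply: relu_net_ext => q vq.
  by rewrite (dec_row (th0 ^~ om)) ?valid_all_idx // /th0 vq.
rewrite [X in measurable X](_ : _ = [set om | forall f : pattern n ns,
    (exists p : 'rV[R]_n, realizes ns (dec (v om)) (pattern_sign f) p) ->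
    conic_Morse (@dnet R n ns (dec (v om)) (pattern_sign f))]); last first.
  apply/seteqP; split=> om /=; rewrite netE.
    by move=> FM f [p rf]; apply: PL_Morse_conic rf.
  move=> h; apply: conic_PL_Morse => p.
  have [f fE] := @pattern_sign_ext n ns (fun i j => rsign (preact ns (dec (v om)) p i.-1 j)).
  have rf : realizes ns (dec (v om)) (pattern_sign f) p.
    by move=> i j si sj; rewrite fE.
  by exists (pattern_sign f) => //; apply: h; exists p.
apply: measurable_forall => f; apply: measurable_imply.
  exact: measurable_realizable.
apply: measurableU.
  by apply: measurable_conic_equiv => //; apply: cont_reg_model.
apply: measurable_exists => k.
by apply: measurable_conic_equiv => //; apply: cont_crit_model.
Qed.

End MorseMeasurable.

(** * Counting the regions of a hyperplane arrangement *)

Section RegionCount.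
Variables (R : realType) (n : nat) (J : finType) (w : J -> 'rV[R]_n) (b : J -> R).

Definition aff (j : J) (x : 'rV[R]_n) : R := \sum_k w j 0 k * x 0 k + b j.
Definition lin (j : J) (x : 'rV[R]_n) : R := \sum_k w j 0 k * x 0 k.

Definition on_side (e : {set J}) (j : J) (x : 'rV[R]_n) : Prop :=
  if j \in e then 0 < aff j x else aff j x < 0.

(** The arrangement [S] restricted to the flat cut out by [G]; carrying [G] along is what allows an
    induction by deletion and restriction. *)
Definition cell (S G e : {set J}) : Prop :=
  exists x, (forall g, g \in G -> aff g x = 0) /\ (forall j, j \in S -> on_side e j x).

(** Independence of normals appears as solvability for prescribed slopes, because it is used to find
    directions of motion. *)
Definition general_position : Prop :=
  (forall G : {set J}, (#|G| <= n)%N -> forall c : J -> R,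
     exists v, forall g, g \in G -> lin g v = c g) /\
  (forall (G : {set J}) x, (n < #|G|)%N -> ~ (forall g, g \in G -> aff g x = 0)).

Lemma affD j x t v : aff j (x + t *: v) = aff j x + t * lin j v.
Proof.
rewrite /aff /lin mulr_sumr addrAC; congr (_ + _); rewrite -big_split.
by apply: eq_bigr => k _ /=; rewrite !mxE; ring.
Qed.

Lemma linB j x y : lin j (x - y) = aff j x - aff j y.
Proof.
rewrite /aff /lin opprD addrACA subrr addr0 -sumrB.
by apply: eq_bigr => k _; rewrite !mxE; ring.
Qed.

Hypothesis gp : general_position.

Lemma on_side_perturb (e : {set J}) j x y : on_side e j x ->
  `|aff j y - aff j x| < `|aff j x| -> on_side e j y.
Proof.
rewrite /on_side; case: ifP => _ h; rewrite ltr_norml.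
  by rewrite (gtr0_norm h) => /andP[h1 h2]; lra.
by rewrite (ltr0_norm h) => /andP[h1 h2]; lra.
Qed.

Lemma on_side_convex (e : {set J}) j x y z (s u : R) : 0 < s -> 0 < u ->
  aff j z = s * aff j x + u * aff j y ->
  on_side e j x -> on_side e j y -> on_side e j z.
Proof.
move=> s0 u0; rewrite /on_side => ->; case: ifP => _ hx hy.
  by rewrite addr_gt0 // mulr_gt0.
by rewrite -oppr_gt0 opprD -!mulrN addr_gt0 // mulr_gt0 // oppr_gt0.
Qed.

(* Deletion-restriction: a cell of the smaller arrangement is cut in two by [f]
   exactly when it meets the hyperplane of [f]. *)
Lemma cell_split (S G e : {set J}) f : f \notin S -> f \notin G -> e \subset S ->
  (`[< cell (f |: S) G (f |: e) >] + `[< cell (f |: S) G e >] =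
   `[< cell S G e >] + `[< cell S (f |: G) e >])%N.
Proof.
move=> fS fG eS.
have fe : f \notin e by apply: contra fS => /(fintype.subsetP eS).
have onS j x : j \in S -> on_side (f |: e) j x = on_side e j x.
  move=> jS; rewrite /on_side in_setU1; case: eqP => // jf.
  by rewrite -jf jS in fS.
have onfA x : on_side (f |: e) f x = (0 < aff f x) by rewrite /on_side setU11.
have onfB x : on_side e f x = (aff f x < 0) by rewrite /on_side (negbTE fe).
set A := cell _ _ (f |: e); set B := cell _ _ e.
set X := cell S G e; set Z := cell S _ e.
have ZAB : Z -> A /\ B.
  move=> [x [x0 xS]].
  have sG : (#|f |: G| <= n)%N.
    by rewrite leqNgt; apply/negP => h; apply: (gp.2 _ x h).
  (* Moving along [v] crosses the hyperplane of [f] while staying on those of [G]. *)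
  have [v vG] := gp.1 _ sG (fun j => (j == f)%:R).
  have [|t t0 ht] := @exists_small_scale R J
    (fun j => if j \in S then `|lin j v| else 0)
    (fun j => if j \in S then `|aff j x| else 1).
    move=> j; case: ifP => [jS|//]; rewrite normr_gt0; apply/eqP => aj.
    by have := xS j jS; rewrite /on_side aj ltxx; case: ifP.
  have near j (c : R) : j \in S -> `|c| = t -> on_side e j (x + c *: v).
    move=> jS ct; apply: on_side_perturb (xS j jS) _.
    by rewrite affD addrAC subrr add0r normrM ct; have := ht j; rewrite jS.
  have zero g (c : R) : g \in G -> aff g (x + c *: v) = 0.
    move=> gG; rewrite affD x0 ?vG ?in_setU1 ?gG ?orbT //.
    have -> : (g == f) = false by apply/negbTE/eqP => gf; rewrite -gf gG in fG.
    by rewrite mulr0 addr0.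
  have fE (c : R) : aff f (x + c *: v) = c.
    by rewrite affD x0 ?vG ?setU11 // eqxx mulr1 add0r.
  split.
    exists (x + t *: v); split=> [g|j]; first exact: zero.
    rewrite in_setU1 => /orP[/eqP->|jS]; first by rewrite onfA fE.
    by rewrite onS //; apply: near => //; rewrite gtr0_norm.
  exists (x + (- t) *: v); split=> [g|j]; first exact: zero.
  rewrite in_setU1 => /orP[/eqP->|jS]; first by rewrite onfB fE oppr_lt0.
  by apply: near => //; rewrite normrN gtr0_norm.
have ABZ : A -> B -> Z.
  move=> [x [x0 xS]] [y [y0 yS]].
  have fx : 0 < aff f x by rewrite -onfA; apply: xS; rewrite setU11.
  have fy : aff f y < 0 by rewrite -onfB; apply: yS; rewrite setU11.
  have D0 : 0 < aff f x - aff f y by rewrite subr_gt0 (lt_trans fy).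
  (* Weights of the point where the segment from [x] to [y] meets the hyperplane of [f]. *)
  pose s := - aff f y / (aff f x - aff f y); pose u := aff f x / (aff f x - aff f y).
  have s0 : 0 < s by rewrite divr_gt0 // oppr_gt0.
  have u0 : 0 < u by rewrite divr_gt0.
  have su : s + u = 1 by rewrite -mulrDl addrC divff // gt_eqF.
  pose z := x + u *: (y - x).
  have zE j : aff j z = s * aff j x + u * aff j y.
    by rewrite affD linB -[s](addrK u) su; ring.
  exists z; split=> [g|j jS].
    rewrite in_setU1 => /orP[/eqP->|gG]; last by rewrite zE x0 // y0 // !mulr0 addr0.
    by rewrite zE /s /u; field; rewrite gt_eqF.
  apply: (on_side_convex s0 u0 (zE j)).
    by rewrite -onS //; apply: xS; rewrite in_setU1 jS orbT.
  by apply: yS; rewrite in_setU1 jS orbT.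
have AX : A -> X.
  move=> [x [x0 xS]]; exists x; split=> // j jS; rewrite -onS //.
  by apply: xS; rewrite in_setU1 jS orbT.
have BX : B -> X.
  by move=> [x [x0 xS]]; exists x; split=> // j jS; apply: xS; rewrite in_setU1 jS orbT.
have XABZ : X -> [\/ A, B | Z].
  move=> [x [x0 xS]]; have [fx|fx|fx] := ltgtP 0 (aff f x).
  - apply: Or31; exists x; split=> // j; rewrite in_setU1 => /orP[/eqP->|jS].
      by rewrite onfA.
    by rewrite onS //; apply: xS.
  - apply: Or32; exists x; split=> // j; rewrite in_setU1 => /orP[/eqP->|jS].
      by rewrite onfB.
    exact: xS.
  - apply: Or33; exists x; split=> // g; rewrite in_setU1 => /orP[/eqP->|] //.
    exact: x0.
have [hZ|hZ] := pselect Z.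
  have [hA hB] := ZAB hZ.
  by rewrite !asboolT //; apply: AX.
rewrite (asboolF hZ) addn0; have [hA|hA] := pselect A.
  rewrite (asboolT hA) (asboolT (AX hA)) asboolF // => hB.
  exact: hZ (ABZ hA hB).
rewrite (asboolF hA) add0n; have [hB|hB] := pselect B.
  by rewrite (asboolT hB) (asboolT (BX hB)).
by rewrite (asboolF hB) asboolF // => /XABZ[].
Qed.

Definition ncells (S G : {set J}) : nat :=
  (\sum_(e : {set J} | e \subset S) `[< cell S G e >])%N.

Lemma ncells_setU1 (S G : {set J}) f : f \notin S -> f \notin G ->
  ncells (f |: S) G = (ncells S G + ncells S (f |: G))%N.
Proof.
move=> fS fG; rewrite /ncells -big_split /=.
under [RHS]eq_bigr => e eS do rewrite -cell_split //.
rewrite big_split /= (bigID (fun e : {set J} => f \in e)) /=; congr (_ + _)%N.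
  rewrite (reindex_onto (fun e => f |: e) (fun e => e :\ f)) /=; last first.
    by move=> e /andP[_ fe]; rewrite finset.setD1K.
  apply: eq_bigl => e; rewrite setU11 andbT.
  apply/andP/idP => [[h /eqP <-]|eS].
    by rewrite finset.subDset.
  split; first exact: finset.setUS.
  rewrite finset.setU1K //; apply: contra fS; exact: (fintype.subsetP eS).
apply: eq_bigl => e; apply/andP/idP => [[h fe]|eS].
  apply/fintype.subsetP => j je; have := fintype.subsetP h j je.
  by rewrite in_setU1 => /orP[/eqP jf|] //; rewrite -jf je in fe.
split; last by apply: contra fS; apply: (fintype.subsetP eS).
exact: fintype.subset_trans eS (finset.subsetUr _ _).
Qed.

(** The flat of [G] has dimension [n - #|G|]; when [G] has more than [n] elements it is empty,
    matched by truncated subtraction giving an empty sum. The induction step is Pascal's rule. *)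
Lemma ncellsE (S G : {set J}) : (forall j, j \in S -> j \notin G) ->
  ncells S G = (\sum_(k < n.+1 - #|G|) 'C(#|S|, k))%N.
Proof.
move: {2}#|S| (erefl #|S|) => s; elim: s S G => [|s IH] S G.
  move=> /cards0_eq ->; rewrite cards0 => _.
  rewrite /ncells (big_pred1 finset.set0); last by move=> e; rewrite /= finset.subset0.
  have [Gn|Gn] := leqP #|G| n.
    rewrite subSn // big_ord_recl bin0 big1 ?addn0; last by move=> k _; rewrite bin0n.
    have [v vG] := gp.1 _ Gn (fun j => - aff j 0).
    rewrite asboolT //; exists v; split=> [g gG|j]; last by rewrite finset.in_set0.
    by have := vG g gG; rewrite -[v in LHS](subr0 v) linB => /eqP; rewrite subr_eq addNr => /eqP.
  have -> : (n.+1 - #|G| = 0)%N by apply/eqP; rewrite subn_eq0.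
  rewrite big_ord0 asboolF // => -[x [x0 _]].
  exact: (gp.2 G x Gn).
move=> cS dSG.
have [f fS] : exists f, f \in S by apply/card_gt0P; rewrite cS.
pose S' := S :\ f.
have fS' : f \notin S' by rewrite !inE eqxx.
have cS' : #|S'| = s by have := cardsD1 f S; rewrite fS cS => -[].
have SE : S = f |: S' by rewrite finset.setD1K.
have fG : f \notin G by apply: dSG.
have dS'G j : j \in S' -> j \notin G by move/finset.setD1P => [_]; apply: dSG.
have dS'fG j : j \in S' -> j \notin f |: G.
  by rewrite finset.in_setD1 finset.in_setU1 negb_or => /andP[-> /dSG].
rewrite SE ncells_setU1 // !IH // !cardsU1 fS' fG cS' add1n.
rewrite subnS [(true + s)%N]add1n.
case: (n.+1 - #|G|)%N => [|m] /=; first by rewrite !big_ord0.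
rewrite big_ord_recl bin0 [in RHS]big_ord_recl bin0 -addnA; congr (_ + _)%N.
by rewrite -big_split; apply: eq_bigr => k _ /=; rewrite /bump /= add1n binS.
Qed.

Lemma ncells_general : ncells [set: J]%SET finset.set0 = (\sum_(k < n.+1) 'C(#|J|, k))%N.
Proof.
rewrite ncellsE; last by move=> j _; rewrite finset.in_set0.
by rewrite cards0 subn0 finset.cardsT.
Qed.

End RegionCount.

(** * Laws with independent coordinates *)

Lemma measurable_fun_ext d1 d2 (T1 : measurableType d1) (T2 : measurableType d2)
    (f g : T1 -> T2) : f =1 g -> measurable_fun setT g -> measurable_fun setT f.
Proof. by move=> /funext ->. Qed.

Section ProductSpace.
Variables (R : realType) (I : choiceType) (Vs : seq I).

Definition box (A : I -> set R) : set (I -> R) :=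
  [set t | forall q, q \in Vs -> A q (t q)].
Definition boxes : set (set (I -> R)) :=
  [set box A | A in [set A : I -> set R | forall q, measurable (A q)]].
(** Keeps the type of functions that the network takes as argument, with the sigma-algebra generated
    by the coordinates in [Vs] alone. *)
Definition pspace := g_sigma_algebraType boxes.

Lemma measurable_box (A : I -> set R) : (forall q, measurable (A q)) ->
  measurable (box A : set pspace).
Proof. by move=> mA; apply: sub_sigma_algebra; exists A. Qed.

(** Boxes form a pi-system that contains the whole space. *)
Lemma pspace_unique (m1 m2 : {measure set pspace -> \bar R}) :
  (m1 setT < +oo)%E ->
  (forall A : I -> set R, (forall q, measurable (A q)) -> m1 (box A) = m2 (box A)) ->
  forall S : set pspace, measurable S -> m1 S = m2 S.
Proof.
move=> m1oo m12 S mS.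
apply: (@measure_unique _ _ pspace boxes (fun=> [set: pspace])) => //.
- move=> _ _ [A mA <-] [B mB <-]; exists (fun q => A q `&` B q).
    by move=> q; apply: measurableI.
  apply/seteqP; split=> t /= h.
    by split=> q /h[].
  by move=> q qV; split; [apply: h.1 | apply: h.2].
- move=> _; exists (fun=> setT) => //.
  by apply/seteqP; split.
- by apply/seteqP; split=> // t _; exists 0%N.
- by move=> _ [A mA <-]; apply: m12.
Qed.

Lemma measurable_proj q : q \in Vs -> measurable_fun setT (fun t : pspace => t q).
Proof.
move=> qV _ A mA; rewrite setTI.
have -> : (fun t : pspace => t q) @^-1` A = box (fun q' => if q' == q then A else setT).
  apply/seteqP; split=> t /= h; last by have := h q qV; rewrite eqxx.
  by move=> q' _; case: eqP => // ->.
by apply: measurable_box => q'; case: ifP.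
Qed.

Lemma measurable_into_pspace d (Om : measurableType d) (f : Om -> pspace) :
  (forall q, q \in Vs -> measurable_fun setT (fun om => f om q)) ->
  measurable_fun setT f.
Proof.
move=> mf; apply: (@measurability _ _ Om pspace setT f boxes) => // _ [_ [A mA <-] <-].
rewrite setTI.
have -> : f @^-1` box A = [set om | forall q : seq_sub Vs, A (ssval q) (f om (ssval q))].
  apply/seteqP; split=> om /= h q; first by apply: h; apply: ssvalP.
  by move=> qV; apply: (h (SeqSub qV)).
apply: measurable_forall => q; rewrite -[X in measurable X]setTI.
by apply: mf => //; apply: ssvalP.
Qed.

Variables (nu : probability pspace R) (mu : probability R R).
Hypothesis nu_box : forall A : I -> set R, (forall q, measurable (A q)) ->
  nu (box A) = (\prod_(q <- Vs) mu (A q))%E.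

Definition flip (sg : I -> bool) (t : pspace) : pspace :=
  fun q => if sg q then - t q else t q.

Lemma measurable_flip sg : measurable_fun setT (flip sg).
Proof.
apply: measurable_into_pspace => q qV; rewrite /flip; case: (sg q); last exact: measurable_proj.
by apply: measurableT_comp => //; apply: measurable_proj.
Qed.

Lemma image_opp (A : set R) : [set - x | x in A] = -%R @^-1` A.
Proof.
apply/seteqP; split=> x /=; first by move=> [y Ay <-]; rewrite opprK.
by move=> Ax; exists (- x); rewrite ?opprK.
Qed.

Lemma flip_invariant sg (S : set pspace) : symmetric_law mu -> measurable S ->
  nu (flip sg @^-1` S) = nu S.
Proof.
move=> sym mS.
pose m2 : {measure set pspace -> \bar R} :=
  measure_function_pushforward__canonical__measure_function_Measure nu (measurable_flip sg).
rewrite -[LHS]/(m2 S); apply/esym; apply: pspace_unique => //.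
  exact: le_lt_trans (probability_le1 nu measurableT) (ltry 1).
move=> A mA; rewrite /m2 /= /pushforward.
have mNA (B : set R) : measurable B -> measurable [set - x | x in B].
  move=> mB; rewrite image_opp -[X in measurable X]setTI.
  by apply: (@oppr_measurable R setT).
have -> : flip sg @^-1` box A = box (fun q => if sg q then [set - x | x in A q] else A q).
  apply/seteqP; split=> t /= h q qV; have := h q qV; rewrite /flip; case: (sg q) => //;
    by rewrite image_opp.
rewrite !nu_box //; last by move=> q; case: ifP => // _; apply: mNA.
by apply: eq_bigr => q _; case: ifP => // _; rewrite sym.
Qed.

Hypothesis Vs_uniq : uniq Vs.

Definition resample (q : I) (tr : pspace * R) : pspace :=
  fun q' => if q' == q then tr.2 else tr.1 q'.

Lemma measurable_resample q : measurable_fun setT (resample q).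
Proof.
apply: measurable_into_pspace => q' qV; rewrite /resample; case: eqP => _.
  exact: measurable_snd.
by apply: (@measurableT_comp _ _ _ _ _ _ (fun t : pspace => t q')) => //; apply: measurable_proj.
Qed.

(* Redrawing one coordinate from [mu] leaves the product law unchanged, which
   gives Fubini in that coordinate. *)
Lemma integral_resample q (S : set pspace) : q \in Vs -> measurable S ->
  nu S = (\int[nu]_t mu [set r | S (resample q (t, r))])%E.
Proof.
move=> qV mS.
pose m2 : {measure set pspace -> \bar R} :=
  measure_function_pushforward__canonical__measure_function_Measure (nu \x mu)%E (measurable_resample q).
have -> : nu S = m2 S.
  apply: pspace_unique => //.
    exact: le_lt_trans (probability_le1 nu measurableT) (ltry 1).
  move=> A mA; rewrite /m2 /= /pushforward.
  have -> : resample q @^-1` box A = box (fun q' => if q' == q then setT else A q') `*` A q.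
    apply/seteqP; split=> -[t r] /=.
      move=> h; split=> [q' qV'|]; last by have := h q qV; rewrite /resample eqxx.
      by have := h q' qV'; rewrite /resample; case: eqP.
    by move=> [h1 h2] q' qV'; have := h1 q' qV'; rewrite /resample; case: eqP => // ->.
  rewrite product_measure1E //; last first.
    by apply: measurable_box => q'; case: ifP.
  transitivity ((\prod_(q' <- Vs) mu (if q' == q then setT else A q')) * mu (A q))%E; last first.
    by congr (_ * _)%E; apply/esym; apply: nu_box => q'; case: ifP.
  rewrite nu_box // (bigD1_seq q) //= [X in (_ = X * _)%E](bigD1_seq q) //= eqxx probability_setT mul1e muleC.
  by congr (_ * _)%E; apply: eq_bigr => q' /negbTE ->.
rewrite /m2 /= /pushforward /product_measure1; apply: eq_integral => t _ /=.
by rewrite xsectionE.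
Qed.

Hypothesis mu_ac : mu `<< (@lebesgue_measure R).

Lemma mu_set1 (r : R) : mu [set r] = 0%E.
Proof.
move/null_content_dominatesP: mu_ac; apply => //.
exact: lebesgue_measure_set1.
Qed.

Lemma measurable_eq0 (f : pspace -> R) : measurable_fun setT f ->
  measurable [set t | f t = 0].
Proof.
move=> mf; rewrite -[X in measurable X]setTI.
exact: (mf measurableT [set 0]).
Qed.

(** With the other coordinates fixed and a nonzero slope, the equation has a single root in
    coordinate [q], and [mu] has no atoms. Redrawing coordinate [q] turns this into a statement
    about [nu]. *)
Lemma affine_nonzero q (a b : pspace -> R) : q \in Vs ->
  measurable_fun setT a -> measurable_fun setT b ->
  (forall t r, a (resample q (t, r)) = a t) ->
  (forall t r, b (resample q (t, r)) = b t) ->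
  nu [set t | a t = 0] = 0%E -> nu [set t | a t * t q + b t = 0] = 0%E.
Proof.
move=> qV ma mb aq bq a0.
have mf : measurable_fun setT (fun t : pspace => a t * t q + b t).
  by apply: measurable_funD => //; apply: measurable_funM => //; apply: measurable_proj.
pose X := [set t | a t * t q + b t = 0] `&` ~` [set t | a t = 0].
have mX : measurable X.
  by apply: measurableI; [apply: measurable_eq0 | apply: measurableC; apply: measurable_eq0].
have X0 : nu X = 0%E.
  rewrite (integral_resample qV mX); apply: integral0_eq => t _.
  have [at0|at0] := eqVneq (a t) 0.
    rewrite (_ : [set r | _] = set0) ?measure0 //.
    by apply/seteqP; split=> r // [_] /=; rewrite aq at0.
  rewrite (_ : [set r | _] = [set - b t / a t]) ?mu_set1 //.
  apply/seteqP; split=> r /=.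
    move=> [/= + _]; rewrite aq bq /resample eqxx /= => /eqP.
    by rewrite addr_eq0 => /eqP <-; rewrite mulrC mulKf.
  move=> ->; rewrite /X /= aq bq /resample eqxx /= mulrC mulfVK // addNr.
  by split=> //; apply/eqP.
apply/eqP; rewrite eq_le measure_ge0 andbT.
apply: (@le_trans _ _ (nu (X `|` [set t | a t = 0]))).
  apply: le_measure; rewrite ?inE //; first exact: measurable_eq0.
    by apply: measurableU => //; apply: measurable_eq0.
  move=> t /= ft; have [at0|at0] := pselect (a t = 0); first by right.
  by left.
apply: (@le_trans _ _ (nu X + nu [set t | a t = 0%R])%E); last by rewrite X0 a0 adde0.
by apply: measureU2 => //; apply: measurable_eq0.
Qed.

End ProductSpace.

(** * Generic nonvanishing of minors *)

Section Minors.
Variables (R : realType) (n : nat).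

(* Columns [0 .. n-1] hold the weights, column [n] the bias. *)
Definition col_idx (j : nat) : option nat := if (j < n)%N then Some j else None.

Lemma col_idx_inj i j : (i <= n)%N -> (j <= n)%N -> col_idx i = col_idx j -> i = j.
Proof.
rewrite /col_idx; case: ltnP => hi; case: ltnP => hj hi' hj';
  [by case | by [] | by [] | move=> _].
by apply/eqP; rewrite eqn_leq (leq_trans hi' hj) (leq_trans hj' hi).
Qed.

Definition bordered_mx N k (f : 'I_k -> 'I_N) (t : pidx -> R) (u : nat -> R) : 'M[R]_k.+1 :=
  \matrix_(i, j) if unlift ord_max i is Some i' then t (1%N, f i' : nat, col_idx j) else u j.

(** The last row 0 is a placeholder: cofactors along a row do not see that row. *)
Definition bordered_cof N k (f : 'I_k -> 'I_N) (t : pidx -> R) (j : 'I_k.+1) : R :=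
  cofactor (bordered_mx f t (fun=> 0)) ord_max j.

(** For [k = n.+1] the last column is the bias column, and the minor tests whether [n.+1]
    hyperplanes have a common point. *)
Definition minor N k (f : 'I_k -> 'I_N) (t : pidx -> R) : R :=
  \det (\matrix_(i, j) t (1%N, f i : nat, col_idx j) : 'M[R]_k).

Lemma det_bordered N k (f : 'I_k -> 'I_N) t u :
  \det (bordered_mx f t u) = \sum_(j < k.+1) u j * bordered_cof f t j.
Proof.
rewrite (expand_det_row _ ord_max); apply: eq_bigr => j _.
rewrite mxE unlift_none; congr (_ * _); rewrite /bordered_cof /cofactor.
congr (_ * \det _); apply/matrixP => a b; rewrite !mxE.
by rewrite liftK.
Qed.

Lemma bordered_cof_max N k (f : 'I_k -> 'I_N) t :
  bordered_cof f t ord_max = minor f t.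
Proof.
rewrite /bordered_cof /cofactor -signr_odd oddD addbb mul1r; congr (\det _).
by apply/matrixP => a b; rewrite !mxE liftK lift_max.
Qed.

Lemma minorS N k (f : 'I_k.+1 -> 'I_N) t :
  minor f t = \sum_(j < k.+1) t (1%N, f ord_max : nat, col_idx j) *
                     bordered_cof (fun i => f (lift ord_max i)) t j.
Proof.
rewrite -(det_bordered (fun i => f (lift ord_max i)) t
  (fun j => t (1%N, f ord_max : nat, col_idx j))).
congr (\det _); apply/matrixP => i j; rewrite !mxE.
by case: unliftP => [i' ->|->].
Qed.

End Minors.

Section AlmostSurely.
Variables (R : realType) (n : nat) (ns : seq nat).

Definition param_idx : seq pidx := [seq q <- undup (all_idx n ns) | valid_idx n ns q].

Lemma mem_param_idx q : (q \in param_idx) = valid_idx n ns q.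
Proof.
rewrite mem_filter mem_undup andbC; apply/andP/idP => [[]//|vq].
by rewrite valid_all_idx.
Qed.

Lemma param_idx_uniq : uniq param_idx.
Proof. by rewrite filter_uniq // undup_uniq. Qed.

Local Notation T := (pspace R param_idx).
Variables (nu : probability T R) (mu : probability R R).
Hypothesis nu_box : forall A : pidx -> set R, (forall q, measurable (A q)) ->
  nu (box param_idx A) = (\prod_(q <- param_idx) mu (A q))%E.
Hypothesis mu_ac : mu `<< (@lebesgue_measure R).
Local Notation n1 := (Defs.dim n ns 1).

Definition as_nonzero (f : T -> R) : Prop :=
  measurable_fun setT f /\ nu [set t | f t = 0] = 0%E.

Lemma valid_first (j : 'I_n1) c : (c <= n)%N ->
  (1%N, j : nat, col_idx n c) \in param_idx.
Proof.
move=> cn; rewrite mem_param_idx /valid_idx /= ltn_ord /=.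
by rewrite /col_idx; case: ltnP.
Qed.

Lemma measurable_det k (M : T -> 'M[R]_k) :
  (forall i j, measurable_fun setT (fun t => M t i j)) ->
  measurable_fun setT (fun t => \det (M t)).
Proof.
move=> mM; apply: measurable_sum => s.
apply: measurable_funM; first exact: measurable_cst.
by apply: measurable_prod => i _; apply: mM.
Qed.

Lemma measurable_minor k (f : 'I_k -> 'I_n1) : (k <= n.+1)%N ->
  measurable_fun setT (fun t : T => minor n f t).
Proof.
move=> kn; apply: measurable_det => i j.
apply: (measurable_fun_ext (fun t => mxE _ _ _ _)).
apply: measurable_proj; apply: valid_first.
by rewrite -ltnS (leq_trans (ltn_ord j)).
Qed.

Lemma measurable_bordered_cof k (f : 'I_k -> 'I_n1) j : (k <= n)%N ->
  measurable_fun setT (fun t : T => bordered_cof n f t j).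
Proof.
move=> kn; apply: measurable_funM; first exact: measurable_cst.
apply: measurable_det => a b.
apply: (@measurable_fun_ext _ _ _ _ _ (fun t : T => t (1%N, f a : nat, col_idx n (lift j b)))).
  by move=> t; rewrite !mxE liftK.
by apply: measurable_proj; apply: valid_first; rewrite -ltnS (leq_trans (ltn_ord _)).
Qed.

Lemma resample_first (q : pidx) (t : T) (r : R) j c : (1%N, j, c) != q ->
  resample q (t, r) (1%N, j, c) = t (1%N, j, c).
Proof. by move=> /negbTE h; rewrite /resample h. Qed.

Lemma bordered_cof_resample k (f : 'I_k -> 'I_n1) j q (t : T) r :
  (forall i c, (1%N, f i : nat, c) != q) ->
  bordered_cof n f (resample q (t, r)) j = bordered_cof n f t j.
Proof.
move=> fq; rewrite /bordered_cof /cofactor; congr (_ * \det _).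
apply/matrixP => a b; rewrite !mxE liftK.
exact: resample_first.
Qed.

(** Expanding along the last row shows that the minor is affine in its bottom right entry. The slope
    is the minor of size [k] and the remaining terms do not involve that entry, so induction on the
    size applies. *)
Lemma minor_nonzero k (f : 'I_k -> 'I_n1) : injective f -> (k <= n.+1)%N ->
  as_nonzero (fun t => minor n f t).
Proof.
move=> finj kn; split; first exact: measurable_minor.
elim: k f finj kn => [|k IH] f finj kn.
  rewrite (_ : [set t | _] = set0) ?measure0 //.
  by apply/seteqP; split=> t //=; rewrite /minor det_mx00 => /eqP; rewrite oner_eq0.
set f' := fun i => f (lift ord_max i).
have f'inj : injective f' by move=> a b /finj/lift_inj.
pose q : pidx := (1%N, f ord_max : nat, col_idx n k).
have qV : q \in param_idx by apply: valid_first.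
have f'q i c : (1%N, f' i : nat, c) != q.
  apply/eqP => -[/ord_inj/finj h _].
  by have := neq_lift ord_max i; rewrite h eqxx.
pose b (t : T) := \sum_(j < k) t (1%N, f ord_max : nat, col_idx n j) *
  bordered_cof n f' t (lift ord_max j).
rewrite (_ : [set t | _] = [set t | minor n f' t * t q + b t = 0]); last first.
  apply/seteqP; split=> t /=; rewrite minorS big_ord_recr /= bordered_cof_max;
    rewrite -/f' addrC mulrC (eq_bigr (fun j : 'I_k => t (1%N, f ord_max : nat, col_idx n j) *
      bordered_cof n f' t (lift ord_max j))) // => j _;
    by congr (_ * bordered_cof n f' t _); apply/val_inj; rewrite /= /bump leqNgt ltn_ord.
apply: (affine_nonzero nu_box param_idx_uniq mu_ac qV).
- by apply: measurable_minor; apply: ltnW.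
- apply: measurable_sum => j; apply: measurable_funM.
    by apply: measurable_proj; apply: valid_first; rewrite -ltnS ltnW // ltnS (leq_trans (ltn_ord j)).
  exact: measurable_bordered_cof.
- by move=> t r; rewrite -!bordered_cof_max; apply: bordered_cof_resample.
- move=> t r; apply: eq_bigr => j _; rewrite bordered_cof_resample //.
  rewrite resample_first //; apply/eqP => -[/col_idx_inj h].
  by have := ltn_ord j; rewrite h ?ltnn // ltnW // (leq_trans (ltn_ord j)).
- by apply: IH => //; apply: ltnW.
Qed.

(** The last row holds the first entries of the gradient contributed by the active neurons [S];
    nonvanishing makes this gradient independent of the normals selected by [f]. *)
Definition mixed_det k (f : 'I_k -> 'I_n1) (S : {set 'I_n1}) (t : T) : R :=
  \det (bordered_mx n f t (fun j =>
    \sum_(s in S) t (2%N, 0%N, Some (s : nat)) * t (1%N, s : nat, col_idx n j))).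

(** For any [s] in [S] the determinant is affine in the output weight of [s]. Its slope is the pure
    minor of [f] extended by [s], and this extension is injective because [f] avoids [S]. *)
Lemma mixed_det_nonzero k (f : 'I_k -> 'I_n1) (S : {set 'I_n1}) :
  size ns = 1%N -> injective f -> (k < n)%N -> S != finset.set0 ->
  (forall i, f i \notin S) -> as_nonzero (mixed_det f S).
Proof.
move=> ns1 finj kn /finset.set0Pn[s sS] fS.
have v2 (i : 'I_n1) : (2%N, 0%N, Some (i : nat)) \in param_idx.
  rewrite mem_param_idx /valid_idx ns1 /= ltn_ord andbT.
  by rewrite /Defs.dim /dims /= nth_rcons ns1.
pose q : pidx := (2%N, 0%N, Some (s : nat)).
have kn1 (j : 'I_k.+1) : (j <= n)%N by rewrite -ltnS (leq_trans (ltn_ord j)) // ltnW.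
pose a (t : T) := \sum_(j < k.+1) t (1%N, s : nat, col_idx n j) * bordered_cof n f t j.
pose b (t : T) := \sum_(j < k.+1) (\sum_(s' in S :\ s) t (2%N, 0%N, Some (s' : nat)) *
  t (1%N, s' : nat, col_idx n j)) * bordered_cof n f t j.
have detE t : mixed_det f S t = a t * t q + b t.
  rewrite /mixed_det det_bordered /a /b mulr_suml -big_split /=.
  apply: eq_bigr => j _; rewrite (finset.big_setD1 s) //= mulrDl /q; congr (_ + _).
  by rewrite [RHS]mulrC -mulrA.
pose g (i : 'I_k.+1) : 'I_n1 := if unlift ord_max i is Some i' then f i' else s.
have ginj : injective g.
  move=> i j; rewrite /g; case: unliftP => [i' ->|->]; case: unliftP => [j' ->|->] //.
  - by move/finj => ->.
  - by move=> h; have := fS i'; rewrite h sS.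
  - by move=> h; have := fS j'; rewrite -h sS.
have aE t : a t = minor n g t.
  rewrite minorS /a {1}/g unlift_none; apply: eq_bigr => j _; congr (_ * _).
  by congr (bordered_cof n _ t j); apply/funext => i; rewrite /g liftK.
have ma : measurable_fun setT a.
  apply: (measurable_fun_ext aE).
  by apply: measurable_minor; apply: ltnW.
have mb : measurable_fun setT b.
  apply: measurable_sum => j; apply: measurable_funM.
    apply: (@measurable_fun_ext _ _ _ _ _ (fun t : T => \sum_i (if i \in S :\ s then
      t (2%N, 0%N, Some (i : nat)) * t (1%N, i : nat, col_idx n j) else 0))).
      by move=> t; rewrite big_mkcond.
    apply: measurable_sum => i; case: (i \in S :\ s); last exact: measurable_cst.
    by apply: measurable_funM; apply: measurable_proj => //; apply: valid_first.
  by apply: measurable_bordered_cof; apply: ltnW.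
split.
  apply: (measurable_fun_ext detE).
  by apply: measurable_funD => //; apply: measurable_funM => //; apply: measurable_proj; apply: v2.
rewrite (_ : [set t | _] = [set t | a t * t q + b t = 0]); last first.
  by apply/seteqP; split=> t /=; rewrite detE.
apply: (affine_nonzero nu_box param_idx_uniq mu_ac (v2 s) ma mb).
- by move=> t r; rewrite /a; apply: eq_bigr => j _; rewrite bordered_cof_resample.
- move=> t r; rewrite /b; apply: eq_bigr => j _; rewrite bordered_cof_resample //; congr (_ * _).
  apply: eq_bigr => s'; rewrite finset.in_setD1 => /andP[s's _].
  rewrite [in X in _ * X]/resample /=; congr (_ * _).
  rewrite /resample; case: eqP => // -[/ord_inj h].
  by rewrite h eqxx in s's.
- rewrite (_ : [set t | _] = [set t | minor n g t = 0]); last first.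
    by apply/seteqP; split=> t /=; rewrite aE.
  by have [] := minor_nonzero ginj (ltnW kn : (k.+1 <= n.+1)%N).
Qed.

End AlmostSurely.

(** * Separable PL germs *)

Section Separable.
Variables (R : realType).

Lemma reluB (t : R) : relu t - relu (- t) = t.
Proof.
rewrite /relu; case: (leP 0 t) => t0; first by rewrite max_l ?subr0 // oppr_le0.
by rewrite max_r ?oppr_ge0 ?ltW // sub0r opprK.
Qed.

Lemma relu_lip (s t : R) : `|relu s - relu t| <= `|s - t|.
Proof.
have key (a b : R) : b <= a -> `|relu a - relu b| <= `|a - b|.
  move=> ba; rewrite /relu [leRHS]ger0_norm ?subr_ge0 //.
  by case: (leP 0 a) => a0; case: (leP 0 b) => b0; rewrite ger0_norm; lra.
case: (leP t s) => [|/ltW] h; first exact: key.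
by rewrite distrC [leRHS]distrC; apply: key.
Qed.

(** The PL function of one variable with slope [a] on the right of 0 and slope [b] on the left. *)
Definition tau (a b t : R) : R := a * relu t - b * relu (- t).

Lemma tau_ge0 a b t : 0 <= t -> tau a b t = a * t.
Proof. by move=> t0; rewrite /tau /relu max_r // max_l ?oppr_le0 // mulr0 subr0. Qed.

Lemma tau_le0 a b t : t <= 0 -> tau a b t = b * t.
Proof.
by move=> t0; rewrite /tau /relu max_l // max_r ?oppr_ge0 // mulr0 sub0r mulrN opprK.
Qed.

Lemma tau_lip a b s t : `|tau a b s - tau a b t| <= (`|a| + `|b|) * `|s - t|.
Proof.
have -> : tau a b s - tau a b t =
    a * (relu s - relu t) - b * (relu (- s) - relu (- t)) by rewrite /tau; ring.
apply: le_trans (ler_normB _ _) _; rewrite !normrM mulrDl.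
apply: lerD; apply: ler_wpM2l => //; first exact: relu_lip.
by apply: le_trans (relu_lip _ _) _; rewrite -opprD normrN.
Qed.

Lemma tau_inverse a b : 0 < a * b -> exists c d : R,
  cancel (tau a b) (tau c d) /\ cancel (tau c d) (tau a b).
Proof.
have pos (c d : R) : 0 < c -> 0 < d -> cancel (tau c d) (tau c^-1 d^-1).
  move=> c0 d0 t; case: (leP 0 t) => [t0|/ltW t0].
    by rewrite [tau c d t]tau_ge0 // tau_ge0 ?mulKf ?gt_eqF // mulr_ge0 // ltW.
  by rewrite [tau c d t]tau_le0 // tau_le0 ?mulKf ?gt_eqF // mulr_ge0_le0 // ltW.
have neg (c d : R) : c < 0 -> d < 0 -> cancel (tau c d) (tau d^-1 c^-1).
  move=> c0 d0 t; case: (leP 0 t) => [t0|/ltW t0].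
    rewrite [tau c d t]tau_ge0 // tau_le0 ?mulKf ?lt_eqF //.
    by rewrite mulr_le0_ge0 // ltW.
  rewrite [tau c d t]tau_le0 // tau_ge0 ?mulKf ?lt_eqF //.
  by rewrite mulr_le0 // ltW.
case: (ltgtP 0 a) => a0; last by rewrite -a0 mul0r ltxx.
  rewrite pmulr_rgt0 // => b0; exists a^-1, b^-1; split; first exact: pos.
  by have := pos a^-1 b^-1; rewrite !invr_gt0 !invrK; apply.
rewrite nmulr_rgt0 // => b0; exists b^-1, a^-1; split; first exact: neg.
by have := neg b^-1 a^-1; rewrite !invr_lt0 !invrK; apply.
Qed.

(** Slopes of opposite sign give plus or minus the absolute value of a monotone rescaling; that
    rescaling is the coordinate change to the critical model. *)
Lemma tau_norm (a b t : R) : a * b < 0 ->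
  tau a b t = (if a < 0 then -1 else 1) * `|tau `|a| `|b| t|.
Proof.
move=> ab; case: (leP 0 t) => [t0|/ltW t0].
  rewrite !tau_ge0 // normrM normr_id (ger0_norm t0) mulrA.
  by case: ltP => a0; rewrite ?mulN1r ?mul1r ?(ltr0_norm a0) ?(ger0_norm a0) ?opprK.
rewrite !tau_le0 // normrM normr_id (ler0_norm t0).
case: ltP => a0.
  have b0 : 0 < b by rewrite -(nmulr_rlt0 b a0).
  by rewrite gtr0_norm //; ring.
have {}a0 : 0 < a by rewrite lt_def a0 andbT; apply/eqP => a00; rewrite a00 mul0r ltxx in ab.
have b0 : b < 0 by rewrite -(pmulr_rlt0 b a0).
by rewrite ltr0_norm //; ring.
Qed.

Variable n : nat.
Implicit Types (y z : 'rV[R]_n) (A B : 'M[R]_n).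

Definition pospart y : 'rV[R]_n := \row_j relu (y 0 j).
Definition negpart y : 'rV[R]_n := \row_j relu (- y 0 j).
(** The shape of all coordinate changes below: every output coordinate is a sum of functions [tau]
    of single input coordinates, so the map is linear on each orthant. *)
Definition sepmap A B y : 'rV[R]_n := pospart y *m A - negpart y *m B.
Definition sumabs A : R := \sum_i \sum_j `|A i j|.

Lemma sumabs_ge0 A : 0 <= sumabs A.
Proof. by apply: sumr_ge0 => i _; apply: sumr_ge0. Qed.

Lemma sepmapE A B y j : sepmap A B y 0 j = \sum_i tau (A i j) (B i j) (y 0 i).
Proof. by rewrite !mxE -sumrB; apply: eq_bigr => i _; rewrite !mxE /tau; ring. Qed.

Lemma sepmap_lip A B y z :
  `|sepmap A B y - sepmap A B z| <= (sumabs A + sumabs B) * `|y - z|.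
Proof.
have -> : sepmap A B y - sepmap A B z =
    (pospart y - pospart z) *m A - (negpart y - negpart z) *m B.
  rewrite /sepmap !mulmxBl.
  move: (pospart y *m A) (negpart y *m B) (pospart z *m A) (negpart z *m B).
  by move=> u1 u2 u3 u4; apply/rowP => j; rewrite !mxE; ring.
apply: le_trans (ler_normB _ _) _; rewrite mulrDl; apply: lerD.
  apply: le_trans (norm_mulmx_le _ _) _; apply: ler_wpM2l; first exact: sumabs_ge0.
  apply: norm_le_entry => // j; rewrite !mxE; apply: le_trans (relu_lip _ _) _.
  by have := entry_le_norm (y - z) j; rewrite !mxE.
apply: le_trans (norm_mulmx_le _ _) _; apply: ler_wpM2l; first exact: sumabs_ge0.
apply: norm_le_entry => // j; rewrite !mxE; apply: le_trans (relu_lip _ _) _.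
by rewrite -opprD normrN; have := entry_le_norm (y - z) j; rewrite !mxE.
Qed.

Definition sign_mx (e : {set 'I_n}) : 'M[R]_n :=
  diag_mx (\row_j (if j \in e then -1 else 1)).
Definition orthant_mx (e : {set 'I_n}) A B : 'M[R]_n :=
  \matrix_(i, j) (if i \in e then - B i j else A i j).

Lemma sign_mxE (e : {set 'I_n}) (l : 'rV[R]_n) j :
  (l *m sign_mx e) 0 j = if j \in e then - l 0 j else l 0 j.
Proof.
rewrite mxE (bigD1 j) //= !mxE eqxx big1 ?addr0 => [|i /negbTE ij].
  by case: ifP => _ /=; rewrite mulr1n ?mulrN mulr1.
by rewrite !mxE ij mulr0n mulr0.
Qed.

Lemma sepmap_orthant (e : {set 'I_n}) A B (l : 'rV[R]_n) : nneg l ->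
  sepmap A B (l *m sign_mx e) = l *m orthant_mx e A B.
Proof.
move=> l0; apply/rowP => j; rewrite sepmapE mxE; apply: eq_bigr => i _.
rewrite sign_mxE !mxE; case: ifP => _.
  by rewrite tau_le0 ?oppr_le0 ?l0 // mulrN mulrC mulrN.
by rewrite tau_ge0 ?l0 // mulrC.
Qed.

Lemma orthant_decomp y : exists e (l : 'rV[R]_n),
  [/\ nneg l, forall j, l 0 j <= `|y| & y = l *m sign_mx e].
Proof.
exists [set j | y 0 j < 0]%SET, (\row_j `|y 0 j|); split.
- by move=> j; rewrite mxE.
- by move=> j; rewrite mxE; apply: entry_le_norm.
apply/rowP => j; rewrite sign_mxE mxE finset.in_set; case: ltP => yj.
  by rewrite ltr0_norm // opprK.
by rewrite ger0_norm.
Qed.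

(** The cones are the orthants: [V] pulls their generators back through [M] and [W] pushes them
    forward through [sepmap A B]. The inverse [Psi] only has to be Lipschitz. *)
Lemma sep_conic_equiv (M A B : 'M[R]_n) (D md : 'rV[R]_n -> R)
    (Psi : 'rV[R]_n -> 'rV[R]_n) (K : R) : M \in unitmx -> 0 <= K ->
  (forall z z', `|Psi z - Psi z'| <= K * `|z - z'|) ->
  cancel (sepmap A B) Psi -> cancel Psi (sepmap A B) ->
  (forall x, D x = md (sepmap A B (x *m M))) -> conic_equiv D md.
Proof.
move=> Mu K0 Plip SP PS DE.
pose V (i : 'I_#|{set 'I_n}|) := sign_mx (enum_val i) *m invmx M.
pose W (i : 'I_#|{set 'I_n}|) := orthant_mx (enum_val i) A B.
have VM i (l : 'rV[R]_n) : (l *m V i) *m M = l *m sign_mx (enum_val i).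
  by rewrite /V !mulmxA mulmxKV.
have HV i (l : 'rV[R]_n) : nneg l -> sepmap A B ((l *m V i) *m M) = l *m W i.
  by move=> l0; rewrite VM sepmap_orthant.
have P0 : Psi 0 = 0.
  have s0 : sepmap A B 0 = 0.
    apply/rowP => j; rewrite sepmapE mxE; apply: big1 => i _.
    by rewrite mxE tau_ge0 // mulr0.
  by rewrite -[in LHS]s0 SP.
pose cM := sumabs M; pose ci := sumabs (invmx M); pose cS := sumabs A + sumabs B.
have cM0 : 0 <= cM by apply: sumabs_ge0.
have ci0 : 0 <= ci by apply: sumabs_ge0.
have cS0 : 0 <= cS by rewrite addr_ge0 // sumabs_ge0.
(* The four summands bound, in order, the covering by [V], the covering by [W], the distances of [V]
   in terms of [W], and those of [W] in terms of [V]. *)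
exists #|{set 'I_n}|, n, V, W, (cM + K + (ci * K + cS * cM)).
have h1 : 0 <= ci * K by rewrite mulr_ge0.
have h2 : 0 <= cS * cM by rewrite mulr_ge0.
split; first by lra.
split.
- apply: (@conic_cover_le _ _ _ _ _ cM); first by lra.
  move=> x; have [e [l [l0 lx xE]]] := orthant_decomp (x *m M).
  exists (enum_rank e), l; split=> // [j|].
    exact: le_trans (lx j) (norm_mulmx_le _ _).
  by rewrite /V enum_rankK mulmxA -xE mulmxK.
- apply: (@conic_cover_le _ _ _ _ _ K); first by lra.
  move=> z; have [e [l [l0 lx xE]]] := orthant_decomp (Psi z).
  exists (enum_rank e), l; split=> // [j|].
    by apply: le_trans (lx j) _; have := Plip z 0; rewrite P0 !subr0.
  by rewrite /W enum_rankK -sepmap_orthant // -xE PS.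
- apply: (@conic_lip_le _ _ _ _ _ _ (ci * K)); first by lra.
  move=> i j k l k0 l0; rewrite /V !mulmxA -mulmxBl.
  apply: le_trans (norm_mulmx_le _ _) _; rewrite -mulrA; apply: ler_wpM2l => //.
  rewrite -[k *m sign_mx _]SP -[l *m sign_mx _]SP !sepmap_orthant //.
- apply: (@conic_lip_le _ _ _ _ _ _ (cS * cM)); first by lra.
  move=> i j k l k0 l0; rewrite -!HV //.
  apply: le_trans (sepmap_lip _ _ _ _) _; rewrite -mulrA; apply: ler_wpM2l => //.
  by rewrite -mulmxBl; apply: norm_mulmx_le.
by move=> i l l0; rewrite DE HV.
Qed.

Lemma reg_modelE (i : 'I_n) : val i = n.-1 -> forall z, reg_model z = z 0 i.
Proof.
move=> iE z; rewrite /reg_model (big_pred1 i) // => j.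
by rewrite /= -(inj_eq val_inj) iE.
Qed.

(** The function itself becomes the last coordinate. Its summand at [i0] is a homeomorphism of the
    line, so the coordinate [i0] can be recovered from the value and the other coordinates; the
    transposition [s] stores the old last coordinate in the slot of [i0]. *)
Lemma conic_equiv_regular (M : 'M[R]_n) (D : 'rV[R]_n -> R) (a b : 'I_n -> R) i0 :
  M \in unitmx -> (forall x, D x = \sum_i tau (a i) (b i) ((x *m M) 0 i)) ->
  0 < a i0 * b i0 -> conic_equiv D (@reg_model R n).
Proof.
move=> Mu DE ab0; have [c [d [tK Kt]]] := tau_inverse ab0.
have n0 : (n.-1 < n)%N by case: (n) i0 {M D a b Mu DE ab0 tK Kt} => [[]|].
pose top := Ordinal n0; pose s := tperm i0 top.
have sK : involutive s by apply: tpermK.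
have s_top i : i != i0 -> s i != top.
  by apply: contra => /eqP h; apply/eqP; rewrite -[i]sK h /s tpermR.
have s_i0 j : j != top -> s j != i0.
  by apply: contra => /eqP h; apply/eqP; rewrite -[j]sK h /s tpermL.
pose A : 'M[R]_n := \matrix_(i, j) if j == top then a i else (i == s j)%:R.
pose B : 'M[R]_n := \matrix_(i, j) if j == top then b i else (i == s j)%:R.
have ABtop y : sepmap A B y 0 top = \sum_i tau (a i) (b i) (y 0 i).
  by rewrite sepmapE; apply: eq_bigr => i _; rewrite !mxE eqxx.
have ABj y j : j != top -> sepmap A B y 0 j = y 0 (s j).
  move=> /negbTE jt; rewrite sepmapE (bigD1 (s j)) //= !mxE jt eqxx.
  rewrite /tau !mul1r reluB big1 ?addr0 // => i /negbTE ij.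
  by rewrite !mxE jt ij !mul0r subrr.
pose rest z := \sum_(i | i != i0) tau (a i) (b i) (z 0 (s i)).
pose Psi z : 'rV[R]_n := \row_i if i == i0 then tau c d (z 0 top - rest z) else z 0 (s i).
pose L := \sum_i (`|a i| + `|b i|).
have L0 : 0 <= L by apply: sumr_ge0 => i _; rewrite addr_ge0.
have restlip z z' : `|rest z - rest z'| <= L * `|z - z'|.
  rewrite /rest -sumrB; apply: le_trans (ler_norm_sum _ _ _) _.
  rewrite mulr_suml big_mkcond /=; apply: ler_sum => i _; case: ifP => _; last first.
    by rewrite mulr_ge0 // addr_ge0.
  apply: le_trans (tau_lip _ _ _ _) _; apply: ler_wpM2l; first by rewrite addr_ge0.
  by have := entry_le_norm (z - z') (s i); rewrite !mxE.
have cd0 : 0 <= `|c| + `|d| by rewrite addr_ge0.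
apply: (@sep_conic_equiv M A B D _ Psi ((`|c| + `|d|) * (1 + L) + 1)) => //.
- by rewrite addr_ge0 // mulr_ge0 // addr_ge0.
- move=> z z'; have N0 : 0 <= `|z - z'| by [].
  apply: norm_le_entry => [|i]; first by rewrite mulr_ge0 // addr_ge0 // mulr_ge0 // addr_ge0.
  rewrite !mxE; case: ifP => _; last first.
    apply: (@le_trans _ _ (1 * `|z - z'|)).
      by rewrite mul1r; have := entry_le_norm (z - z') (s i); rewrite !mxE.
    by apply: ler_wpM2r => //; rewrite lerDr mulr_ge0 // addr_ge0.
  apply: le_trans (tau_lip _ _ _ _) _.
  apply: (@le_trans _ _ ((`|c| + `|d|) * (1 + L) * `|z - z'|)); last first.
    by apply: ler_wpM2r => //; rewrite lerDl.
  rewrite -mulrA; apply: ler_wpM2l => //.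
  have -> : z 0 top - rest z - (z' 0 top - rest z') =
      (z 0 top - z' 0 top) - (rest z - rest z') by ring.
  apply: le_trans (ler_normB _ _) _; rewrite mulrDl mul1r; apply: lerD => //.
  by have := entry_le_norm (z - z') top; rewrite !mxE.
- move=> y; apply/rowP => i; rewrite mxE; case: eqP => [->|/eqP ii0]; last first.
    by rewrite ABj ?s_top // sK.
  rewrite ABtop /rest (bigD1 i0) //= -[RHS]tK; congr (tau c d _).
  rewrite [X in _ - X](eq_bigr (fun i => tau (a i) (b i) (y 0 i))) ?addrK //.
  by move=> j ji0; rewrite ABj ?s_top // sK.
- move=> z; apply/rowP => j; have [->|jt] := eqVneq j top; last first.
    by rewrite ABj // mxE (negbTE (s_i0 j jt)) sK.
  rewrite ABtop (bigD1 i0) //= mxE eqxx Kt -[RHS](subrK (rest z)); congr (_ + _).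
  by apply: eq_bigr => i /negbTE ii0; rewrite mxE ii0.
by move=> x; rewrite (@reg_modelE top) // ABtop DE.
Qed.

(** Brings the descending coordinates to the front, where [crit_model] expects them. *)
Lemma exists_sorting_perm (P : pred 'I_n) : exists s : {perm 'I_n},
  forall j, P (s j) = (j < #|P|)%N.
Proof.
pose r := enum P ++ enum (predC P).
have sr : size r = n by rewrite size_cat -!cardE cardC card_ord.
have ur : uniq r.
  rewrite cat_uniq !enum_uniq andbT /=; apply/hasPn => i.
  by rewrite !mem_enum.
have inj : injective (fun j : 'I_n => nth j r j).
  move=> i j; have <- : nth i r j = nth j r j by apply: set_nth_default; rewrite sr.
  by move/eqP; rewrite nth_uniq ?sr // => /eqP/val_inj.
exists (perm inj) => j; rewrite permE nth_cat -cardE; case: ltnP => jP.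
  have : nth j (enum P) j \in enum P by apply: mem_nth; rewrite -cardE.
  by rewrite mem_enum.
have : nth j (enum (predC P)) (j - #|P|) \in enum (predC P).
  by apply: mem_nth; rewrite -cardE ltn_subLR // cardC card_ord.
by rewrite mem_enum => /negbTE.
Qed.

(** Rescaling the two half-lines of coordinate [i] by the absolute values of [a i] and [b i] turns
    each summand into plus or minus an absolute value; the index counts the negative [a i]. *)
Lemma conic_equiv_critical (M : 'M[R]_n) (D : 'rV[R]_n -> R) (a b : 'I_n -> R) :
  M \in unitmx -> (forall x, D x = \sum_i tau (a i) (b i) ((x *m M) 0 i)) ->
  (forall i, a i * b i < 0) -> exists k : 'I_n.+1, conic_equiv D (@crit_model R n k).
Proof.
move=> Mu DE ab; pose P : pred 'I_n := fun i => a i < 0.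
have [s sP] := exists_sorting_perm P.
have kn : (#|P| < n.+1)%N by rewrite ltnS -[X in (_ <= X)%N]card_ord max_card.
exists (Ordinal kn).
have a0 i : 0 < `|a i|.
  by rewrite normr_gt0; apply/eqP => h; have := ab i; rewrite h mul0r ltxx.
have b0 i : 0 < `|b i|.
  by rewrite normr_gt0; apply/eqP => h; have := ab i; rewrite h mulr0 ltxx.
pose A : 'M[R]_n := \matrix_(i, j) ((i == s j)%:R * `|a i|).
pose B : 'M[R]_n := \matrix_(i, j) ((i == s j)%:R * `|b i|).
have ABE y j : sepmap A B y 0 j = tau `|a (s j)| `|b (s j)| (y 0 (s j)).
  rewrite sepmapE (bigD1 (s j)) //= !mxE eqxx !mul1r big1 ?addr0 // => i /negbTE ij.
  by rewrite !mxE ij !mul0r /tau !mul0r subrr.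
have /choice[cd cdP] i : exists cd : R * R, cancel (tau `|a i| `|b i|) (tau cd.1 cd.2) /\
    cancel (tau cd.1 cd.2) (tau `|a i| `|b i|).
  by have [|c [d h]] := @tau_inverse `|a i| `|b i|; [rewrite mulr_gt0 | exists (c, d)].
pose Psi z : 'rV[R]_n := \row_i tau (cd i).1 (cd i).2 (z 0 ((s^-1)%g i)).
pose K := \sum_i (`|(cd i).1| + `|(cd i).2|).
have K0 : 0 <= K by apply: sumr_ge0 => i _; rewrite addr_ge0.
apply: (@sep_conic_equiv M A B D _ Psi K) => //.
- move=> z z'; apply: norm_le_entry => [|i]; first by rewrite mulr_ge0.
  rewrite !mxE; apply: le_trans (tau_lip _ _ _ _) _; apply: ler_pM => //.
    by rewrite /K (bigD1 i) //= lerDl sumr_ge0 // => j _; rewrite addr_ge0.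
  by have := entry_le_norm (z - z') ((s^-1)%g i); rewrite !mxE.
- by move=> y; apply/rowP => i; rewrite mxE ABE permKV (cdP i).1.
- by move=> z; apply/rowP => j; rewrite ABE mxE permK (cdP _).2.
move=> x; rewrite DE (reindex_perm s) /= /crit_model (bigID (fun j : 'I_n => (j < #|P|)%N)) /=.
congr (_ + _); rewrite -?sumrN.
  apply: eq_bigr => j jP; rewrite ABE tau_norm // -/(P (s j)) sP jP mulN1r //.
under [RHS]eq_bigl do rewrite leqNgt.
apply: eq_bigr => j /negbTE jP; rewrite ABE tau_norm // -/(P (s j)) sP jP mul1r //.
Qed.

(** In the factorisation of [A] through [col_ebase A], a partial identity and [row_ebase A], padding
    the left factor with an identity block gives an invertible matrix whose top rows are those of
    [A]. *)
Lemma extend_row_free k (A : 'M[R]_(k, n)) : row_free A ->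
  exists2 M : 'M[R]_n, M \in unitmx & exists2 f : 'I_k -> 'I_n, injective f &
  forall i, row (f i) M = row i A.
Proof.
move=> Afree; have kn : (k <= n)%N by rewrite -(eqP Afree) rank_leq_col.
have [r nE] : exists r, n = (k + r)%N by exists (n - k)%N; rewrite subnKC.
move: A Afree {kn}; rewrite nE => A Afree.
exists (block_mx (col_ebase A) 0 0 1%:M *m row_ebase A).
  rewrite unitmx_mul row_ebase_unit andbT unitmxE det_ublock det1 mulr1.
  by rewrite -unitmxE col_ebase_unit.
exists (@lshift k r); first exact: lshift_inj.
move=> i; rewrite -{3}(mulmx_ebase A) (eqP Afree) row_mul [in RHS]row_mul.
congr (_ *m _); apply/rowP => j; rewrite [LHS]mxE [in RHS]row_mul [RHS]mxE.
case: (split_ordP j) => j' ->.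
  rewrite block_mxEul (bigD1 j') //= !mxE /= eqxx ltn_ord mulr1 big1 ?addr0 // => a.
  by rewrite !mxE /= => /negbTE; rewrite -(inj_eq val_inj) /= => ->; rewrite mulr0.
rewrite block_mxEur mxE big1 // => a _; rewrite !mxE /=.
case: eqP => [h|_]; last by rewrite mulr0.
by have := ltn_ord a; rewrite h ltnNge leq_addr.
Qed.

End Separable.

(** * Networks with one hidden layer *)

Lemma sum_injective_support (V : nmodType) (I J : finType) (g : I -> J) (F : J -> V) :
  injective g -> (forall j, (forall i, g i != j) -> F j = 0) ->
  \sum_j F j = \sum_i F (g i).
Proof.
move=> ginj F0; rewrite (bigID [in codom g]) /= [X in _ + X]big1 ?addr0; last first.
  by move=> j jg; apply: F0 => i; apply: contra jg => /eqP <-; apply: codom_f.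
rewrite -big_uniq /=; last by rewrite map_inj_uniq // enum_uniq.
by rewrite big_map big_enum.
Qed.

Lemma row_free_of_minor (R : realType) k n (X : 'M[R]_(k, n)) (Y : 'M[R]_k) (kn : (k <= n)%N) :
  (forall i j, Y i j = X i (widen_ord kn j)) -> \det Y != 0 -> row_free X.
Proof.
move=> YX dY; apply: inj_row_free => v vX.
have Yu : Y \in unitmx by rewrite unitmxE unitfE.
rewrite -[v](mulmxK Yu) (_ : v *m Y = 0) ?mul0mx //.
apply/rowP => j; rewrite [RHS]mxE; have := congr1 (fun u : 'rV_n => u 0 (widen_ord kn j)) vX.
by rewrite !mxE => h; rewrite -[RHS]h; apply: eq_bigr => i _; rewrite YX.
Qed.

Section OneLayer.
Variables (R : realType) (n N : nat) (t : pidx -> R).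

Definition weight (j : 'I_N) : 'rV[R]_n := \row_k t (1%N, j : nat, Some (k : nat)).
Definition bias (j : 'I_N) : R := t (1%N, j : nat, None).
Definition outw (j : 'I_N) : R := t (2%N, 0%N, Some (j : nat)).
Definition out_sum (S : {set 'I_N}) (j : nat) : R :=
  \sum_(s in S) outw s * t (1%N, s : nat, col_idx n j).

Definition minors_nonzero : Prop := forall k (f : 'I_k -> 'I_N),
  injective f -> (k <= n.+1)%N -> minor n f t != 0.

Definition mixed_minors_nonzero : Prop :=
  forall k (f : 'I_k -> 'I_N) (S : {set 'I_N}), injective f -> (k < n)%N ->
  S != finset.set0 -> (forall i, f i \notin S) ->
  \det (bordered_mx n f t (out_sum S)) != 0.

Lemma col_idx_ord (j : 'I_n) : col_idx n j = Some (j : nat).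
Proof. by rewrite /col_idx ltn_ord. Qed.

(** A common point [x] of [n.+1] hyperplanes would place the nonzero vector [(x, 1)] in the kernel
    of a minor with bias column. Smaller minors make the normals independent, and a right inverse
    solves for the slopes. *)
Lemma general_position_of_minors : minors_nonzero -> general_position weight bias.
Proof.
move=> hm; split.
  move=> G Gn c; pose f : 'I_#|G| -> 'I_N := enum_val.
  pose W : 'M[R]_(#|G|, n) := \matrix_i weight (f i).
  have Wfree : row_free W.
    apply: (@row_free_of_minor _ _ _ W _ Gn _ (hm _ f enum_val_inj _)); last exact: leqW.
    by move=> i j; rewrite !mxE /= /col_idx (leq_trans (ltn_ord j) Gn).
  have [X WX] := row_freeP Wfree.
  pose u : 'cV[R]_n := X *m \col_i c (f i).
  exists u^T => g gG; rewrite -(enum_rankK_in gG gG).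
  set i := enum_rank_in gG g.
  have -> : lin weight (enum_val i) u^T = (W *m u) i 0.
    by rewrite /lin [RHS]mxE; apply: eq_bigr => k _; rewrite !mxE.
  by rewrite mulmxA WX mul1mx mxE.
move=> G x Gn h; pose f (i : 'I_n.+1) : 'I_N := enum_val (widen_ord Gn i).
have finj : injective f by move=> i j /enum_val_inj /(congr1 val) /= /val_inj.
have := hm _ f finj (leqnn _); rewrite /minor; set M := (X in \det X) => dM.
have Mu : M \in unitmx by rewrite unitmxE unitfE.
pose z : 'cV[R]_n.+1 := \col_j (if insub (val j) is Some j' then x 0 j' else 1).
have Mz : M *m z = 0.
  apply/colP => i; rewrite mxE big_ord_recr /= [RHS]mxE !mxE /=.
  rewrite insubF ?ltnn // mulr1 /col_idx ltnn.
  apply: etrans _ (h (f i) (enum_valP _)); rewrite /aff /bias; congr (_ + _).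
  by apply: eq_bigr => j _; rewrite !mxE /= col_idx_ord valK.
have : z = 0 by rewrite -[z](mulKmx Mu) Mz mulmx0.
move/(congr1 (fun u : 'cV[R]_n.+1 => u ord_max 0)); rewrite !mxE /= insubF ?ltnn //.
by move/eqP; rewrite oner_eq0.
Qed.

Hypotheses (hm : minors_nonzero) (hx : mixed_minors_nonzero).
Let gp := general_position_of_minors hm.
Local Notation aff := (aff weight bias).
Local Notation lin := (lin weight).

Lemma inpE (x : 'rV[R]_n) (j : 'I_n) : inp x j = x 0 j.
Proof. by rewrite /inp (big_pred1 j) // => i /=; rewrite -(inj_eq val_inj). Qed.

Lemma preactE (p : 'rV[R]_n) (j : 'I_N) : preact [:: N] t p 0 j = aff j p.
Proof.
rewrite /preact /layer_affine /aff; congr (_ + _); apply: eq_bigr => k _.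
by rewrite mxE -inpE.
Qed.

Definition zero_set (p : 'rV[R]_n) : {set 'I_N} := [set j | aff j p == 0]%SET.
Definition pos_set (p : 'rV[R]_n) : {set 'I_N} := [set j | 0 < aff j p]%SET.
Definition sign_at (p : 'rV[R]_n) (i j : nat) := rsign (preact [:: N] t p i.-1 j).

Lemma dnetE (p x : 'rV[R]_n) : dnet [:: N] t (sign_at p) x =
  \sum_(j in pos_set p) outw j * lin j x + \sum_(j in zero_set p) outw j * relu (lin j x).
Proof.
rewrite [X in _ = X + _]big_mkcond [X in _ = _ + X]big_mkcond -big_split /=.
apply: eq_bigr => j _; rewrite !finset.in_set /sign_at /= preactE /rsign.
have -> : \sum_(k < n) t (1%N, j : nat, Some (k : nat)) * inp x k = lin j x.
  by apply: eq_bigr => k _; rewrite mxE inpE.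
by case: (ltgtP 0 (aff j p)) => h /=; rewrite ?mulr0 ?addr0 ?add0r.
Qed.

Lemma card_zero_set p : (#|zero_set p| <= n)%N.
Proof.
rewrite leqNgt; apply/negP => h; apply: (gp.2 _ p h) => g.
by rewrite finset.in_set => /eqP.
Qed.

(* Pushing [p] off its zero set towards the negative sides would reach the
   region where every neuron is off. *)
Lemma pos_set_nonempty p : ~ cell weight bias [set: 'I_N]%SET finset.set0 finset.set0 ->
  pos_set p != finset.set0.
Proof.
move=> nflat; apply/eqP => S0; apply: nflat.
have neg j : aff j p <= 0.
  rewrite leNgt; apply/negP => h; have : j \in pos_set p by rewrite finset.in_set.
  by rewrite S0 finset.in_set0.
have [v vT] := gp.1 _ (card_zero_set p) (fun=> -1).
have [|s s0 hs] := @exists_small_scale R 'I_N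
  (fun j => if aff j p == 0 then 0 else lin j v)
  (fun j => if aff j p == 0 then 1 else - aff j p).
  move=> j; case: ifPn => // h; rewrite oppr_gt0 lt_def eq_sym h neg //.
exists (p + s *: v); split=> j; first by rewrite finset.in_set0.
move=> _; rewrite /on_side finset.in_set0 affD.
have := hs j; case: eqP => [a0 _|_]; last by move=> h; lra.
by rewrite a0 add0r vT ?finset.in_set ?a0 // mulrN1 oppr_lt0.
Qed.

(** With fewer than [n] kinks, the gradient of the active part and the kink normals extend to linear
    coordinates. In the coordinate given by the gradient the germ is the identity, which is
    monotone. *)
Lemma conic_Morse_few_zeros p : pos_set p != finset.set0 -> (#|zero_set p| < n)%N ->
  conic_Morse (@dnet R n [:: N] t (sign_at p)).
Proof.
move=> S0 Tn; left; pose f : 'I_#|zero_set p| -> 'I_N := enum_val.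
have fS i : f i \notin pos_set p.
  have := enum_valP i; rewrite !finset.in_set => /eqP ->.
  by rewrite ltxx.
have := hx enum_val_inj Tn S0 fS.
pose A : 'M[R]_(#|zero_set p|.+1, n) := \matrix_(i, j)
  if unlift ord_max i is Some i' then weight (f i') 0 j else out_sum (pos_set p) j.
move=> /(row_free_of_minor (X := A) (kn := Tn)) Afree.
have {}Afree : row_free A.
  apply: Afree => i j; rewrite !mxE /=; case: unlift => [i'|//].
  by rewrite mxE /= /col_idx (leq_trans (ltn_ord j) Tn).
have [M Mu [g ginj gM]] := extend_row_free Afree.
(* Slopes in the new coordinates: [(outw, 0)] at a kink, [(1, 1)] for the gradient, [(0, 0)] for the
   coordinates that merely complete the basis. *)
pose co (c : option 'I_#|zero_set p|.+1) : R * R := if c is Some c then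
  if unlift ord_max c is Some c' then (outw (f c'), 0) else (1, 1) else (0, 0).
pose idx (i : 'I_n) := [pick c | g c == i].
have idxg c : idx (g c) = Some c.
  rewrite /idx; case: pickP => [c' /eqP/ginj ->//|/(_ c)]; by rewrite eqxx.
apply: (@conic_equiv_regular _ _ M^T _ (fun i => (co (idx i)).1) (fun i => (co (idx i)).2) (g ord_max)).
- by rewrite unitmx_tr.
- move=> x; rewrite (sum_injective_support ginj); last first.
    move=> j nj; rewrite /idx; case: pickP => [c /eqP gc|_]; first by have := nj c; rewrite gc eqxx.
    by rewrite /tau !mul0r subrr.
  have yE c : (x *m M^T) 0 (g c) = \sum_k A c k * x 0 k.
    rewrite mxE; apply: eq_bigr => k _; rewrite mxE mulrC; congr (_ * _).
    by have /rowP/(_ k) := gM c; rewrite !mxE.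
  rewrite dnetE big_ord_recr /= idxg /co unlift_none /= [RHS]addrC; congr (_ + _).
    rewrite /tau !mul1r reluB yE.
    under [RHS]eq_bigr do rewrite mxE unlift_none /out_sum mulr_suml.
    rewrite exchange_big /=; apply: eq_bigr => s _; rewrite mulr_sumr.
    by apply: eq_bigr => k _; rewrite col_idx_ord mxE mulrA.
  rewrite big_enum_val /=; apply: eq_bigr => i _.
  have -> : widen_ord (leqnSn #|zero_set p|) i = lift ord_max i.
    by apply/val_inj; rewrite /= /bump leqNgt ltn_ord.
  rewrite idxg liftK /= /tau mul0r subr0 yE; congr (_ * relu _).
  by apply: eq_bigr => k _; rewrite [in RHS]mxE liftK.
by rewrite idxg /co unlift_none /= mulr1.
Qed.

End OneLayer.

Section OneLayerVertex.
Variables (R : realType) (n' N : nat) (t : pidx -> R).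
Local Notation n := n'.+1.
Hypotheses (hm : minors_nonzero n N t) (hx : mixed_minors_nonzero n N t).

(** If [e i = 0], the gradient of [S] is a combination of the other [n'] normals, and the
    determinant bordered by them vanishes. The index [f i] itself is allowed in [S]. *)
Lemma coef_nonzero (f : 'I_n -> 'I_N) (S : {set 'I_N}) (e : 'I_n -> R) i :
  injective f -> S != finset.set0 -> (forall j, j != i -> f j \notin S) ->
  (forall k : 'I_n, out_sum n t S k = \sum_j e j * weight n t (f j) 0 k) -> e i != 0.
Proof.
move=> finj S0 fS LE; apply/eqP => ei0.
pose f' (j : 'I_n') := f (lift i j).
have f'inj : injective f' by move=> a b /finj/lift_inj.
have := hx f'inj (ltnSn n') S0; set X := bordered_mx _ _ _ _ => /(_ _)/negP; apply.
  by move=> j; apply: fS; rewrite eq_sym neq_lift.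
apply/negPn/negP => dX.
have Xu : X \in unitmx by rewrite unitmxE unitfE.
pose v : 'rV[R]_n := \row_c if unlift ord_max c is Some c' then - e (lift i c') else 1.
have vX : v *m X = 0.
  apply/rowP => k; rewrite mxE [RHS]mxE big_ord_recr /= !mxE unlift_none mul1r LE.
  rewrite (bigD1_ord i) //= ei0 mul0r add0r -big_split /=; apply: big1 => j _.
  have -> : widen_ord (leqnSn n') j = lift ord_max j.
    by apply/val_inj; rewrite /= /bump leqNgt ltn_ord.
  by rewrite !mxE liftK col_idx_ord mulNr addNr.
have : v = 0 by rewrite -[v](mulmxK Xu) vX mul0mx.
move/rowP/(_ ord_max); rewrite !mxE unlift_none => /eqP.
by rewrite oner_eq0.
Qed.

(** The [n] kink normals form a basis. If [c] are the coefficients of the active gradient in it, the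
    germ is a sum of functions with left slope [c 0 i] and right slope [c 0 i + outw t (f i)]. No
    slope vanishes, so either some pair has equal signs and the point is regular, or all pairs have
    opposite signs and it is critical. *)
Lemma conic_Morse_vertex (p : 'rV[R]_n) : pos_set N t p != finset.set0 -> #|zero_set N t p| = n ->
  conic_Morse (@dnet R n [:: N] t (sign_at N t p)).
Proof.
move=> S0 Tn; pose f (i : 'I_n) : 'I_N := enum_val (cast_ord (esym Tn) i).
have finj : injective f by move=> a b /enum_val_inj/cast_ord_inj.
have fT i : f i \in zero_set N t p by apply: enum_valP.
have fS i : f i \notin pos_set N t p.
  by have := fT i; rewrite !finset.in_set => /eqP ->; rewrite ltxx.
pose W : 'M[R]_n := \matrix_i weight n t (f i).
have Wu : W \in unitmx.
  rewrite unitmxE unitfE; have := hm finj (leqnSn n); rewrite /minor.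
  by congr (\det _ != 0); apply/matrixP => i j; rewrite !mxE col_idx_ord.
pose L : 'rV[R]_n := \row_k out_sum n t (pos_set N t p) k.
pose c := L *m invmx W.
have LE (k : 'I_n) : out_sum n t (pos_set N t p) k = \sum_j c 0 j * weight n t (f j) 0 k.
  have : L 0 k = (c *m W) 0 k by rewrite /c mulmxKV.
  by rewrite mxE => ->; rewrite mxE; apply: eq_bigr => j _; rewrite !mxE.
have c0 i : c 0 i != 0.
  by apply: (coef_nonzero finj S0 _ LE) => j _; apply: fS.
have ca0 i : c 0 i + outw t (f i) != 0.
  (* The right slope is the coefficient obtained when neuron [f i] joins the active set. *)
  have := @coef_nonzero f (f i |: pos_set N t p) (fun j => c 0 j + (j == i)%:R * outw t (f i)) i finj.
  rewrite eqxx mul1r; apply.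
  - by apply/finset.set0Pn; exists (f i); rewrite finset.setU11.
  - move=> j ji; rewrite finset.in_setU1 negb_or fS andbT.
    by apply: contra ji => /eqP/finj ->.
  move=> k; rewrite /out_sum finset.big_setU1 //= -/(out_sum n t (pos_set N t p) k) LE.
  rewrite addrC; under [RHS]eq_bigr do rewrite mulrDl.
  rewrite big_split /=; congr (_ + _).
  rewrite (bigD1 i) //= eqxx mul1r mxE col_idx_ord big1 ?addr0 // => j /negbTE ->.
  by rewrite !mul0r.
pose a i := c 0 i + outw t (f i).
have DE x : dnet [:: N] t (sign_at N t p) x =
    \sum_i tau (a i) (c 0 i) ((x *m W^T) 0 i).
  have yE i : (x *m W^T) 0 i = lin (weight n t) (f i) x.
    by rewrite mxE; apply: eq_bigr => k _; rewrite !mxE mulrC.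
  have tE (u v s : R) : tau (u + v) u s = u * s + v * relu s.
    by rewrite -{2}(reluB s) /tau; ring.
  under eq_bigr do rewrite /a tE yE.
  rewrite big_split /= dnetE; congr (_ + _).
    transitivity (\sum_k out_sum n t (pos_set N t p) (k : 'I_n) * x 0 k).
      under [RHS]eq_bigr do rewrite /out_sum mulr_suml.
      rewrite exchange_big /=; apply: eq_bigr => s _; rewrite mulr_sumr.
      by apply: eq_bigr => k _; rewrite col_idx_ord mxE mulrA.
    under [LHS]eq_bigr do rewrite LE mulr_suml.
    rewrite exchange_big /=; apply: eq_bigr => j _; rewrite mulr_sumr.
    by apply: eq_bigr => k _; rewrite mulrA.
  rewrite big_enum_val /= (reindex (cast_ord (esym Tn))) //.
  by exists (cast_ord Tn) => ? _; rewrite ?cast_ordK ?cast_ordKV.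
have WTu : W^T \in unitmx by rewrite unitmx_tr.
have [[i i0]|ni] := pselect (exists i, 0 < a i * c 0 i).
  by left; apply: conic_equiv_regular WTu DE i0.
right; apply: conic_equiv_critical WTu DE _ => i.
rewrite lt_def eq_sym mulf_neq0 ?c0 ?ca0 //=.
by rewrite leNgt; apply/negP => h; apply: ni; exists i.
Qed.

Lemma one_layer_PL_Morse :
  ~ cell (weight n t) (bias t) [set: 'I_N]%SET finset.set0 finset.set0 ->
  PL_Morse (@relu_net R n [:: N] t).
Proof.
move=> nflat; apply: conic_PL_Morse => p.
exists (sign_at N t p); first by move=> i j.
have S0 : pos_set N t p != finset.set0 by apply: pos_set_nonempty nflat.
have := card_zero_set hm p; rewrite leq_eqVlt => /orP[/eqP Tn|Tn].
  exact: conic_Morse_vertex.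
exact: conic_Morse_few_zeros.
Qed.

End OneLayerVertex.

(** * Flat regions and their probability *)

Section Flat.
Variables (R : realType) (n' : nat) (ns : seq nat) (th : pidx -> R).
Local Notation n := n'.+1.

Lemma dnet_off s : (0 < size ns)%N ->
  (forall j, (j < Defs.dim n ns 1)%N -> s 1%N j = Some false) ->
  forall x : 'rV[R]_n, dnet ns th s x = 0.
Proof.
move=> ns0 s1 x.
have d0 i j : (j < Defs.dim n ns i.+1)%N -> dhid (Defs.dim n ns) th s (inp x) i.+1 j = 0.
  elim: i j => [|i IH] j jd; first by rewrite /= s1.
  rewrite [LHS]/= big1 ?drelu0 // => k _.
  transitivity (th (i.+2, j, Some (k : nat)) * dhid (Defs.dim n ns) th s (inp x) i.+1 k) => //.
  by rewrite IH // mulr0.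
rewrite /dnet; case: (size ns) ns0 => // m _; apply: big1 => k _.
by rewrite d0 // mulr0.
Qed.

(** The cones [W] cover the space, so a model equivalent to 0 would vanish identically; but each
    model takes the value 1 or -1 at a basis vector. *)
Lemma not_conic_Morse0 : ~ conic_Morse (fun _ : 'rV[R]_n => 0).
Proof.
have md0 (md : 'rV[R]_n -> R) : conic_equiv (fun=> 0) md -> forall y, md y = 0.
  move=> [N [m [V [W [C [_ [_ cW _ _ h]]]]]]] y.
  by have [i [l [l0 _ ->]]] := cW y; rewrite -(h i l).
move=> [/md0/(_ (delta_mx 0 ord_max))|[k /md0/(_ (delta_mx 0 ord0))]].
  by rewrite (@reg_modelE R n ord_max) // mxE !eqxx => /eqP; rewrite oner_eq0.
rewrite /crit_model.
have E (P : pred 'I_n) : \sum_(j | P j) `|(delta_mx 0 ord0 : 'rV[R]_n) ord0 j| = (P ord0)%:R.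
  rewrite big_mkcond (bigD1 ord0) //= big1 ?addr0 => [|j /negbTE j0].
    by rewrite mxE !eqxx normr1; case: (P ord0).
  by rewrite mxE j0 andbF normr0 if_same.
rewrite !E; case: (val k) => [|m] /=; first by rewrite oppr0 add0r => /eqP; rewrite oner_eq0.
by rewrite addr0 => /eqP; rewrite oppr_eq0 oner_eq0.
Qed.

Lemma flat_not_PL_Morse : (0 < size ns)%N ->
  cell (weight n th) (bias th) [set: 'I_(Defs.dim n ns 1)]%SET finset.set0 finset.set0 ->
  ~ PL_Morse (@relu_net R n ns th).
Proof.
move=> ns0 [x [_ xneg]] FM.
pose s i j := rsign (preact ns th x i.-1 j).
have := @PL_Morse_conic R n ns th s x FM (fun i j _ _ => erefl).
rewrite (_ : dnet ns th s = fun=> 0); first exact: not_conic_Morse0.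
apply/funext => y; apply: dnet_off => // j jd.
have := xneg (Ordinal jd); rewrite finset.in_setT => /(_ isT).
rewrite /on_side finset.in_set0 /s /rsign /=.
have -> : preact ns th x 0 j = aff (weight n th) (bias th) (Ordinal jd) x.
  rewrite /preact /layer_affine /aff; congr (_ + _); apply: eq_bigr => k _.
  by rewrite mxE /= -inpE.
by move=> h; rewrite h ltNge ltW.
Qed.

End Flat.

Section FlatProbability.
Variables (R : realType) (n : nat) (ns : seq nat).
Local Notation T := (pspace R (param_idx n ns)).
Local Notation N := (Defs.dim n ns 1).

(** Flatness is the case [e = set0]; the other patterns enter through the symmetry argument. *)
Definition flat_set (e : {set 'I_N}) : set T :=
  [set t | cell (weight n t) (bias t) [set: 'I_N]%SET finset.set0 e].

Lemma measurable_aff j (x : 'rV[R]_n) :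
  measurable_fun setT (fun t : T => aff (weight n t) (bias t) (j : 'I_N) x).
Proof.
apply: measurable_funD.
  apply: measurable_sum => k.
  apply: (@measurable_fun_ext _ _ _ _ _ (fun t : T => t (1%N, j : nat, col_idx n k) * x 0 k)).
    by move=> t; rewrite mxE col_idx_ord.
  apply: measurable_funM; last exact: measurable_cst.
  by apply: measurable_proj; apply: valid_first; apply: ltnW.
have := @measurable_proj R _ (param_idx n ns) _ (valid_first j (leqnn n)).
by rewrite /col_idx ltnn.
Qed.

Lemma measurable_on_side e j (x : 'rV[R]_n) :
  measurable [set t : T | on_side (weight n t) (bias t) e (j : 'I_N) x].
Proof.
rewrite /on_side; case: (j \in e).
  have := measurable_aff j x measurableT (measurable_itv `]0, +oo[); rewrite setTI.
  by congr measurable; apply/seteqP; split=> t /=; rewrite in_itv /= andbT.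
have := measurable_aff j x measurableT (measurable_itv `]-oo, 0[); rewrite setTI.
by congr measurable; apply/seteqP; split=> t /=; rewrite in_itv.
Qed.

(** Cells are open, so a nonempty one contains a rational point; the existence of a point becomes a
    countable union. *)
Lemma cell_rational (w : 'I_N -> 'rV[R]_n) b (e : {set 'I_N}) :
  cell w b [set: 'I_N]%SET finset.set0 e <->
  exists c : 'rV[rat]_n, forall j, on_side w b e j (map_mx ratr c).
Proof.
split=> [[x [_ xS]]|[c cS]]; last first.
  by exists (map_mx ratr c); split=> [j|j _ //]; rewrite finset.in_set0.
have {}xS j : on_side w b e j x by apply: xS; rewrite finset.in_setT.
have [|d d0 hd] := @exists_small_scale R 'I_N (fun j => \sum_k `|w j 0 k|)
  (fun j => `|aff w b j x|).
  move=> j; rewrite normr_gt0; apply/eqP => aj.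
  by have := xS j; rewrite /on_side aj ltxx; case: ifP.
have /choice[c cP] k : exists q : rat, ratr q \in `](x 0 k - d), (x 0 k + d)[.
  by apply: rat_in_itvoo; lra.
exists (\row_k c k) => j; apply: on_side_perturb (xS j) _.
rewrite -linB; apply: le_lt_trans (hd j); rewrite mulrC mulr_suml.
apply: le_trans (ler_norm_sum _ _ _) _; apply: ler_sum => k _.
rewrite normrM; apply: ler_wpM2l => //; rewrite !mxE ler_norml.
by have := cP k; rewrite in_itv /= => /andP[h1 h2]; apply/andP; split; lra.
Qed.

Lemma measurable_flat_set e : measurable (flat_set e).
Proof.
rewrite (_ : flat_set e = [set t : T | exists c : 'rV[rat]_n, forall j : 'I_N,
    on_side (weight n t) (bias t) e j (map_mx ratr c)]); last first.
  by apply/seteqP; split=> t /= /cell_rational.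
apply: measurable_exists => c; apply: measurable_forall => j.
exact: measurable_on_side.
Qed.

Definition flip_rows (e : {set 'I_N}) (q : pidx) : bool :=
  (q.1.1 == 1%N) && (if insub q.1.2 is Some j then j \in e else false).

Lemma flip_flat_set e : flip (flip_rows e) @^-1` flat_set finset.set0 = flat_set e.
Proof.
have fE (t : T) (j : 'I_N) o : flip (flip_rows e) t (1%N, j : nat, o) =
    if j \in e then - t (1%N, j : nat, o) else t (1%N, j : nat, o).
  by rewrite /flip /flip_rows /= valK.
have affE (t : T) j x : aff (weight n (flip (flip_rows e) t)) (bias (flip (flip_rows e) t)) j x =
    if j \in e then - aff (weight n t) (bias t) j x else aff (weight n t) (bias t) j x.
  rewrite /aff /bias fE; case: ifP => je.
    rewrite opprD -sumrN; congr (_ + _); apply: eq_bigr => k _.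
    by rewrite !mxE fE je mulNr.
  by congr (_ + _); apply: eq_bigr => k _; rewrite !mxE fE je.
apply/seteqP; split=> t [x [_ xS]]; exists x; split=> j; rewrite ?finset.in_set0 //;
  move=> /xS; rewrite /on_side finset.in_set0 affE; case: ifP => _ //;
  by rewrite oppr_lt0.
Qed.

Variables (nu : probability T R) (mu : probability R R).
Hypothesis nu_box : forall A : pidx -> set R, (forall q, measurable (A q)) ->
  nu (box (param_idx n ns) A) = (\prod_(q <- param_idx n ns) mu (A q))%E.
Hypothesis mu_ac : mu `<< (@lebesgue_measure R).
Hypothesis mu_sym : symmetric_law mu.

Lemma as_nonzero_ae (f : T -> R) : as_nonzero nu f -> {ae nu, forall t, f t != 0}.
Proof.
move=> [mf f0]; exists [set t | f t = 0]; split=> //; first exact: measurable_eq0.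
by move=> t /=; move/negP/negPn/eqP.
Qed.

(** Row selections are represented by finite functions, so that finitely many null events are
    discarded. *)
Lemma ae_minors_nonzero : {ae nu, forall t, minors_nonzero n N t}.
Proof.
have h (k : 'I_n.+2) (f : {ffun 'I_k -> 'I_N}) :
    {ae nu, forall t, injective f -> minor n f t != 0}.
  have [finj|nfinj] := pselect (injective f); last by apply: aeW => t /nfinj.
  have := as_nonzero_ae (minor_nonzero nu_box mu_ac finj (ltn_ord k : (k <= n.+1)%N)).
  by apply: filterS => t.
have : {ae nu, forall t, forall (k : 'I_n.+2) (f : {ffun 'I_k -> 'I_N}),
    injective f -> minor n f t != 0}.
  by apply: filter_forall => k; apply: filter_forall => f; apply: h.
apply: (@filterS T (almost_everywhere nu) _) => t ht k f finj kn.
have kn' : (k < n.+2)%N by [].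
have -> : f = [ffun i => f i] by apply/funext => i; rewrite ffunE.
apply: (ht (Ordinal kn')) => i j; rewrite !ffunE; exact: finj.
Qed.

Lemma ae_mixed_minors_nonzero : size ns = 1%N ->
  {ae nu, forall t, mixed_minors_nonzero n N t}.
Proof.
move=> ns1.
have h (k : 'I_n) (f : {ffun 'I_k -> 'I_N}) (S : {set 'I_N}) :
    {ae nu, forall t, injective f -> S != finset.set0 -> (forall i, f i \notin S) ->
     \det (bordered_mx n f t (out_sum n t S)) != 0}.
  have [[finj S0 fS]|nh] := pselect [/\ injective f, S != finset.set0 & forall i, f i \notin S];
    last by apply: aeW => t h1 h2 h3; case: nh.
  have := as_nonzero_ae (mixed_det_nonzero nu_box mu_ac ns1 finj (ltn_ord k) S0 fS).
  by apply: filterS => t ht _ _ _; apply: ht.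
have : {ae nu, forall t, forall (k : 'I_n) (f : {ffun 'I_k -> 'I_N}) (S : {set 'I_N}),
    injective f -> S != finset.set0 -> (forall i, f i \notin S) ->
     \det (bordered_mx n f t (out_sum n t S)) != 0}.
  by do 3 apply: filter_forall => ?; apply: h.
apply: (@filterS T (almost_everywhere nu) _) => t ht k f S finj kn S0 fS.
have E : f = [ffun i => f i] by apply/funext => i; rewrite ffunE.
rewrite E; apply: (ht (Ordinal kn)) => // [i j|i]; rewrite !ffunE //; exact: finj.
Qed.

(* Flipping the signs of first-layer rows permutes the sign patterns, so all
   patterns are realized with the same probability, and almost surely exactly
   [\sum_(k < n.+1) 'C(N, k)] of them are realized. *)
Lemma flat_probability :
  ((2 ^ N)%:R%:E * nu (flat_set finset.set0) = (\sum_(k < n.+1) 'C(N, k))%N%:R%:E)%E.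
Proof.
have nuE e : nu (flat_set e) = nu (flat_set finset.set0).
  rewrite -flip_flat_set; apply: (flip_invariant nu_box) => //.
  exact: measurable_flat_set.
have -> : ((2 ^ N)%:R%:E * nu (flat_set finset.set0) = \sum_(e : {set 'I_N}) nu (flat_set e))%E.
  under eq_bigr do rewrite nuE.
  rewrite -(fineK (fin_num_measure nu _ (measurable_flat_set finset.set0))) sumEFin.
  rewrite sumr_const -EFinM mulr_natl; congr (_ *+ _)%:E.
  by rewrite -cardsT -powersetT card_powerset cardsT card_ord.
(* The sum of the probabilities is the expected number of realized patterns, and this number is
   almost surely constant. *)
transitivity (\sum_(e : {set 'I_N}) \int[nu]_t (\1_(flat_set e) t)%:E)%E.
  apply: eq_bigr => e _; rewrite integral_indic ?setIT //.
  exact: measurable_flat_set.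
rewrite -ge0_integral_sum //; last first.
  by move=> e; apply/measurable_EFinP; apply: measurable_indic; apply: measurable_flat_set.
transitivity (\int[nu]_t (cst (\sum_(k < n.+1) 'C(N, k))%N%:R%:E t))%E; last first.
  rewrite integral_cst // [X in (_ * X)%E](_ : _ = 1%E) ?mule1 //.
  exact: probability_setT.
apply: ge0_ae_eq_integral => //.
- by apply: emeasurable_sum => e; apply/measurable_EFinP; apply: measurable_indic; apply: measurable_flat_set.
- by move=> t _; apply: sume_ge0 => e _; rewrite lee_fin.
- by move=> t _; rewrite lee_fin ler0n.
apply: (@filterS T (almost_everywhere nu) _ _ _ _ ae_minors_nonzero) => t ht _.
have := ncells_general (general_position_of_minors ht); rewrite card_ord => nc.
rewrite /cst -nc /ncells.
rewrite sumEFin; congr (_%:E); rewrite natr_sum; apply: eq_big => e; first by rewrite finset.subsetT.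
by move=> _; rewrite indicE /flat_set; congr (_%:R); congr nat_of_bool.
Qed.

End FlatProbability.

(** * The probability of the PL Morse event *)

Lemma sum_bin_split n N :
  (\sum_(k < n.+1) 'C(N, k) + \sum_(n.+1 <= k < N.+1) 'C(N, k) = 2 ^ N)%N.
Proof.
have E : (2 ^ N = \sum_(0 <= k < N.+1) 'C(N, k))%N.
  by rewrite -[2%N]/(1 + 1)%N expnDn big_mkord; apply: eq_bigr => i _; rewrite !exp1n !muln1.
rewrite E -(big_mkord xpredT (fun k => 'C(N, k))).
have [nN|nN] := leqP n.+1 N.+1; first by rewrite -big_cat_nat.
(* Here [N < n]: the second sum is empty and the terms of the first beyond [N] vanish. *)
rewrite [X in (_ + X)%N]big_geq; last exact: ltnW.
rewrite addn0 (big_cat_nat (n := N.+1)) //=; last exact: ltnW.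
rewrite [X in (_ + X)%N]big_nat_cond [X in (_ + X)%N]big1 ?addn0 // => k.
by rewrite andbT => /andP[h _]; rewrite bin_small.
Qed.

Lemma pspace_PL_Morse_probability (R : realType) n' (ns : seq nat)
    (nu : probability (pspace R (param_idx n'.+1 ns)) R) (mu : probability R R) :
  let n := n'.+1 in let n1 := head 0%N ns in
  let c : R := (\sum_(n.+1 <= k < n1.+1) 'C(n1, k))%:R / (2 ^+ n1) in
  (0 < size ns)%N ->
  (forall A : pidx -> set R, (forall q, measurable (A q)) ->
    nu (box (param_idx n ns) A) = (\prod_(q <- param_idx n ns) mu (A q))%E) ->
  mu `<< (@lebesgue_measure R) -> symmetric_law mu ->
  if size ns == 1%N then nu [set t | PL_Morse (@relu_net R n ns t)] = c%:E
  else (nu [set t | PL_Morse (@relu_net R n ns t)] <= c%:E)%E.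
Proof.
move=> n n1 c ns0 nu_box mu_ac mu_sym.
set E := [set t : pspace R (param_idx n ns) | PL_Morse (@relu_net R n ns t)].
have mE : measurable E.
  apply: (@measurable_PL_Morse R n ns _ _ (fun q (t : pspace R (param_idx n ns)) => t q)) => q vq.
  by apply: measurable_proj; rewrite mem_param_idx.
pose N := Defs.dim n ns 1; have n1E : n1 = N by rewrite /N /n1; case: (ns) ns0.
pose F0 := @flat_set R n ns finset.set0.
have mF0 : measurable F0 by apply: measurable_flat_set.
have mF0C : measurable (~` F0) by apply: measurableC.
have mD : measurable (~` F0 `\` E) by apply: measurableD.
have EF0 : E `<=` ~` F0.
  by move=> t Mt Ft; apply: (flat_not_PL_Morse ns0 Ft Mt).
(* The binomials up to [n] and those beyond it add up to [2 ^ N], so [c] is the probability that no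
   flat pattern occurs. *)
have nuF0 : nu (~` F0) = c%:E.
  have := flat_probability nu_box mu_ac mu_sym; rewrite -/N -/F0.
  rewrite probability_setC // -(fineK (fin_num_measure nu _ mF0)) -EFinM -EFinB.
  move=> -[h]; congr (_%:E); rewrite /c n1E.
  have p0 : (2 ^+ N : R) != 0 by rewrite expf_neq0.
  have := congr1 (fun m : nat => m%:R : R) (sum_bin_split n N).
  rewrite natrD -h natrX => h'; apply: (mulIf p0); rewrite mulfVK //.
  by rewrite mulrBl mul1r -[X in X - _]h'; ring.
have le1 : (nu E <= c%:E)%E.
  by rewrite -nuF0; apply: le_measure EF0; apply: mem_set.
case: eqP => ns1 //.
apply/eqP; rewrite eq_le le1 /= -nuF0.
have nsE : ns = [:: N] by rewrite /N; case: (ns) ns1 => [|a [|]].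
(* Outside the null set where some determinant vanishes, a network without flat pattern is PL
   Morse. *)
have null : nu (~` F0 `\` E) = 0%E.
  apply: measure_negligible => //.
  have h1 := ae_minors_nonzero nu_box mu_ac.
  have h2 := ae_mixed_minors_nonzero nu_box mu_ac ns1.
  have [B [mB B0 sB]] := @filterI _ _ (ae_filter_ringOfSetsType nu) _ _ h1 h2.
  exists B; split=> // t [nF nE]; apply: sB => -[hm hx]; apply: nE; rewrite /E /= nsE.
  exact: (one_layer_PL_Morse hm hx).
apply: (@le_trans _ _ (nu E + nu (~` F0 `\` E))%E); last by rewrite null adde0.
apply: le_trans (measureU2 _ mE mD).
apply: le_measure; [exact: mem_set | apply: mem_set; exact: measurableU |].
by move=> t nF; have [Et|nE] := pselect (E t); [left | right].
Qed.
Theorem theorem1p2 (R : realType) (d : measure_display) (Om : measurableType d)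
    (P : probability Om R) (mu : probability R R)
    (n : nat) (ns : seq nat) (th : pidx -> Om -> R) :
  (0 < n)%N -> (0 < size ns)%N -> all (fun w => 0 < w)%N ns ->
  mu `<< (@lebesgue_measure R) -> symmetric_law mu ->
  iid_params P mu n ns th ->
  let E := [set om | PL_Morse (@relu_net R n ns (fun q => th q om))] in
  let n1 := head 0%N ns in
  let c : R := (\sum_(n.+1 <= k < n1.+1) 'C(n1, k))%:R / (2 ^+ n1) in
  measurable E /\
  (if size ns == 1%N then P E = c%:E else (P E <= c%:E)%E).
Proof.
case: n => // n' _ ns0 _ mu_ac mu_sym [mth [thmu thind]] E n1 c.
set n := n'.+1 in mth thmu thind E c *.
have mE : measurable E by apply: measurable_PL_Morse.
split=> //.
(* Pass to the law of the parameters. Independence and identical distribution say that it has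
   product values on boxes; zeros at invalid indices leave the network unchanged. *)
pose T := pspace R (param_idx n ns).
pose Th (om : Om) : T := fun q => if valid_idx n ns q then th q om else 0.
have mTh : measurable_fun setT Th.
  apply: measurable_into_pspace => q; rewrite mem_param_idx => vq.
  apply: (@measurable_fun_ext _ _ _ _ _ (th q)); last exact: mth.
  by move=> om; rewrite /Th vq.
pose X : {mfun Om >-> T} := mfun_Sub (mem_set mTh).
pose nu : probability T R := distribution P X.
have nuE (S : set T) : nu S = P (Th @^-1` S) by [].
have nu_box (A : pidx -> set R) : (forall q, measurable (A q)) ->
    nu (box (param_idx n ns) A) = (\prod_(q <- param_idx n ns) mu (A q))%E.
  move=> mA; rewrite nuE (_ : Th @^-1` _ =
      \bigcap_(q in [set q | q \in param_idx n ns]) (th q @^-1` A q)); last first.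
    apply/seteqP; split=> om /= h q /= qV; have := h q qV; rewrite /Th.
      by move: qV; rewrite mem_param_idx => ->.
    by move: qV; rewrite mem_param_idx => ->.
  rewrite thind //; first last.
  - by apply/allP => q; rewrite mem_param_idx.
  - exact: param_idx_uniq.
  by apply: eq_big_seq => q; rewrite mem_param_idx => vq; apply: thmu.
pose E' : set T := [set t | PL_Morse (@relu_net R n ns t)].
have PE : P E = nu E'.
  rewrite nuE; congr (P _); apply/seteqP; split=> om /=; rewrite /E' /E /=.
    by congr PL_Morse; apply/funext; apply: relu_net_ext => q vq; rewrite /Th vq.
  by congr PL_Morse; apply/funext; apply: relu_net_ext => q vq; rewrite /Th vq.
by rewrite PE; apply: (pspace_PL_Morse_probability ns0 nu_box mu_ac mu_sym).
Qed.
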